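(* Let $X\subset(\mathbb{C}^n,0)$ be an arbitrary germ of an analytic set and let $f\in\mathcal{O}_n$ be such that $\mu_X(f)<\infty$. Suppose also that $f\in\mathbf{m}^3$. If $\mu_X(f)=\tau_X(f)$, then the pair $(f,X)$ is relatively quasihomogeneous with respect to a system of weights $w\in\left(\left(0,\tfrac12\right)\cap\mathbb{Q}\right)^n$.
   Context: $\mathcal{O}_n$ is the ring of germs at $0$ of holomorphic functions on $\mathbb{C}^n$, $\mathbf{m}\subset\mathcal{O}_n$ its maximal ideal, and $\Theta\cong\mathcal{O}_n^n$ the module of germs at $0$ of holomorphic vector fields (derivations of $\mathcal{O}_n$). For a germ of an analytic variety $X\subset(\mathbb{C}^n,0)$ (with $0\in X$), $I_X\subset\mathcal{O}_n$ is the ideal of function germs vanishing on $X$, and $\Theta_X=\{\delta\in\Theta:\delta(I_X)\subseteq I_X\}$ is the module of logarithmic vector fields. For $f\in\mathcal{O}_n$, $df(\Theta_X)=\{\delta(f):\delta\in\Theta_X\}\subset\mathcal{O}_n$, and $$\mu_X(f)=\dim_{\mathbb{C}}\frac{\mathcal{O}_n}{df(\Theta_X)},\qquad \tau_X(f)=\dim_{\mathbb{C}}\frac{\mathcal{O}_n}{df(\Theta_X)+\langle f\rangle}$$ (Bruce-Roberts Milnor and Tjurina numbers). The pair $(f,X)$ is called relatively quasihomogeneous with respect to a system of weights $w=(w_1,\dots,w_n)\in\mathbb{Q}_+^n$ (positive rationals) if there exist a system of local holomorphic coordinates $x=(x_1,\dots,x_n)$ at $0\in\mathbb{C}^n$ (centred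 at $0$) and a system of generators $h_1,\dots,h_m$ of $I_X$ such that in these coordinates $$f(x)=\sum_{\langle w,s\rangle=1}a_s x^s,\qquad h_i(x)=\sum_{\langle w,s\rangle=d_i}b_{s,i}x^s,\quad i=1,\dots,m,$$ with $a_s,b_{s,i}\in\mathbb{C}$ and $d_i\in\mathbb{Q}_+$, where $s\in\mathbb{N}^n$ ranges over exponent vectors, $x^s=x_1^{s_1}\cdots x_n^{s_n}$ and $\langle w,s\rangle=\sum_i w_is_i$. *)

(* Defs.v *)
From HB Require Import structures.
From mathcomp Require Import all_boot all_order all_algebra.
From mathcomp Require Import complex.
From mathcomp Require Import all_classical all_reals all_analysis.

Set Implicit Arguments.
Unset Strict Implicit.
Unset Printing Implicit Defensive.

Import Order.TTheory GRing.Theory Num.Theory.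
Import numFieldNormedType.Exports.

Local Open Scope classical_set_scope.
Local Open Scope ring_scope.

(* The field of complex numbers; as a [numClosedFieldType] it carries the
   topology of the complex modulus, and [differentiable] on ['rV[CC R]_n] is
   complex (Frechet) differentiability. *)
Definition CC (R : realType) : numClosedFieldType := R[i]%C.

(* A germ at 0 is represented by any function on C^n having that germ. All the
   sets of functions below that stand for sets of germs are stable under
   [germ_eq], so quotients are insensitive to the choice of representatives. *)
Section Germs.
Variables (R : realType) (n : nat).
Local Notation C := (CC R).
Local Notation V := 'rV[CC R]_n.
Implicit Types (f g h : V -> C) (I J : set (V -> C)) (X : set V).

Definition germ_eq f g : Prop := \forall x \near (0 : V), f x = g x.

Definition On : set (V -> C) :=
  [set f | \forall x \near (0 : V), differentiable f x].

Definition maxideal : set (V -> C) := [set f | On f /\ f 0 = 0].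

Definition ideal_mul I J : set (V -> C) :=
  [set f | On f /\ exists (k : nat) (g h : 'I_k -> V -> C),
     (forall i, I (g i) /\ J (h i)) /\
     germ_eq f (fun x => \sum_(i < k) g i x * h i x)].

Fixpoint ideal_exp I (k : nat) : set (V -> C) :=
  if k is k'.+1 then ideal_mul I (ideal_exp I k') else On.

Definition ideal_add I J : set (V -> C) :=
  [set f | On f /\ exists g h, [/\ I g, J h & germ_eq f (fun x => g x + h x)]].

Definition ideal_gen (m : nat) (h : 'I_m -> V -> C) : set (V -> C) :=
  [set f | On f /\ exists a : 'I_m -> V -> C,
     (forall i, On (a i)) /\ germ_eq f (fun x => \sum_(i < m) a i x * h i x)].

Definition generators I (m : nat) (h : 'I_m -> V -> C) : Prop :=
  (forall i, I (h i)) /\ I = ideal_gen h.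

(* The classes of e_1, ..., e_k form a C-basis of O_n / J. *)
Definition quotient_basis J (k : nat) (e : 'I_k -> V -> C) : Prop :=
  (forall i, On (e i)) /\
  forall g, On g ->
    exists! c : 'rV[C]_k, J (fun x => g x - \sum_(i < k) c 0 i * e i x).

(* dim_C (O_n / J), with value +oo when there is no finite basis. *)
Definition quotient_dim J : \bar R :=
  xget +oo%E [set (k%:R)%:E | k in [set k | exists e : 'I_k -> V -> C,
                                              quotient_basis J e]].

(* X is the germ at 0 of an analytic set containing 0. *)
Definition analytic_germ X : Prop :=
  X 0 /\ exists (k : nat) (g : 'I_k -> V -> C),
    (forall i, On (g i)) /\
    \forall x \near (0 : V), X x <-> (forall i, g i x = 0).

Definition vanishing_ideal X : set (V -> C) :=
  [set h | On h /\ \forall x \near (0 : V), X x -> h x = 0].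

Definition vector_fields : set (V -> V) :=
  [set v | \forall x \near (0 : V), differentiable v x].

(* The derivation sum_i v_i (d/dx_i) attached to the vector field v. *)
Definition derivation (v : V -> V) f : V -> C := fun x => 'D_(v x) f x.

Definition log_vector_fields X : set (V -> V) :=
  [set v | vector_fields v /\
     forall h, vanishing_ideal X h -> vanishing_ideal X (derivation v h)].

Definition df_log X f : set (V -> C) :=
  [set g | On g /\ exists2 v, log_vector_fields X v & germ_eq g (derivation v f)].

Definition BR_milnor X f : \bar R := quotient_dim (df_log X f).

Definition BR_tjurina X f : \bar R :=
  quotient_dim (ideal_add (df_log X f) (ideal_gen (fun _ : 'I_1 => f))).

(* The rows x p = (x_1(p), ..., x_n(p)) form a holomorphic coordinate system
   centred at 0: x has a holomorphic local inverse y. *)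
Definition local_coordinates (x : V -> V) : Prop :=
  [/\ vector_fields x, x 0 = 0 &
      exists y : V -> V,
        [/\ vector_fields y, y 0 = 0,
            \forall p \near (0 : V), y (x p) = p &
            \forall q \near (0 : V), x (y q) = q]].

Definition weight (w : 'I_n -> rat) (s : {ffun 'I_n -> nat}) : rat :=
  \sum_(i < n) w i * (s i)%:R.

(* For positive weights the index set is finite, so that the finitely supported
   sum [\sum_(s \in _)] is an ordinary finite sum. *)
Definition quasihomogeneous (x : V -> V) (w : 'I_n -> rat) (d : rat) f : Prop :=
  exists a : {ffun 'I_n -> nat} -> C,
    germ_eq f (fun p => \sum_(s \in [set s | weight w s = d])
                          a s * \prod_(i < n) x p 0 i ^+ s i).

Definition relatively_quasihomogeneous f X (w : 'I_n -> rat) : Prop :=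
  (forall i, 0 < w i) /\
  exists (x : V -> V) (m : nat) (h : 'I_m -> V -> C) (d : 'I_m -> rat),
    [/\ local_coordinates x,
        generators (vanishing_ideal X) h,
        quasihomogeneous x w 1 f &
        forall i, 0 < d i /\ quasihomogeneous x w (d i) (h i)].

End Germs.

(* Main.v *)
Require Import Defs.
From HB Require Import structures.
From mathcomp Require Import all_boot all_order all_algebra.
From mathcomp Require Import complex.
From mathcomp Require Import all_classical all_reals all_analysis.
From mathcomp Require Import ring lra.
Import Order.TTheory GRing.Theory Num.Theory.
Import numFieldNormedType.Exports.
Local Open Scope classical_set_scope.
Local Open Scope ring_scope.
Set Implicit Arguments.
Unset Strict Implicit.
Unset Printing Implicit Defensive.

(* Saito's argument, relative to X. Goursat's theorem and Osgood's lemma identify O_n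
   with the ring of convergent power series. As mu = tau is finite, f lies in
   df(Theta_X), i.e. T f = f for a logarithmic T, and m^[d] (d-th powers of elements
   of m) is contained in df(Theta_X); together with f in m^3 this forces T to vanish
   at 0. In coordinates that are generalized eigenvectors of T modulo a high power of
   m, f has weight 1 up to that order, and x_i^d in df(Theta_X) puts a monomial
   x_i^k x_j with 2 <= k <= d into f. The equations k_i lam_i + lam_(j_i) = 1 have only
   one solution, which is rational and lies in (0, 1/2). Since all the eigenvalues are
   positive, T - lam_i maps m^K onto itself, with convergent solutions, and the
   coordinates can be corrected to exact generalized eigenvectors. There f is
   quasihomogeneous of weight 1; the weighted components of an element of I_X lie in
   I_X + m^K for all K, hence in I_X by Krull, and those of a standard basis generate. *)

(** The equality of mu and tau enters through linear algebra: nested subspaces of the same finite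
    codimension coincide, so df(Theta_X) + (f) = df(Theta_X). The exponent d is mu_X(f), because 1,
    l, ..., l^mu are dependent modulo df(Theta_X). The obstacle is convergence: linear algebra gives
    eigencoordinates only modulo m^K, and T may have a nilpotent part. The bound k <= d turns the
    equations for the weights into lam_i >= 1 / (2 d), so |<lam, s> - lam_i| grows linearly with
    |s|. There are no small divisors, and the growth absorbs the factor |s| produced when the
    off-diagonal part of T differentiates x^s. K is chosen so that the monomials x_i^k x_j are
    visible modulo m^K and the growth has set in. One contraction in a weighted l1 norm yields both
    the solution of (T - lam) u = g and division with remainder for convergent series. Division is
    needed because an element of I_X may have infinitely many weighted components, among which
    finitely many generators have to be found. *)

(** * The modulus of a complex number as a real number *)

Section ComplexModulus.
Variable R : realType.
Local Notation C := (CC R).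
Implicit Types (z w : C).

(** The norm of [CC R] takes its values in [CC R] itself; a modulus in [R] keeps the estimates in a
    real field, where [lra] and [nra] apply. *)
Definition nrm z : R := Normc.normc (z : R[i]).
Definition rc (r : R) : C := (r%:C)%C.

Lemma normC_nrm z : `|z| = rc (nrm z). Proof. by []. Qed.
Lemma nrm_ge0 z : 0 <= nrm z.
Proof. by rewrite /nrm; case: z => a b /=; rewrite sqrtr_ge0. Qed.
Lemma nrm0 : nrm 0 = 0. Proof. exact: Normc.normc0. Qed.
Lemma nrm1 : nrm 1 = 1. Proof. exact: Normc.normc1. Qed.
Lemma nrm_eq0 z : nrm z = 0 -> z = 0. Proof. exact: Normc.eq0_normc. Qed.
Lemma nrm_gt0 z : z != 0 -> 0 < nrm z.
Proof.
move=> z0; rewrite lt_neqAle nrm_ge0 andbT eq_sym.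
by apply: contra z0 => /eqP/nrm_eq0 ->.
Qed.
Lemma nrmM z w : nrm (z * w) = nrm z * nrm w. Proof. exact: Normc.normcM. Qed.
Lemma nrmV z : nrm z^-1 = (nrm z)^-1. Proof. exact: Normc.normcV. Qed.
Lemma nrmX z k : nrm (z ^+ k) = nrm z ^+ k.
Proof. by elim: k => [|k IH]; rewrite ?nrm1 // !exprS nrmM IH. Qed.
Lemma nrmD z w : nrm (z + w) <= nrm z + nrm w. Proof. exact: le_normcD. Qed.
Lemma nrmN z : nrm (- z) = nrm z. Proof. exact: normcN. Qed.
Lemma nrmB z w : nrm (z - w) <= nrm z + nrm w.
Proof. by rewrite -(nrmN w) nrmD. Qed.
Lemma nrmBC z w : nrm (z - w) = nrm (w - z). Proof. by rewrite -nrmN opprB. Qed.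
Lemma nrm_tri z w u : nrm (z - u) <= nrm (z - w) + nrm (w - u).
Proof. by apply: le_trans (nrmD _ _); rewrite addrA subrK. Qed.
Lemma nrm_rc (r : R) : nrm (rc r) = `|r|.
Proof. by rewrite /nrm /= expr0n addr0 sqrtr_sqr. Qed.
Lemma nrm_nat (k : nat) : nrm k%:R = k%:R.
Proof. by rewrite (_ : k%:R = rc k%:R) ?nrm_rc ?normr_nat // /rc rmorph_nat. Qed.
Lemma nrm_i (r : R) : nrm (Complex 0 r : C) = `|r|.
Proof. by rewrite /nrm /= expr0n add0r sqrtr_sqr. Qed.
Lemma nrm_sum (I : Type) (s : seq I) (P : pred I) (F : I -> C) :
  nrm (\sum_(i <- s | P i) F i) <= \sum_(i <- s | P i) nrm (F i).
Proof.
elim/big_ind2: _ => [|x1 x2 y1 y2 h1 h2|//]; first by rewrite nrm0.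
by apply: le_trans (nrmD _ _) _; exact: lerD.
Qed.
Lemma nrm_Re z : `|complex.Re z| <= nrm z.
Proof.
case: z => a b; rewrite /nrm /= -sqrtr_sqr ler_sqrt ?lerDl ?sqr_ge0 //.
by rewrite addr_ge0 ?sqr_ge0.
Qed.
Lemma nrm_Im z : `|complex.Im z| <= nrm z.
Proof.
case: z => a b; rewrite /nrm /= -sqrtr_sqr ler_sqrt ?lerDr ?sqr_ge0 //.
by rewrite addr_ge0 ?sqr_ge0.
Qed.
Lemma complexRI (a b : R) : Complex a b = rc a + Complex 0 b :> C.
Proof. by apply/eqP; rewrite eq_complex /= addr0 add0r !eqxx. Qed.
Lemma nrm_ReIm z : nrm z <= `|complex.Re z| + `|complex.Im z|.
Proof.
case: z => a b; rewrite complexRI; apply: le_trans (nrmD _ _) _.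
by rewrite nrm_rc nrm_i /= addr0 add0r.
Qed.
Lemma ReB z w : complex.Re (z - w) = complex.Re z - complex.Re w.
Proof. by case: z; case: w. Qed.
Lemma ImB z w : complex.Im (z - w) = complex.Im z - complex.Im w.
Proof. by case: z; case: w. Qed.
Lemma rcM (a b : R) : rc (a * b) = rc a * rc b. Proof. exact: rmorphM. Qed.

Lemma nearC (z : C) (P : set C) :
  (\forall w \near z, P w) <-> exists2 e : R, 0 < e & forall w, nrm (w - z) < e -> P w.
Proof.
split.
  move=> /nbhs_ballP[e /= e0 he]; exists (complex.Re e).
    by move: e0; rewrite ltcE => /andP[].
  move=> w hw; apply: he; rewrite /ball /= normC_nrm ltcE /=.
  by rewrite nrmBC hw andbT; move: e0; rewrite ltcE => /andP[].
move=> [e e0 he]; apply/nbhs_ballP; exists (rc e) => /=; first by rewrite /rc ltcR.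
move=> w; rewrite /ball /= normC_nrm /rc ltcR nrmBC; exact: he.
Qed.

Lemma contC (F : C -> C) (z : C) : {for z, continuous F} <->
  forall e : R, 0 < e -> exists2 d : R, 0 < d &
    forall w, nrm (w - z) < d -> nrm (F w - F z) < e.
Proof.
split.
  move=> h e e0.
  by have /nearC [d d0 hd] : \forall w \near z, nrm (F w - F z) < e;
    [apply: (h [set u | nrm (u - F z) < e]); apply/nearC; exists e|exists d].
move=> h A /nearC [e e0 he]; have [d d0 hd] := h e e0.
by apply/nearC; exists d => // w /hd /he.
Qed.

Lemma contR (g : R -> R) (x : R) : {for x, continuous g} <->
  forall e : R, 0 < e -> exists2 d : R, 0 < d &
    forall y, `|y - x| < d -> `|g y - g x| < e.
Proof.
split.
  move=> /cvgrPdist_lt h e e0; have /nbhs_ballP[d /= d0 hd] := h _ e0.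
  by exists d => // y hy; rewrite distrC; apply: hd; rewrite /ball /= distrC.
move=> h; apply/cvgrPdist_lt => e e0; have [d d0 hd] := h e e0.
by apply/nbhs_ballP; exists d => // y; rewrite /ball /= distrC => /hd; rewrite distrC.
Qed.
End ComplexModulus.
Arguments nrm : simpl never.
Arguments rc : simpl never.

(** * Integrals of complex functions over a real interval *)

Section IntervalIntegral.
Variable R : realType.
Local Notation C := (CC R).
Local Notation mu := (@lebesgue_measure R).
Implicit Types (a b : R) (g h : R -> C).

(** Continuity is taken in R and not relative to [a, b]: it restricts to subintervals at once and is
    the form that [integrable_cont] consumes. *)
Definition cts a b g := forall x, a <= x <= b ->
  forall e : R, 0 < e -> exists2 d : R, 0 < d &
    forall y, `|y - x| < d -> nrm (g y - g x) < e.

Definition integral_ab a b g : C :=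
  Complex (\int[mu]_(x in `[a, b]) complex.Re (g x))
          (\int[mu]_(x in `[a, b]) complex.Im (g x)).

Lemma integrable_cont a b (g : R -> R) :
  (forall x, a <= x <= b -> {for x, continuous g}) ->
  mu.-integrable `[a, b]%classic (EFin \o g).
Proof.
move=> h; apply: continuous_compact_integrable; first exact: segment_compact.
by apply: continuous_in_subspaceT => x; rewrite inE /= in_itv /=; exact: h.
Qed.

Lemma cts_Re a b g : cts a b g -> mu.-integrable `[a, b]%classic (EFin \o (fun x => complex.Re (g x))).
Proof.
move=> h; apply: integrable_cont => x hx; apply/contR => e e0.
have [d d0 hd] := h x hx e e0; exists d => // y /hd.
by apply: le_lt_trans; rewrite /= -ReB nrm_Re.
Qed.
Lemma cts_Im a b g : cts a b g -> mu.-integrable `[a, b]%classic (EFin \o (fun x => complex.Im (g x))).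
Proof.
move=> h; apply: integrable_cont => x hx; apply/contR => e e0.
have [d d0 hd] := h x hx e e0; exists d => // y /hd.
by apply: le_lt_trans; rewrite /= -ImB nrm_Im.
Qed.

Lemma eq_integral_ab a b g h : (forall x, a <= x <= b -> g x = h x) ->
  integral_ab a b g = integral_ab a b h.
Proof.
move=> gh; rewrite /integral_ab; congr Complex;
  by apply: eq_Rintegral => x; rewrite inE /= in_itv /= => /gh ->.
Qed.

Lemma integral_abD a b g h : cts a b g -> cts a b h ->
  integral_ab a b (fun x => g x + h x) = integral_ab a b g + integral_ab a b h.
Proof.
move=> cg ch; rewrite /integral_ab.
have E : forall z w : C, complex.Re (z + w) = complex.Re z + complex.Re w /\
   complex.Im (z + w) = complex.Im z + complex.Im w by move=> [? ?] [? ?].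
apply/eqP; rewrite eq_complex /=; apply/andP; split; apply/eqP.
  by rewrite -(RintegralD _ (cts_Re cg) (cts_Re ch)) //; congr (Rintegral _ _ _);
    apply/funext => x; case: (E (g x) (h x)).
by rewrite -(RintegralD _ (cts_Im cg) (cts_Im ch)) //; congr (Rintegral _ _ _);
    apply/funext => x; case: (E (g x) (h x)).
Qed.

Lemma integral_abZ a b g (c : C) : cts a b g ->
  integral_ab a b (fun x => c * g x) = c * integral_ab a b g.
Proof.
move=> cg; rewrite /integral_ab; case: c => p q.
have iR := cts_Re cg; have iI := cts_Im cg.
have iz : forall (r : R) (u : R -> R), mu.-integrable `[a, b]%classic (EFin \o u) ->
    mu.-integrable `[a, b]%classic (EFin \o (fun x => r * u x)).
  move=> r u hu; rewrite (_ : _ \o _ = fun x => (r%:E * (u x)%:E)%E); last first.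
    by apply/funext => x; rewrite /= EFinM.
  by apply: integrableZl.
apply/eqP; rewrite eq_complex /=; apply/andP; split; apply/eqP.
  rewrite -!RintegralZl // -RintegralB //; try exact: iz.
  by congr (Rintegral _ _ _); apply/funext => x /=; case: (g x).
rewrite -!RintegralZl // -RintegralD //; try exact: iz.
by congr (Rintegral _ _ _); apply/funext => x /=; case: (g x).
Qed.

Lemma integral_ab_split a b m g : a <= m -> m <= b -> cts a b g ->
  integral_ab a b g = integral_ab a m g + integral_ab m b g.
Proof.
move=> am mb cg.
have key (u : R -> R) : mu.-integrable `[a, b]%classic (EFin \o u) ->
  \int[mu]_(x in `[a, b]) u x =
   \int[mu]_(x in `[a, m]) u x + \int[mu]_(x in `[m, b]) u x.
  move=> iu; have iu' : mu.-integrable `]m, b]%classic (EFin \o u).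
    by apply: integrableS iu => //; apply: subset_itvr; rewrite bnd_simp.
  rewrite -(Rintegral_itv_obnd_cbnd iu').
  rewrite -(@Rintegral_itvB _ u (BLeft a) (BRight b) m) //; first by rewrite addrC subrK.
rewrite /integral_ab (key _ (cts_Re cg)) (key _ (cts_Im cg)).
by apply/eqP; rewrite eq_complex /= !eqxx.
Qed.

(** The factor 2 comes from bounding real and imaginary parts separately; the 4 of [contour_le] and
    the 16 of [sq_le] descend from it. *)
Lemma integral_ab_le a b g (M : R) : a <= b -> cts a b g ->
  (forall x, a <= x <= b -> nrm (g x) <= M) ->
  nrm (integral_ab a b g) <= 2 * M * (b - a).
Proof.
move=> ab cg hM.
have key (u : R -> R) : mu.-integrable `[a, b]%classic (EFin \o u) ->
  (forall x, a <= x <= b -> `|u x| <= M) -> `|\int[mu]_(x in `[a, b]) u x| <= M * (b - a).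
  move=> iu hu; apply: le_trans (le_normr_Rintegral _ iu) _ => //.
  apply: (@le_trans _ _ (\int[mu]_(x in `[a, b]) M)).
    apply: le_Rintegral => //.
    - exact: (integrable_norm iu).
    - by apply: integrable_cont => x _; exact: cvg_cst.
  rewrite Rintegral_cst //= lebesgue_measure_itv /= lte_fin.
  by move: ab; rewrite le_eqVlt => /predU1P[->|->]; rewrite ?ltxx ?subrr /= ?mulr0.
apply: le_trans (nrm_ReIm _) _; rewrite /= -mulrA mulr_natl mulr2n; apply: lerD.
  by apply: key (cts_Re cg) _ => x hx; apply: le_trans (nrm_Re _) (hM _ hx).
by apply: key (cts_Im cg) _ => x hx; apply: le_trans (nrm_Im _) (hM _ hx).
Qed.

Lemma cts_cst a b (c : C) : cts a b (fun=> c).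
Proof. by move=> x _ e e0; exists 1 => // y _; rewrite subrr nrm0. Qed.
Lemma ctsM a b g h : cts a b g -> cts a b h -> cts a b (fun x => g x * h x).
Proof.
move=> cg ch x hx e e0; set M := 1 + nrm (g x) + nrm (h x).
have M1 : 1 <= M by rewrite /M; have := nrm_ge0 (g x); have := nrm_ge0 (h x); lra.
have e2 : 0 < Num.min 1 (e / (3 * M)).
  by rewrite lt_min ltr01 /=; apply: divr_gt0 => //; lra.
have [d1 d10 h1] := cg x hx _ e2; have [d2 d20 h2] := ch x hx _ e2.
exists (Num.min d1 d2); first by rewrite lt_min d10 d20.
move=> y; rewrite lt_min => /andP[/h1 k1 /h2 k2].
have -> : g y * h y - g x * h x =
  (g y - g x) * (h y - h x) + (g y - g x) * h x + g x * (h y - h x) by ring.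
apply: le_lt_trans (nrmD _ _) _; apply: le_lt_trans (lerD (nrmD _ _) (lexx _)) _.
rewrite !nrmM; move: k1 k2; rewrite !lt_min => /andP[a1 a2] /andP[b1 b2].
have E : e = 3 * M * (e / (3 * M)) by field; lra.
set q := e / (3 * M) in a2 b2 E *; rewrite {}E.
have q0 : 0 < q by apply: divr_gt0 => //; lra.
have := nrm_ge0 (g x); have := nrm_ge0 (h x); rewrite /M in M1 *.
have := nrm_ge0 (g y - g x); have := nrm_ge0 (h y - h x).
move: (nrm (g y - g x)) (nrm (h y - h x)) (nrm (h x)) (nrm (g x)) a1 a2 b1 b2 M1.
by clear -q0 => A B H G; nra.
Qed.
End IntervalIntegral.

(** * Goursat's theorem on rectangles *)

Section Goursat.
Variable R : realType.
Local Notation C := (CC R).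
Implicit Types (a b c d : R) (F G : C -> C).

Definition ccont F (z : C) := forall e : R, 0 < e -> exists2 d : R, 0 < d &
    forall w, nrm (w - z) < d -> nrm (F w - F z) < e.
(* Caratheodory's form of complex differentiability. *)
Definition cdiff F (z : C) := exists2 phi : C -> C, ccont phi z &
  forall w, F w = F z + phi w * (w - z).

Definition pt (x y : R) : C := Complex x y.

Lemma ptB x y x' y' : nrm (pt x y - pt x' y') <= `|x - x'| + `|y - y'|.
Proof. exact: nrm_ReIm. Qed.

Lemma ccont_ctsx F a b y : (forall x, a <= x <= b -> ccont F (pt x y)) ->
  cts a b (fun x => F (pt x y)).
Proof.
move=> h x /h hx e /hx [d d0 hd]; exists d => // u hu; apply: hd.
by apply: le_lt_trans (ptB _ _ _ _) _; rewrite subrr normr0 addr0.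
Qed.
Lemma ccont_ctsy F c d x : (forall y, c <= y <= d -> ccont F (pt x y)) ->
  cts c d (fun y => F (pt x y)).
Proof.
move=> h y /h hy e /hy [r r0 hr]; exists r => // u hu; apply: hr.
by apply: le_lt_trans (ptB _ _ _ _) _; rewrite subrr normr0 add0r.
Qed.

Definition crect F a b c d :=
  forall x y, a <= x <= b -> c <= y <= d -> ccont F (pt x y).

Lemma crect_sub F a b c d a' b' c' d' : a <= a' -> b' <= b -> c <= c' -> d' <= d ->
  crect F a b c d -> crect F a' b' c' d'.
Proof. by move=> h1 h2 h3 h4 h x y hx hy; apply: h; lra. Qed.

(** Integral along the boundary of [a, b] x [c, d], counterclockwise; the factor ['i] is dz = i dy
    on the vertical sides. *)
Definition contour F a b c d : C :=
  integral_ab a b (fun x => F (pt x c)) - integral_ab a b (fun x => F (pt x d)) +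
  'i%C * (integral_ab c d (fun y => F (pt b y)) - integral_ab c d (fun y => F (pt a y))).

Lemma crect_x F a b c d y : crect F a b c d -> c <= y <= d -> cts a b (fun x => F (pt x y)).
Proof. by move=> h hy; apply: ccont_ctsx => x hx; exact: h. Qed.
Lemma crect_y F a b c d x : crect F a b c d -> a <= x <= b -> cts c d (fun y => F (pt x y)).
Proof. by move=> h hy; apply: ccont_ctsy => y hx; exact: h. Qed.

(** Continuity at boundary points only: integrands such as f(z) z^-k are singular inside the
    square. *)
Definition cbd F a b c d := forall x y, a <= x <= b -> c <= y <= d ->
  [|| x == a, x == b, y == c | y == d] -> ccont F (pt x y).

Lemma crect_bd F a b c d : crect F a b c d -> cbd F a b c d.
Proof. by move=> h x y hx hy _; exact: h. Qed.
Lemma cbd_x F a b c d y : cbd F a b c d -> c <= d -> (y == c) || (y == d) ->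
  cts a b (fun x => F (pt x y)).
Proof.
move=> h cd hy; apply: ccont_ctsx => x hx; apply: h => //; last by rewrite hy !orbT.
by case/orP: hy => /eqP ->; rewrite lexx cd.
Qed.
Lemma cbd_y F a b c d x : cbd F a b c d -> a <= b -> (x == a) || (x == b) ->
  cts c d (fun y => F (pt x y)).
Proof.
move=> h ab hx; apply: ccont_ctsy => y hy; apply: h => //; last by case/orP: hx => ->; rewrite ?orbT.
by case/orP: hx => /eqP ->; rewrite lexx ab.
Qed.

(** The two integrals along the cut cancel as terms, whatever their values, so only the horizontal
    sides are split and continuity on the outer boundary suffices. *)
Lemma contour_splitx F a m b c d : a <= m -> m <= b -> c <= d -> cbd F a b c d ->
  contour F a b c d = contour F a m c d + contour F m b c d.
Proof.
move=> am mb cd h; rewrite /contour.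
rewrite !(@integral_ab_split _ a b m) //; first ring.
- by apply: cbd_x h _ _; rewrite ?eqxx ?orbT.
- by apply: cbd_x h _ _; rewrite ?eqxx ?orbT.
Qed.
Lemma contour_splity F a b c m d : c <= m -> m <= d -> a <= b -> cbd F a b c d ->
  contour F a b c d = contour F a b c m + contour F a b m d.
Proof.
move=> am mb cd h; rewrite /contour.
rewrite !(@integral_ab_split _ c d m) //; first ring.
- by apply: cbd_y h _ _; rewrite ?eqxx ?orbT.
- by apply: cbd_y h _ _; rewrite ?eqxx ?orbT.
Qed.

Lemma nrmI : nrm ('i%C : C) = 1.
Proof. by rewrite (nrm_i (1 : R)) normr1. Qed.

Lemma contour_le F a b c d (M : R) : a <= b -> c <= d -> cbd F a b c d ->
  (forall x y, a <= x <= b -> c <= y <= d -> [|| x == a, x == b, y == c | y == d] ->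
     nrm (F (pt x y)) <= M) ->
  nrm (contour F a b c d) <= 4 * M * ((b - a) + (d - c)).
Proof.
move=> ab cd h hM; rewrite /contour; apply: le_trans (nrmD _ _) _.
have hx y : (y == c) || (y == d) ->
    nrm (integral_ab a b (fun x => F (pt x y))) <= 2 * M * (b - a).
  move=> hy; apply: integral_ab_le => //; first exact: cbd_x h cd hy.
  move=> x hx; apply: hM => //; last by rewrite hy !orbT.
  by case/orP: hy => /eqP ->; rewrite lexx cd.
have hy x : (x == a) || (x == b) ->
    nrm (integral_ab c d (fun y => F (pt x y))) <= 2 * M * (d - c).
  move=> hx'; apply: integral_ab_le => //; first exact: cbd_y h ab hx'.
  move=> y hy; apply: hM => //; last by case/orP: hx' => ->; rewrite ?orbT.
  by case/orP: hx' => /eqP ->; rewrite lexx ab.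
rewrite nrmM nrmI mul1r; apply: le_trans (lerD (nrmB _ _) (nrmB _ _)) _.
have := hx c; have := hx d; have := hy a; have := hy b.
rewrite !eqxx !orbT => /(_ isT) h1 /(_ isT) h2 /(_ isT) h3 /(_ isT) h4.
by apply: le_trans (lerD (lerD h4 h3) (lerD h1 h2)) _; lra.
Qed.

Lemma integral_ab_cst a b (k : C) : a <= b -> integral_ab a b (fun=> k) = rc (b - a) * k.
Proof.
move=> ab; rewrite /integral_ab !Rintegral_cst //= lebesgue_measure_itv /= lte_fin.
have -> : fine (if a < b then (b%:E + (- a)%:E)%E else 0%E) = b - a.
  by move: ab; rewrite le_eqVlt => /predU1P[->|->]; rewrite ?ltxx ?subrr.
by case: k => p q; apply/eqP; rewrite eq_complex /= !mul0r addr0 subr0 ![_ * (b - a)]mulrC !eqxx.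
Qed.

Lemma integral_abB a b (g h : R -> C) : cts a b g -> cts a b h ->
  integral_ab a b (fun x => g x - h x) = integral_ab a b g - integral_ab a b h.
Proof.
move=> cg ch; have ch' := ctsM (cts_cst (a := a) (b := b) (-1 : C)) ch.
rewrite -mulN1r -integral_abZ // -integral_abD //.
by apply: eq_integral_ab => x _; rewrite mulN1r.
Qed.

Lemma contourD F G a b c d : a <= b -> c <= d -> cbd F a b c d -> cbd G a b c d ->
  contour (fun z => F z + G z) a b c d = contour F a b c d + contour G a b c d.
Proof.
move=> ab cd hF hG; rewrite /contour.
rewrite !integral_abD; first ring.
all: first [by apply: (cbd_x hF); rewrite ?eqxx ?orbT | by apply: (cbd_y hF); rewrite ?eqxx ?orbT
   | by apply: (cbd_x hG); rewrite ?eqxx ?orbT | by apply: (cbd_y hG); rewrite ?eqxx ?orbT].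
Qed.

Lemma contourZ F a b c d (k : C) : a <= b -> c <= d -> cbd F a b c d ->
  contour (fun z => k * F z) a b c d = k * contour F a b c d.
Proof.
move=> ab cd hF; rewrite /contour.
rewrite !integral_abZ; first ring.
all: first [by apply: (cbd_x hF); rewrite ?eqxx ?orbT | by apply: (cbd_y hF); rewrite ?eqxx ?orbT].
Qed.

Lemma eq_contour F G a b c d : a <= b -> c <= d ->
  (forall x y, a <= x <= b -> c <= y <= d ->
     [|| x == a, x == b, y == c | y == d] -> F (pt x y) = G (pt x y)) ->
  contour F a b c d = contour G a b c d.
Proof.
move=> ab cd h; rewrite /contour.
by congr (_ - _ + _ * (_ - _)); apply: eq_integral_ab => u hu; apply: h;
  rewrite ?lexx ?ab ?cd ?eqxx ?orbT.
Qed.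

(** The integrands on opposite sides differ by a constant; each pair of sides gives that constant
    times a length, and the two products cancel. *)
Lemma contour_affine (p q : C) a b c d : a <= b -> c <= d ->
  crect (fun z => p + q * z) a b c d -> contour (fun z => p + q * z) a b c d = 0.
Proof.
move=> ab cd h; rewrite /contour -!integral_abB; first last.
- by apply: crect_x h _; lra.
- by apply: crect_x h _; lra.
- by apply: crect_y h _; lra.
- by apply: crect_y h _; lra.
rewrite (@eq_integral_ab _ a b _ (fun=> q * ('i%C * rc (c - d)))); last first.
  move=> x _; rewrite opprD addrACA subrr add0r -mulrBr; congr (_ * _).
  by apply/eqP; rewrite eq_complex /=; apply/andP; split; apply/eqP; ring.
rewrite (@eq_integral_ab _ c d _ (fun=> q * (rc (b - a)))); last first.
  move=> x _; rewrite opprD addrACA subrr add0r -mulrBr; congr (_ * _).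
  by apply/eqP; rewrite eq_complex /=; apply/andP; split; apply/eqP; ring.
rewrite !integral_ab_cst //.
have -> : rc (c - d) = - rc (d - c) by rewrite -opprB /rc rmorphN.
ring.
Qed.

Lemma ccont_cst (k : C) z : ccont (fun=> k) z.
Proof. by move=> e e0; exists 1 => // w _; rewrite subrr nrm0. Qed.
Lemma ccont_id z : ccont id z.
Proof. by move=> e e0; exists e. Qed.
Lemma ccontP F z : ccont F z <-> F @ z --> F z.
Proof. by split=> [h|h]; [exact: (contC F z).2 h|exact: (contC F z).1 h]. Qed.
Lemma ccontD F G z : ccont F z -> ccont G z -> ccont (fun w => F w + G w) z.
Proof. move=> /ccontP h1 /ccontP h2; apply: (ccontP _ z).2; exact: cvgD h1 h2. Qed.
Lemma ccontM F G z : ccont F z -> ccont G z -> ccont (fun w => F w * G w) z.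
Proof.
move=> /ccontP h1 /ccontP h2; apply: (ccontP _ z).2.
exact: (@cvgM (CC R) _ _ _ _ _ _ _ h1 h2).
Qed.
Lemma ccontN F z : ccont F z -> ccont (fun w => - F w) z.
Proof. move=> /ccontP h1; apply: (ccontP _ z).2; exact: cvgN h1. Qed.
Lemma ccontV F z : F z != 0 -> ccont F z -> ccont (fun w => (F w)^-1) z.
Proof.
move=> h0 /ccontP h1; apply: (ccontP _ z).2.
exact: (@cvgV (CC R) _ _ _ _ _ h0 h1).
Qed.
Lemma ccontX F z k : ccont F z -> ccont (fun w => F w ^+ k) z.
Proof.
move=> h; elim: k => [|k IH]; first exact: ccont_cst.
by under eq_fun do rewrite exprS; exact: ccontM.
Qed.
Lemma cdiff_cont F z : cdiff F z -> ccont F z.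
Proof.
move=> [phi hp hF].
rewrite (_ : F = fun w => F z + phi w * (w - z)); last by apply/funext.
apply: ccontD; first exact: ccont_cst.
by apply: ccontM => //; apply: ccontD; [exact: ccont_id | exact: ccont_cst].
Qed.

Lemma nested_intervals (u v : nat -> R) : (forall k, u k <= u k.+1) ->
  (forall k, v k.+1 <= v k) -> (forall k, u k <= v k) ->
  exists x, forall k, u k <= x <= v k.
Proof.
move=> hu hv huv.
have mu i j : u i <= u (i + j)%N by elim: j => [|j IH]; rewrite ?addn0 // addnS (le_trans IH).
have mv i j : v (i + j)%N <= v i by elim: j => [|j IH]; rewrite ?addn0 // addnS (le_trans _ IH).
have uv i j : u i <= v j.
  by apply: le_trans (mu i j) _; apply: le_trans (huv _) _; rewrite addnC.
have hs : has_sup (range u).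
  by split; [exists (u 0%N), 0%N | exists (v 0%N) => _ [k _ <-]].
exists (sup (range u)) => k; apply/andP; split.
  by apply: ub_le_sup; [case: hs | exists k].
by apply: ge_sup; [exists (u 0%N), 0%N | move=> _ [j _ <-]].
Qed.

(** Choosing a bad quarter defines a step on rectangles; its iterates are nested intervals in each
    variable, whose common point is the witness. *)
Lemma bisection (bad : R -> R -> R -> R -> Prop) a0 b0 c0 d0 :
  a0 <= b0 -> c0 <= d0 -> bad a0 b0 c0 d0 ->
  (forall a b c d, a0 <= a -> a <= b -> b <= b0 -> c0 <= c -> c <= d -> d <= d0 -> bad a b c d ->
     let m := (a + b) / 2 in let n := (c + d) / 2 in
     [\/ bad a m c n, bad a m n d, bad m b c n | bad m b n d]) ->
  exists x y, [/\ a0 <= x <= b0, c0 <= y <= d0 & forall r, 0 < r ->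
    exists a b c d, [/\ [/\ a0 <= a, b <= b0, c0 <= c & d <= d0],
       a <= x <= b, c <= y <= d, (b - a) + (d - c) < r & bad a b c d]].
Proof.
move=> ab cd hbad hstep.
pose ok (s : (R * R) * (R * R)) := [/\ [/\ a0 <= s.1.1, s.1.1 <= s.1.2 & s.1.2 <= b0],
   [/\ c0 <= s.2.1, s.2.1 <= s.2.2 & s.2.2 <= d0] & bad s.1.1 s.1.2 s.2.1 s.2.2].
have /choice [f hf] : forall s, exists s', ok s -> ok s' /\
   [/\ s.1.1 <= s'.1.1, s'.1.2 <= s.1.2, s.2.1 <= s'.2.1 & s'.2.2 <= s.2.2] /\
   s'.1.2 - s'.1.1 = (s.1.2 - s.1.1) / 2 /\ s'.2.2 - s'.2.1 = (s.2.2 - s.2.1) / 2.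
  move=> [[a b] [c d]]; have [[[h1 h2 h3] [h4 h5 h6] h7]|h] := pselect (ok ((a, b), (c, d)));
    last by exists ((a, b), (c, d)).
  move: h1 h2 h3 h4 h5 h6 h7 => /= h1 h2 h3 h4 h5 h6 h7.
  have [hb|hb|hb|hb] := hstep _ _ _ _ h1 h2 h3 h4 h5 h6 h7.
  - exists ((a, (a + b) / 2), (c, (c + d) / 2)) => _; rewrite /ok /=; split; first by split => //; split; lra.
    by split; [split; lra | split; lra].
  - exists ((a, (a + b) / 2), ((c + d) / 2, d)) => _; rewrite /ok /=; split; first by split => //; split; lra.
    by split; [split; lra | split; lra].
  - exists (((a + b) / 2, b), (c, (c + d) / 2)) => _; rewrite /ok /=; split; first by split => //; split; lra.
    by split; [split; lra | split; lra].
  - exists (((a + b) / 2, b), ((c + d) / 2, d)) => _; rewrite /ok /=; split; first by split => //; split; lra.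
    by split; [split; lra | split; lra].
pose s k := iter k f ((a0, b0), (c0, d0)).
have oks k : ok (s k).
  by elim: k => [|k IH]; [rewrite /ok /= | rewrite /s iterS; case: (hf _ IH)].
have nst k := (hf _ (oks k)).2.
have len k : (s k).1.2 - (s k).1.1 = (b0 - a0) / 2 ^+ k /\
             (s k).2.2 - (s k).2.1 = (d0 - c0) / 2 ^+ k.
  elim: k => [|k [IH1 IH2]]; first by rewrite expr0 !divr1.
  have [_ [e1 e2]] := nst k; rewrite -iterS -/(s k.+1) in e1 e2.
  by rewrite e1 e2 IH1 IH2 exprS invfM; split; ring.
have [x hx] : exists x, forall k, (s k).1.1 <= x <= (s k).1.2.
  apply: nested_intervals => k; try by have [[]] := nst k.
  by have [[]] := oks k.
have [y hy] : exists x, forall k, (s k).2.1 <= x <= (s k).2.2.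
  apply: nested_intervals => k; try by have [[]] := nst k.
  by have [_ []] := oks k.
exists x, y; split; [exact: (hx 0%N) | exact: (hy 0%N) |] => r r0.
pose S := (b0 - a0) + (d0 - c0); have S0 : 0 <= S by rewrite /S; lra.
have [k hk] : exists k : nat, S / 2 ^+ k < r.
  exists (Num.trunc (S / r)).+1; rewrite ltr_pdivrMr ?exprn_gt0 // mulrC -ltr_pdivrMr //.
  apply: lt_trans (truncnS_gt _) _.
  by rewrite -natrX ltr_nat ltn_expl.
exists (s k).1.1, (s k).1.2, (s k).2.1, (s k).2.2.
have [[h1 h2 h3] [h4 h5 h6] h7] := oks k; split => //.
by have [-> ->] := len k; rewrite -mulrDl.
Qed.

(** It suffices to bound the contour by k L^2 for every k > 0, where L is the half perimeter. If the
    bound fails on a rectangle it fails on one of its quarters, since L^2 is divided by 4. *)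
Lemma goursat F a b c d : a <= b -> c <= d ->
  (forall x y, a <= x <= b -> c <= y <= d -> cdiff F (pt x y)) ->
  contour F a b c d = 0.
Proof.
move=> ab cd hF; have cF : crect F a b c d by move=> x y hx hy; exact/cdiff_cont/hF.
suff h (k : R) : 0 < k -> nrm (contour F a b c d) <= k * ((b - a) + (d - c)) ^+ 2.
  apply: nrm_eq0; apply/eqP; rewrite eq_le nrm_ge0 andbT; apply/ler_addgt0Pr => e e0.
  rewrite add0r; set L := (b - a) + (d - c) in h.
  have L0 : 0 <= L by rewrite /L; lra.
  apply: le_trans (h (e / (1 + L ^+ 2)) _) _.
    by apply: divr_gt0 => //; have := sqr_ge0 L; lra.
  rewrite mulrAC ler_pdivrMr; last by have := sqr_ge0 L; lra.
  by rewrite ler_pM2l // ler_wpDl.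
move=> k0; rewrite leNgt; apply/negP => hb.
pose bad a b c d := k * ((b - a) + (d - c)) ^+ 2 < nrm (contour F a b c d).
have [|x [y [hx hy hr]]] := @bisection bad a b c d ab cd hb.
  move=> a' b' c' d' h1 h2 h3 h4 h5 h6 hbad m n; rewrite /bad.
  have cF' := crect_sub h1 h3 h4 h6 cF.
  have am : a' <= m by rewrite /m; lra.
  have mb : m <= b' by rewrite /m; lra.
  have cn : c' <= n by rewrite /n; lra.
  have nd : n <= d' by rewrite /n; lra.
  have E : contour F a' b' c' d' = (contour F a' m c' n + contour F a' m n d') +
     (contour F m b' c' n + contour F m b' n d').
    rewrite (contour_splitx am mb h5 (crect_bd cF')); congr (_ + _); apply: contour_splity => //;
      by apply/crect_bd; apply: crect_sub cF'.
  move: hbad; rewrite /bad E => hbad.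
  set L := (b' - a') + (d' - c') in hbad.
  have e1 : m - a' = (b' - a') / 2 by rewrite /m; lra.
  have e2 : b' - m = (b' - a') / 2 by rewrite /m; lra.
  have e3 : n - c' = (d' - c') / 2 by rewrite /n; lra.
  have e4 : d' - n = (d' - c') / 2 by rewrite /n; lra.
  rewrite e1 e2 e3 e4 -mulrDl -/L.
  have EL : k * (L / 2) ^+ 2 = k * L ^+ 2 / 4 by field.
  rewrite EL.
  have [|g1] := ltP (k * L ^+ 2 / 4) (nrm (contour F a' m c' n)); first by constructor.
  have [|g2] := ltP (k * L ^+ 2 / 4) (nrm (contour F a' m n d')); first by constructor.
  have [|g3] := ltP (k * L ^+ 2 / 4) (nrm (contour F m b' c' n)); first by constructor.
  have [|g4] := ltP (k * L ^+ 2 / 4) (nrm (contour F m b' n d')); first by constructor.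
  exfalso; move: hbad; rewrite ltNge => /negP; apply.
  apply: le_trans (nrmD _ _) _; apply: le_trans (lerD (nrmD _ _) (nrmD _ _)) _; lra.
have [phi cphi hphi] := hF _ _ hx hy.
(* With slope error k / 8 the estimate of [contour_le] becomes 4 (k / 8) L L = k L^2 / 2, below the
   threshold of [bad]. *)
have k8 : 0 < k / 8 by lra.
have [r r0 hr'] := cphi _ k8.
have [a' [b' [c' [d' [[h1 h2 h3 h4] h5 h6 h7 hbad]]]]] := hr _ r0.
have ab' : a' <= b' by lra.
have cd' : c' <= d' by lra.
set z0 := pt x y in hphi hr'.
pose A := fun z => (F z0 - phi z0 * z0) + phi z0 * z.
pose B := fun z => (phi z - phi z0) * (z - z0).
have EF : F = fun z => A z + B z.
  by apply/funext => z; rewrite hphi /A /B; ring.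
have cF' := crect_sub h1 h2 h3 h4 cF.
have cA : crect A a' b' c' d'.
  move=> u v _ _; apply: ccontD; first exact: ccont_cst.
  by apply: ccontM; [exact: ccont_cst | exact: ccont_id].
have EB : B = fun z => F z + (-1) * A z.
  by apply/funext => z; rewrite hphi /A /B; ring.
have cB : crect B a' b' c' d'.
  rewrite EB => u v hu hv; apply: ccontD; first exact: cF'.
  by apply: ccontM; [exact: ccont_cst | exact: cA].
have : contour F a' b' c' d' = contour B a' b' c' d'.
  by rewrite {1}EF (contourD ab' cd' (crect_bd cA) (crect_bd cB)) contour_affine // add0r.
set L := (b' - a') + (d' - c') in h7.
have L0 : 0 <= L by rewrite /L; lra.
have : nrm (contour B a' b' c' d') <= 4 * (k / 8 * L) * L.
  apply: contour_le => //; first exact: crect_bd.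
  move=> u v hu hv _; rewrite /B nrmM.
  have hd : nrm (pt u v - z0) <= L.
    apply: le_trans (ptB _ _ _ _) _; rewrite /L.
    by apply: lerD; rewrite ler_norml; lra.
  apply: ler_pM; rewrite ?nrm_ge0 //.
  by apply/ltW/hr'; apply: le_lt_trans hd h7.
move=> hle hE; move: hbad; rewrite /bad hE -/L ltNge => /negP; apply.
apply: le_trans hle _; rewrite expr2.
have := mulr_ge0 (ltW k0) (mulr_ge0 L0 L0); lra.
Qed.

(* One point where F is only continuous is harmless: the contour can be shrunk around it. *)
Lemma goursat_punctured F a b c d (x0 y0 : R) : a < x0 < b -> c < y0 < d ->
  (forall x y, a <= x <= b -> c <= y <= d -> pt x y != pt x0 y0 -> cdiff F (pt x y)) ->
  ccont F (pt x0 y0) ->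
  contour F a b c d = 0.
Proof.
move=> hx hy hF c0.
have cF : crect F a b c d.
  move=> x y ux uy; have [->//|h] := eqVneq (pt x y) (pt x0 y0).
  exact/cdiff_cont/hF.
have [d1 d10 hd] := c0 1 ltr01.
set M := nrm (F (pt x0 y0)) + 1.
suff h (e : R) : 0 < e -> e < x0 - a -> e < b - x0 -> e < y0 - c -> e < d - y0 -> e < d1 / 2 ->
    nrm (contour F a b c d) <= 16 * M * e.
  apply: nrm_eq0; apply/eqP; rewrite eq_le nrm_ge0 andbT; apply/ler_addgt0Pr => e e0.
  have M0 : 0 < M by rewrite /M; have := nrm_ge0 (F (pt x0 y0)); lra.
  pose q := Num.min (e / (16 * M)) (Num.min (Num.min (x0 - a) (b - x0))
     (Num.min (Num.min (y0 - c) (d - y0)) (d1 / 2))).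
  have e16 : 0 < e / (16 * M) by apply: divr_gt0 => //; lra.
  have q0 : 0 < q.
    rewrite /q !lt_min e16 /=; lra.
  have hq : q <= e / (16 * M) by rewrite /q ge_min lexx.
  have [l1 l2 l3 l4 l5] : [/\ q <= x0 - a, q <= b - x0, q <= y0 - c, q <= d - y0 & q <= d1 / 2].
    by rewrite /q !ge_min !lexx !orbT.
  have := h (q / 2); rewrite add0r => h'; apply: le_trans (h' _ _ _ _ _ _) _; try lra.
  have : 16 * M * (e / (16 * M)) = e by field; lra.
  have := ler_wpM2l (_ : 0 <= 16 * M) hq; rewrite (_ : 0 <= 16 * M); last by lra.
  move=> /(_ isT) k1 k2; have : 0 <= 16 * M * q by apply: mulr_ge0; lra.
  lra.
move=> e0 h1 h2 h3 h4 h5.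
have z a' b' c' d' : a <= a' -> a' <= b' -> b' <= b -> c <= c' -> c' <= d' -> d' <= d ->
   (b' < x0) || (x0 < a') || (d' < y0) || (y0 < c') -> contour F a' b' c' d' = 0.
  move=> k1 k2 k3 k4 k5 k6 k7; apply: goursat => // x y ux uy; apply: hF; try lra.
  apply/eqP => -[ex ey]; move: k7; rewrite -!orbA => /or4P[]; lra.
rewrite (contour_splitx (m := x0 - e) _ _ _ (crect_bd cF)); try lra.
rewrite (z a (x0 - e)) ?add0r; try lra.
rewrite (@contour_splitx F (x0 - e) (x0 + e) b); try lra; last by apply/crect_bd; apply: crect_sub cF; lra.
rewrite (z (x0 + e) b) ?addr0; try lra.
rewrite (@contour_splity F (x0 - e) (x0 + e) c (y0 - e) d); try lra; last by apply/crect_bd; apply: crect_sub cF; lra.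
rewrite (z _ _ c (y0 - e)) ?add0r; try lra.
rewrite (@contour_splity F (x0 - e) (x0 + e) (y0 - e) (y0 + e) d); try lra; last by apply/crect_bd; apply: crect_sub cF; lra.
rewrite (z _ _ (y0 + e) d) ?addr0; try lra.
apply: le_trans (@contour_le F _ _ _ _ M _ _ _ _) _; try lra.
- by apply/crect_bd; apply: crect_sub cF; lra.
- move=> x y ux uy _; rewrite /M -[F (pt x y)](subrK (F (pt x0 y0))) addrC.
  apply: le_trans (nrmD _ _) _; rewrite lerD2l; apply/ltW/hd.
  apply: le_lt_trans (ptB _ _ _ _) _; apply: (@le_lt_trans _ _ (e + e)); last lra.
  by apply: lerD; rewrite ler_norml; lra.
Qed.
End Goursat.

(** * Cauchy's formula on squares and Taylor expansion in one variable *)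

Section TaylorOneVariable.
Variable R : realType.
Local Notation C := (CC R).
Implicit Types (r : R) (F G f : C -> C) (z : C).

Definition sq F r : C := contour F (- r) r (- r) r.
Definition csq F r := cbd F (- r) r (- r) r.

(** The slope function of [cdiff] must satisfy its equation on all of C, so it is redefined as a
    difference quotient away from z; only its continuity at z is a local matter. *)
Lemma cdiff_local F G z e : 0 < e -> (forall w, nrm (w - z) < e -> F w = G w) ->
  cdiff G z -> cdiff F z.
Proof.
move=> e0 h [phi hp hG].
exists (fun w => if w == z then phi z else (F w - F z) / (w - z)).
  move=> t t0; have [d d0 hd] := hp t t0.
  exists (Num.min d e); first by rewrite lt_min d0.
  move=> w; rewrite lt_min => /andP[h1 h2]; rewrite /= eqxx.
  case: eqP => [_|/eqP wz]; first by rewrite subrr nrm0.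
  have hz : F z = G z by apply: h; rewrite subrr nrm0.
  rewrite (h w h2) hz (hG w) addrAC subrr add0r mulfK ?subr_eq0 //; exact: hd.
move=> w; case: eqP => [->|/eqP wz]; first by rewrite subrr mulr0 addr0.
by rewrite divfK ?subr_eq0 // addrC subrK.
Qed.

Lemma cdiff_cst (k : C) z : cdiff (fun=> k) z.
Proof. by exists (fun=> 0) => [|w]; [exact: ccont_cst | rewrite mul0r addr0]. Qed.
Lemma cdiff_id z : cdiff id z.
Proof. by exists (fun=> 1) => [|w]; [exact: ccont_cst | rewrite mul1r addrC subrK]. Qed.
Lemma cdiffD F G z : cdiff F z -> cdiff G z -> cdiff (fun w => F w + G w) z.
Proof.
move=> [p hp hF] [q hq hG]; exists (fun w => p w + q w); first exact: ccontD.
by move=> w; rewrite (hF w) (hG w); ring.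
Qed.
Lemma cdiffM F G z : cdiff F z -> cdiff G z -> cdiff (fun w => F w * G w) z.
Proof.
move=> dF dG; have cG := cdiff_cont dG; case: dF dG => [p hp hF] [q hq hG].
exists (fun w => p w * G w + F z * q w).
  by apply: ccontD; apply: ccontM => //; exact: ccont_cst.
by move=> w; rewrite (hF w) (hG w); ring.
Qed.
Lemma cdiffV F z : F z != 0 -> cdiff F z -> cdiff (fun w => (F w)^-1) z.
Proof.
move=> Fz dF; have cF := cdiff_cont dF; case: dF => [p hp hF].
have [d d0 hd] := cF _ (nrm_gt0 Fz).
have nz w : nrm (w - z) < d -> F w != 0.
  by move=> /hd h; apply/eqP => e; move: h; rewrite e sub0r nrmN ltxx.
exists (fun w => if w == z then - p z / (F z * F z) else ((F w)^-1 - (F z)^-1) / (w - z)).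
  have h : ccont (fun w => - p w * (F w * F z)^-1) z.
    apply: ccontM; first exact: ccontN.
    by apply: ccontV; [rewrite mulf_neq0 | apply: ccontM => //; exact: ccont_cst].
  move=> t t0; have [d1 d10 hd1] := h t t0.
  exists (Num.min d d1); first by rewrite lt_min d0.
  move=> w; rewrite lt_min => /andP[h1 h2]; rewrite /= eqxx.
  case: eqP => [_|/eqP wz]; first by rewrite subrr nrm0.
  suff -> : ((F w)^-1 - (F z)^-1) / (w - z) = - p w / (F w * F z) by exact: hd1.
  have Fw := nz _ h1; have wz' : w - z != 0 by rewrite subr_eq0.
  have E : F z = F w - p w * (w - z) by rewrite (hF w); ring.
  have -> : (F w)^-1 - (F z)^-1 = (F z - F w) / (F w * F z) by field; rewrite Fw Fz.
  by rewrite {1}E; field; rewrite Fw Fz wz'.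
move=> w; case: eqP => [->|/eqP wz]; first by rewrite subrr mulr0 addr0.
by rewrite divfK ?subr_eq0 // addrC subrK.
Qed.
Lemma cdiffX F z k : cdiff F z -> cdiff (fun w => F w ^+ k) z.
Proof.
move=> h; elim: k => [|k IH]; first exact: cdiff_cst.
by under eq_fun do rewrite exprS; exact: cdiffM.
Qed.

Lemma nrm_bdry r (x y : R) : 0 < r -> - r <= x <= r -> - r <= y <= r ->
  [|| x == - r, x == r, y == - r | y == r] -> r <= nrm (pt x y).
Proof.
move=> r0 _ _ h; have [h1 h2] := (nrm_Re (pt x y), nrm_Im (pt x y)).
case/or4P: h => /eqP E; subst; move: h1 h2; rewrite /= ?normrN ?(gtr0_norm r0) //.
Qed.

Lemma pt_neq0 r (x y : R) : 0 < r -> - r <= x <= r -> - r <= y <= r ->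
  [|| x == - r, x == r, y == - r | y == r] -> pt x y != 0.
Proof.
move=> r0 hx hy h; apply/eqP => e; have := nrm_bdry r0 hx hy h.
by rewrite e nrm0 leNgt r0.
Qed.

Lemma csqD F G r : csq F r -> csq G r -> csq (fun z => F z + G z) r.
Proof. by move=> hF hG x y hx hy h; apply: ccontD; [exact: hF|exact: hG]. Qed.
Lemma csqM F G r : csq F r -> csq G r -> csq (fun z => F z * G z) r.
Proof. by move=> hF hG x y hx hy h; apply: ccontM; [exact: hF|exact: hG]. Qed.
Lemma csq_cst (k : C) r : csq (fun=> k) r.
Proof. by move=> x y _ _ _; exact: ccont_cst. Qed.
Lemma csq_X r k : 0 < r -> csq (fun z => z ^- k) r.
Proof.
move=> r0 x y hx hy h; apply: ccontV; last by apply: ccontX; exact: ccont_id.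
by rewrite expf_neq0 //; exact: pt_neq0 h.
Qed.

Lemma sqD F G r : 0 < r -> csq F r -> csq G r ->
  sq (fun z => F z + G z) r = sq F r + sq G r.
Proof. by move=> r0 hF hG; apply: contourD => //; lra. Qed.
Lemma sqZ F r (k : C) : 0 < r -> csq F r -> sq (fun z => k * F z) r = k * sq F r.
Proof. by move=> r0 hF; apply: contourZ => //; lra. Qed.
(** The boundary of the square lies in the annulus r <= |z| <= 2 r; bounds and equalities are stated
    there, and the shape of the path is forgotten. *)
Lemma sq_le F r (M : R) : 0 < r -> csq F r ->
  (forall z, nrm z <= 2 * r -> r <= nrm z -> nrm (F z) <= M) -> nrm (sq F r) <= 16 * r * M.
Proof.
move=> r0 hF h; have -> : 16 * r * M = 4 * M * ((r - - r) + (r - - r)) by ring.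
apply: contour_le => //; try lra.
move=> x y hx hy hb; apply: h; last exact: nrm_bdry hb.
by apply: le_trans (nrm_ReIm _) _; rewrite /= mulr_natl mulr2n; apply: lerD; rewrite ler_norml.
Qed.
Lemma eq_sq F G r : 0 < r -> (forall z, nrm z <= 2 * r -> r <= nrm z -> F z = G z) -> sq F r = sq G r.
Proof.
move=> r0 h; apply: eq_contour; try lra.
move=> x y hx hy hb; apply: h; last exact: nrm_bdry hb.
by apply: le_trans (nrm_ReIm _) _; rewrite /= mulr_natl mulr2n; apply: lerD; rewrite ler_norml.
Qed.
Lemma sq_sum r N (G : nat -> C -> C) : 0 < r -> (forall k, csq (G k) r) ->
  csq (fun z => \sum_(k < N) G k z) r /\
  sq (fun z => \sum_(k < N) G k z) r = \sum_(k < N) sq (G k) r.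
Proof.
move=> r0 h; elim: N => [|N [IH1 IH2]].
  have -> : (fun z => \sum_(k < 0) G k z) = (fun=> 0) by apply/funext => x; rewrite big_ord0.
  split; first exact: csq_cst.
  rewrite big_ord0 -[RHS](mul0r (sq (fun=> 0) r)) -sqZ //; last exact: csq_cst.
  by apply: eq_sq => // z _ _; rewrite mulr0.
have -> : (fun x => \sum_(k < N.+1) G k x) = (fun x => \sum_(k < N) G k x + G N x).
  by apply/funext => x; rewrite big_ord_recr.
by rewrite sqD // IH2 big_ord_recr; split => //; exact: csqD.
Qed.

(* The four sides contribute equally to the integral of 1/z, each being i times a positive real. *)
Lemma sq_inv_ge r : 0 < r -> 4 <= nrm (sq (fun z => z^-1) r).
Proof.
move=> r0; have rr : - r <= r by lra.
have c1 : csq (fun z => z^-1) r by have := csq_X 1 r0.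
pose g := fun x : R => rc (2 * r * (x ^+ 2 + r ^+ 2)^-1).
have den (x : R) : x ^+ 2 + r ^+ 2 != 0.
  by apply: lt0r_neq0; apply: ltr_wpDl; rewrite ?sqr_ge0 ?exprn_gt0.
have inv x y : (pt x y)^-1 = Complex (x / (x ^+ 2 + y ^+ 2)) (- y / (x ^+ 2 + y ^+ 2)).
  by apply/eqP; rewrite eq_complex /= mulNr !eqxx.
have cx y : (y == - r) || (y == r) -> cts (- r) r (fun t => (pt t y)^-1).
  by move=> yr; apply: (cbd_x c1); rewrite ?yr ?orbT //; case/orP: yr => /eqP ->; rewrite ?lexx.
have cy x : (x == - r) || (x == r) -> cts (- r) r (fun t => (pt x t)^-1).
  by move=> xr; apply: (cbd_y c1); rewrite ?xr ?orbT //; case/orP: xr => /eqP ->; rewrite ?lexx.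
rewrite /sq /contour.
rewrite -integral_abB; [|by apply: cx; rewrite eqxx|by apply: cx; rewrite eqxx orbT].
rewrite -integral_abB; [|by apply: cy; rewrite eqxx orbT|by apply: cy; rewrite eqxx].
have cg : cts (- r) r g.
  move=> x hx e e0.
  suff [d d0 hd] : exists2 d : R, 0 < d & forall y, `|y - x| < d ->
      `|2 * r * (y ^+ 2 + r ^+ 2)^-1 - 2 * r * (x ^+ 2 + r ^+ 2)^-1| < e.
    by exists d => // y /hd; rewrite /g /rc -rmorphB nrm_rc.
  move: e e0; apply: (contR (fun y => 2 * r * (y ^+ 2 + r ^+ 2)^-1) x).1.
  apply: (@cvgM R); first exact: cvg_cst.
  apply: (@cvgV R) => //; apply: cvgD; last exact: cvg_cst.
  by apply: (@cvgM R); exact: cvg_id.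
have -> : integral_ab (- r) r (fun x => (pt x (- r))^-1 - (pt x r)^-1) =
    ('i%C : C) * integral_ab (- r) r g.
  rewrite -integral_abZ //; apply: eq_integral_ab => x _; rewrite !inv /g /rc.
  by apply/eqP; rewrite eq_complex /=; apply/andP; split; apply/eqP; field; rewrite den ?andbT //= sqrrN den.
have -> : integral_ab (- r) r (fun y => (pt r y)^-1 - (pt (- r) y)^-1) =
    integral_ab (- r) r g.
  apply: eq_integral_ab => x _; rewrite !inv /g /rc.
  have h := den x; rewrite addrC in h.
  by apply/eqP; rewrite eq_complex /=; apply/andP; split; apply/eqP; field; rewrite ?sqrrN ?h //= den.
have n2 (z : C) : nrm (('i%C : C) * z + ('i%C : C) * z) = 2 * nrm z.
  by rewrite -mulr2n -(mulr_natl (_ * z)) !nrmM nrm_nat nrmI mul1r.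
rewrite n2.
suff : 2 <= nrm (integral_ab (- r) r g) by lra.
apply: le_trans (nrm_Re _); rewrite ler_normr; apply/orP; left.
have iz : (@lebesgue_measure R).-integrable `[- r, r]%classic (EFin \o (fun x : R => complex.Re (g x))) := cts_Re cg.
apply: (@le_trans _ _ (complex.Re (integral_ab (- r) r (fun=> rc r^-1)))).
  by rewrite integral_ab_cst // /rc /= mul0r subr0 opprK mulrDl divff ?gt_eqF.
apply: le_Rintegral => //.
  exact: (cts_Re (cts_cst (a := - r) (b := r) (rc r^-1))).
move=> x /=; rewrite in_itv /= => /andP[hx1 hx2].
have D0 : 0 < x ^+ 2 + r ^+ 2 by rewrite lt0r den addr_ge0 ?sqr_ge0.
rewrite ler_pdivlMr // mulrC ler_pdivrMr //.
have : x ^+ 2 <= r ^+ 2 by rewrite -ler_sqrt ?sqr_ge0 // !sqrtr_sqr (gtr0_norm r0) ler_norml hx1.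
rewrite !expr2; lra.
Qed.

(** The region between the two squares is cut into four rectangles, each in a half plane at distance
    r from 0, where [goursat] applies. *)
Lemma sq_enlarge F r b : 0 < r -> r <= b ->
  (forall z, r <= nrm z -> cdiff F z) -> sq F b = sq F r.
Proof.
move=> r0 rb hF.
have big x y : [|| x <= - r, r <= x, y <= - r | r <= y] -> r <= nrm (pt x y).
  have := nrm_Re (pt x y); have := nrm_Im (pt x y); rewrite /= => h1 h2.
  have [a1 a2 a3 a4] : [/\ x <= `|x|, - x <= `|x|, y <= `|y| & - y <= `|y|].
    by rewrite !ler_norm -normrN ler_norm -[`|y|]normrN ler_norm.
  by case/or4P => h3; lra.
have c a' b' c' d' : [&& (a' <= - r), (r <= b'), (c' <= - r) & (r <= d')] -> cbd F a' b' c' d'.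
  move=> /and4P[k1 k2 k3 k4] x y _ _ hb; apply/cdiff_cont/hF/big.
  by case/or4P: hb => /eqP ->; apply/or4P;
    [constructor 1 | constructor 2 | constructor 3 | constructor 4].
have z a' b' c' d' : a' <= b' -> c' <= d' -> [|| b' <= - r, r <= a', d' <= - r | r <= c'] ->
    contour F a' b' c' d' = 0.
  move=> k1 k2 k3; apply: goursat => // x y /andP[ux1 ux2] /andP[uy1 uy2]; apply/hF/big.
  by case/or4P: k3 => k; apply/or4P; [constructor 1 | constructor 2 | constructor 3 | constructor 4];
    lra.
have k1 : - b <= - r by lra.
have k2 : - r <= b by lra.
have k3 : - b <= b by lra.
have k4 : - r <= r by lra.
have k6 : - b <= r by lra.
rewrite /sq (contour_splitx (m := - r) k1 k2 k3); last by apply: c; rewrite k1 rb.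
rewrite (z (- b) (- r)) ?lexx ?add0r //.
rewrite (contour_splitx (m := r) k4 rb k3); last by apply: c; rewrite lexx k1 rb.
rewrite (z r b) ?lexx ?orbT ?addr0 //.
rewrite (contour_splity (m := - r) k1 k2 k4); last by apply: c; rewrite !lexx k1 rb.
rewrite (z _ _ (- b) (- r)) ?lexx ?orbT ?add0r //.
rewrite (contour_splity (m := r) k4 rb k4); last by apply: c; rewrite !lexx rb.
by rewrite (z _ _ r b) ?lexx ?orbT ?addr0.
Qed.

(** No primitive is used: by [sq_enlarge] the integral does not depend on the square, and on the
    square of size b it is at most 16 b^-(k+1). *)
Lemma sq_negpow r k : 0 < r -> sq (fun z => z ^- k.+2) r = 0.
Proof.
move=> r0; apply: nrm_eq0; apply/eqP; rewrite eq_le nrm_ge0 andbT; apply/ler_addgt0Pr => e e0.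
pose b := Num.max r (Num.max 1 (16 / e)).
have [b1 b2 b3] : [/\ r <= b, 1 <= b & 16 / e <= b] by rewrite /b !le_max !lexx !orbT.
have b0 : 0 < b by lra.
rewrite -(@sq_enlarge _ r b) //; last first.
  move=> z hz; apply: cdiffV; last by apply: cdiffX; exact: cdiff_id.
  by rewrite expf_neq0 //; apply/eqP => h; move: hz; rewrite h nrm0; lra.
apply: le_trans (@sq_le _ b (b ^- k.+2) b0 (csq_X _ b0) _) _.
  move=> z _ hz; rewrite nrmV nrmX lef_pV2 ?posrE ?exprn_gt0 //; last by lra.
  by rewrite lerXn2r ?nnegrE ?nrm_ge0 //; lra.
rewrite add0r (_ : 16 * b * b ^- k.+2 = 16 * b ^- k.+1); last first.
  by rewrite [b ^+ k.+2]exprS invfM; field; rewrite expf_neq0 gt_eqF.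
have h1 : b <= b ^+ k.+1 by rewrite exprS ler_pMr ?exprn_ege1.
rewrite ler_pdivrMr ?exprn_gt0 //.
have : 16 <= b * e by rewrite -ler_pdivrMr.
have : b * e <= b ^+ k.+1 * e by rewrite ler_pM2r.
by rewrite [e * _]mulrC => h2 h3; apply: le_trans h3 h2.
Qed.

(** Cauchy's formula with the integral of 1/z over the same square in place of 2 i pi. Its exact
    value does not matter; [sq_inv_ge] bounds it away from 0. *)
Definition tcoef r f (k : nat) : C := (sq (fun z => z^-1) r)^-1 * sq (fun z => f z * z ^- k.+1) r.

Lemma tcoef_le r f k (M : R) : 0 < r -> csq f r ->
  (forall z, nrm z <= 2 * r -> r <= nrm z -> nrm (f z) <= M) ->
  nrm (tcoef r f k) <= 4 * M * r ^- k.
Proof.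
move=> r0 cf hM; rewrite /tcoef nrmM nrmV.
have h1 := sq_inv_ge r0.
have h2 : nrm (sq (fun z => f z * z ^- k.+1) r) <= 16 * r * (M * r ^- k.+1).
  apply: sq_le => //; first by apply: csqM => //; exact: csq_X.
  move=> z z1 z2; rewrite nrmM nrmV nrmX; apply: ler_pM; rewrite ?nrm_ge0 ?invr_ge0 ?exprn_ge0 ?nrm_ge0 //.
    exact: hM.
  rewrite lef_pV2 ?posrE ?exprn_gt0 //; last by lra.
  by rewrite lerXn2r ?nnegrE ?nrm_ge0 //; lra.
have E : 16 * r * (M * r ^- k.+1) = 4 * (4 * M * r ^- k).
  by rewrite exprS; field; rewrite expf_neq0 ?gt_eqF.
rewrite ler_pdivrMl; last by lra.
apply: (le_trans h2); rewrite E ler_wpM2r //.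
move: h2; rewrite E; have := nrm_ge0 (sq (fun z => f z * z ^- k.+1) r).
clear; lra.
Qed.

Lemma tcoefD r f g k : 0 < r -> csq f r -> csq g r ->
  tcoef r (fun z => f z + g z) k = tcoef r f k + tcoef r g k.
Proof.
move=> r0 cf cg; rewrite /tcoef -mulrDr -sqD //; try (by apply: csqM => //; exact: csq_X).
by congr (_ * _); apply: eq_sq => // z _ _; rewrite mulrDl.
Qed.
Lemma tcoefZ r f k (c : C) : 0 < r -> csq f r ->
  tcoef r (fun z => c * f z) k = c * tcoef r f k.
Proof.
move=> r0 cf; rewrite /tcoef [RHS]mulrCA -(@sqZ _ _ c) //; try (by apply: csqM => //; exact: csq_X).
by congr (_ * _); apply: eq_sq => // z _ _; rewrite mulrA.
Qed.
Lemma eq_tcoef r f g k : 0 < r -> (forall z, nrm z <= 2 * r -> r <= nrm z -> f z = g z) ->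
  tcoef r f k = tcoef r g k.
Proof. by move=> r0 h; rewrite /tcoef; congr (_ * _); apply: eq_sq => // z h1 h2; rewrite h. Qed.

Lemma geom_inv (z w : C) N : w != 0 -> w - z != 0 ->
  (w - z)^-1 = \sum_(k < N) z ^+ k * w ^- k.+1 + z ^+ N * w ^- N / (w - z).
Proof.
move=> w0 wz; elim: N => [|N IH]; first by rewrite big_ord0 add0r expr0 invr1 !mul1r.
rewrite big_ord_recr /= {1}IH -addrA; congr (_ + _).
rewrite !exprS; field; rewrite w0 wz expf_neq0 //.
Qed.

(** Cauchy's theorem for the difference quotient [phi] of f at z, whose only doubtful point is z,
    followed by the expansion of 1/(w - z) with exact remainder. Since |z| / |w| <= 1/2 on the
    square, the error decays like 2^-N. *)
Lemma taylor1 r f (M : R) : 0 < r -> (forall z, nrm z <= 2 * r -> cdiff f z) ->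
  (forall z, nrm z <= 2 * r -> nrm (f z) <= M) ->
  forall z N, nrm z <= r / 2 ->
    nrm (f z - \sum_(k < N) tcoef r f k * z ^+ k) <= 16 * M * 2 ^- N.
Proof.
move=> r0 df hM z N hz.
have M0 : 0 <= M by apply: le_trans (hM 0 _); rewrite ?nrm_ge0 // nrm0; lra.
have zz : nrm z <= 2 * r by lra.
case: N => [|N].
  by rewrite big_ord0 subr0 expr0 invr1 mulr1; apply: le_trans (hM _ zz) _; lra.
have cf : csq f r.
  move=> x y hx hy hb; apply/cdiff_cont/df.
  by apply: le_trans (nrm_ReIm _) _; rewrite /= mulr_natl mulr2n; apply: lerD; rewrite ler_norml.
have [phi cphi hphi] := df z zz.
have phiE w : w != z -> phi w = (f w - f z) / (w - z).
  by move=> wz; rewrite hphi addrAC subrr add0r mulfK // subr_eq0.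
have zE : z = pt (complex.Re z) (complex.Im z) by case: (z).
have zne w : r <= nrm w -> w != z by move=> hw; apply/eqP => e; move: hw; rewrite e; lra.
have s0 : sq phi r = 0.
  apply: (@goursat_punctured _ _ _ _ _ _ (complex.Re z) (complex.Im z)).
  - by have := nrm_Re z; rewrite ler_norml => /andP[]; lra.
  - by have := nrm_Im z; rewrite ler_norml => /andP[]; lra.
  - move=> x y hx hy; rewrite -zE; set w := pt x y => wz.
    have hw : nrm w <= 2 * r.
      by apply: le_trans (nrm_ReIm _) _; rewrite /= mulr_natl mulr2n; apply: lerD; rewrite ler_norml.
    apply: (@cdiff_local _ (fun w => (f w - f z) / (w - z)) _ (nrm (z - w))).
    + by rewrite nrm_gt0 // subr_eq0 eq_sym.
    + move=> u hu; apply: phiE; apply/eqP => E; by move: hu; rewrite E ltxx.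
    + apply: cdiffM; first by apply: cdiffD; [exact: df | exact: cdiff_cst].
      by apply: cdiffV; [rewrite subr_eq0 | apply: cdiffD; [exact: cdiff_id | exact: cdiff_cst]].
  - by rewrite -zE.
pose G k := fun w : C => z ^+ k * (f w * w ^- k.+1 + - f z * w ^- k.+1).
pose E := fun w => (f w - f z) * (z ^+ N.+1 * w ^- N.+1 / (w - z)).
have cG k : csq (G k) r.
  apply: csqM; first exact: csq_cst.
  by apply: csqD; apply: csqM; rewrite ?csq_X //; first [exact: csq_X | exact: csq_cst].
have cE : csq E r.
  apply: csqM; first by apply: csqD => //; exact: csq_cst.
  apply: csqM; first by apply: csqM; [exact: csq_cst | exact: csq_X].
  move=> x y hx hy hb; apply: ccontV.
    by rewrite subr_eq0; apply/zne/(nrm_bdry r0 hx hy hb).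
  by apply: ccontD; [exact: ccont_id | exact: ccont_cst].
have [cS sS] := sq_sum N.+1 r0 cG.
have nz w : r <= nrm w -> w != 0.
  by move=> hw; apply/eqP => e; move: hw; rewrite e nrm0; lra.
have e1 : sq phi r = \sum_(k < N.+1) sq (G k) r + sq E r.
  rewrite -sS -sqD //; apply: eq_sq => // w _ hw.
  rewrite phiE ?zne // (@geom_inv z w N.+1) ?subr_eq0 ?zne ?nz // mulrDr; congr (_ + _).
  by rewrite mulr_sumr; apply: eq_bigr => k _; rewrite /G; ring.
set K := sq (fun z => z^-1) r.
have K4 : 4 <= nrm K := sq_inv_ge r0.
have K0 : K != 0 by apply/eqP => e; move: K4; rewrite e nrm0; lra.
(* The subtracted value f z contributes only for k = 0, as the integrals of w^-(k+1) with k > 0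
   vanish. *)
have sG k : sq (G k) r = K * (tcoef r f k * z ^+ k) - (if k == 0%N then f z * K else 0).
  rewrite /G sqZ //; last first.
    by apply: csqD; apply: csqM; rewrite ?csq_X //; first [exact: csq_X | exact: csq_cst].
  rewrite sqD //; try (by apply: csqM; rewrite ?csq_X //; first [exact: csq_X | exact: csq_cst]).
  rewrite [sq (fun z0 : C => - f z * _) r]sqZ //; last exact: csq_X.
  rewrite /tcoef -/K; case: k => [|k] /=; first by rewrite /K; field.
  by rewrite sq_negpow // mulr0 addr0 subr0; field.
have eq1 : f z * K - K * \sum_(k < N.+1) tcoef r f k * z ^+ k = sq E r.
  move: e1; rewrite s0; under eq_bigr => k _ do rewrite sG.
  rewrite sumrB -mulr_sumr [X in _ - X + _]big_ord_recl /= [X in _ - (_ + X) + _]big1 // addr0 => e1.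
  set S := \sum_(k < N.+1) _ in e1 *.
  apply/eqP; rewrite -subr_eq0 -oppr_eq0; apply/eqP; rewrite [RHS]e1; ring.
(* On the square |w - z| >= r / 2, so the integrand is at most 2 M 2^-(N+1) / (r / 2). Division by
   [K], of modulus at least 4, then turns 64 into 16. *)
have hE : nrm (sq E r) <= 64 * M * 2 ^- N.+1.
  apply: le_trans (@sq_le _ r (2 * M * (2 ^- N.+1 / (r / 2))) r0 cE _) _; last first.
    by rewrite le_eqVlt; apply/orP; left; apply/eqP; field; rewrite expf_neq0 // gt_eqF.
  move=> w w1 w2; rewrite /E nrmM; apply: ler_pM; rewrite ?nrm_ge0 //.
    by apply: le_trans (nrmB _ _) _; rewrite mulr_natl mulr2n lerD // hM.
  rewrite !nrmM !nrmV !nrmX; apply: ler_pM; rewrite ?mulr_ge0 ?invr_ge0 ?exprn_ge0 ?nrm_ge0 //.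
    rewrite -!exprVn -exprMn lerXn2r ?nnegrE ?mulr_ge0 ?invr_ge0 ?nrm_ge0 //.
    by rewrite ler_pdivrMr; lra.
  rewrite lef_pV2 ?posrE; try lra; have := nrmB w z; have := nrm_tri w z 0; rewrite !subr0; lra.
have -> : f z - \sum_(k < N.+1) tcoef r f k * z ^+ k = K^-1 * sq E r by rewrite -eq1; field.
rewrite nrmM nrmV ler_pdivrMl; last by lra.
apply: le_trans hE _; have : 0 <= M * 2 ^- N.+1 by apply: mulr_ge0; rewrite ?invr_ge0 ?exprn_ge0.
by set t := M * _ => t0; rewrite -!mulrA -/t; nra.
Qed.
End TaylorOneVariable.

(** * Iterated power series and their second-order remainder *)

Section IteratedSeries.
Variable R : realType.
Local Notation C := (CC R).
Implicit Types (a b : nat -> C) (z w : C).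

Lemma expr2_small (x e : R) : 0 < e -> exists N : nat, x * 2 ^- N <= e.
Proof.
move=> e0; exists (Num.trunc (x / e)).+1; rewrite ler_pdivrMr ?exprn_gt0 // mulrC -ler_pdivrMr //.
apply: ltW; apply: lt_trans (truncnS_gt _) _.
by rewrite -natrX ltr_nat ltn_expl.
Qed.

Lemma le_all_small (a M : R) : (forall N, a <= M * 2 ^- N) -> a <= 0.
Proof.
move=> h; apply/ler_addgt0Pr => e e0; rewrite add0r.
by have [N hN] := expr2_small M e0; apply: le_trans (h N) hN.
Qed.

(** Completeness of R enters through [nested_intervals], so the rate stays explicit; real and
    imaginary parts contribute 2 each to the constant 4. *)
Lemma geom_limit (u : nat -> C) (M : R) : (forall k, nrm (u k.+1 - u k) <= M * 2 ^- k) ->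
  exists z, forall k, nrm (u k - z) <= 4 * M * 2 ^- k.
Proof.
move=> hu.
have key (v : nat -> R) : (forall k, `|v k.+1 - v k| <= M * 2 ^- k) ->
    exists x, forall k, `|v k - x| <= 2 * M * 2 ^- k.
  move=> hv.
  have E k : 2 * M * 2 ^- k = M * 2 ^- k + 2 * M * 2 ^- k.+1 :> R.
    by rewrite exprS; field; rewrite expf_neq0.
  have M0 k : 0 <= M * 2 ^- k by apply: le_trans (hv k); rewrite normr_ge0.
  have [|||x hx] := @nested_intervals R (fun k => v k - 2 * M * 2 ^- k) (fun k => v k + 2 * M * 2 ^- k).
  - by move=> k; have := hv k; rewrite ler_norml => /andP[h1 h2]; rewrite (E k); lra.
  - by move=> k; have := hv k; rewrite ler_norml => /andP[h1 h2]; rewrite (E k); lra.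
  - by move=> k; have := M0 k; lra.
  by exists x => k; have /andP[h1 h2] := hx k; rewrite ler_norml; lra.
have [|x hx] := key (fun k => complex.Re (u k)).
  by move=> k; rewrite -ReB; apply: le_trans (nrm_Re _) (hu k).
have [|y hy] := key (fun k => complex.Im (u k)).
  by move=> k; rewrite -ImB; apply: le_trans (nrm_Im _) (hu k).
exists (Complex x y) => k; apply: le_trans (nrm_ReIm _) _.
by have := hx k; have := hy k; rewrite ReB ImB /=; lra.
Qed.

(** Convergence is required at the rate 2^-N: the series considered come from Cauchy estimates, and
    limits become finite inequalities. *)
Definition is_ser (a : nat -> C) (z : C) :=
  exists M : R, forall N, nrm (\sum_(k < N) a k - z) <= M * 2 ^- N.
Definition ser (a : nat -> C) : C := xget 0 [set z | is_ser a z].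

Lemma is_ser_unique a z w : is_ser a z -> is_ser a w -> z = w.
Proof.
move=> [M hM] [L hL]; apply/eqP; rewrite -subr_eq0; apply/eqP/nrm_eq0.
apply/eqP; rewrite eq_le nrm_ge0 andbT; apply: (@le_all_small _ (M + L)) => N.
apply: le_trans (nrm_tri _ (\sum_(k < N) a k) _) _.
by rewrite nrmBC mulrDl; apply: lerD.
Qed.
Lemma ser_unique a z (M : R) : (forall N, nrm (\sum_(k < N) a k - z) <= M * 2 ^- N) -> ser a = z.
Proof.
move=> h; have hz : is_ser a z by exists M.
by apply: (@is_ser_unique a) => //; exact: (xgetI 0 hz).
Qed.
Lemma serP a (M : R) : (forall k, nrm (a k) <= M * 2 ^- k) ->
  forall N, nrm (\sum_(k < N) a k - ser a) <= 4 * M * 2 ^- N.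
Proof.
move=> h; have [|z hz] := @geom_limit (fun N => \sum_(k < N) a k) M.
  by move=> k; rewrite big_ord_recr /= addrAC subrr add0r.
by rewrite (ser_unique hz).
Qed.
Lemma ser_le a (M : R) : (forall k, nrm (a k) <= M * 2 ^- k) -> nrm (ser a) <= 4 * M.
Proof. by move=> /serP/(_ 0%N); rewrite big_ord0 sub0r nrmN expr0 invr1 mulr1. Qed.
Lemma is_ser_ser a (M : R) : (forall k, nrm (a k) <= M * 2 ^- k) -> is_ser a (ser a).
Proof. by move=> h; exists (4 * M) => N; exact: serP. Qed.
Lemma is_ser_eq a z : is_ser a z -> ser a = z.
Proof. by move=> [M /ser_unique]. Qed.
Lemma is_serD a b z w : is_ser a z -> is_ser b w -> is_ser (fun k => a k + b k) (z + w).
Proof.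
move=> [M hM] [L hL]; exists (M + L) => N.
by rewrite big_split opprD addrACA mulrDl; apply: le_trans (nrmD _ _) _; exact: lerD.
Qed.
Lemma is_serZ a z (c : C) : is_ser a z -> is_ser (fun k => c * a k) (c * z).
Proof.
move=> [M hM]; exists (nrm c * M) => N.
by rewrite -mulr_sumr -mulrBr nrmM -mulrA; apply: ler_wpM2l; rewrite ?nrm_ge0.
Qed.
Lemma is_ser0 : is_ser (fun=> 0) 0.
Proof. by exists 0 => N; rewrite big1 // subrr nrm0 mul0r. Qed.
Lemma is_ser_sum (I : Type) (l : seq I) (a : I -> nat -> C) (z : I -> C) :
  (forall i, is_ser (a i) (z i)) ->
  is_ser (fun k => \sum_(i <- l) a i k) (\sum_(i <- l) z i).
Proof.
move=> h; elim: l => [|i l IH].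
  rewrite big_nil (_ : (fun k => _) = fun=> 0); first exact: is_ser0.
  by apply/funext => k; rewrite big_nil.
rewrite big_cons (_ : (fun k => _) = fun k => a i k + \sum_(i <- l) a i k); first exact: is_serD.
by apply/funext => k; rewrite big_cons.
Qed.
Lemma is_ser_le a z (M : R) : is_ser a z -> (forall k, nrm (a k) <= M * 2 ^- k) -> nrm z <= 4 * M.
Proof. by move=> h ha; rewrite -(is_ser_eq h); exact: ser_le. Qed.
Lemma is_serS a z : is_ser (fun k => a k.+1) z -> is_ser a (a 0%N + z).
Proof.
move=> [M hM]; exists (Num.max (nrm (a 0%N + z)) (2 * M)) => -[|N].
  by rewrite big_ord0 sub0r nrmN expr0 invr1 mulr1 le_max lexx.
rewrite big_ord_recl /= opprD addrACA subrr add0r; apply: le_trans (hM N) _.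
have -> : M * 2 ^- N = 2 * M * 2 ^- N.+1 by rewrite exprS; field; rewrite expf_neq0.
by apply: ler_wpM2r; rewrite ?invr_ge0 ?exprn_ge0 // le_max lexx orbT.
Qed.

Variable n : nat.
Local Notation V := 'rV[CC R]_n.
Local Notation mon := {ffun 'I_n -> nat}.
Implicit Types (c : mon -> C) (x u : V) (s t : mon) (i j : 'I_n) (S : seq 'I_n).

Definition madd s t : mon := [ffun i => (s i + t i)%N].
Definition munit i k : mon := [ffun j => (if j == i then k else 0)%N].
Definition mon0 : mon := [ffun => 0%N].
Definition mdeg s := (\sum_i s i)%N.

Lemma maddC s t : madd s t = madd t s.
Proof. by apply/ffunP => i; rewrite !ffunE addnC. Qed.
Lemma maddA s t (t' : mon) : madd s (madd t t') = madd (madd s t) t'.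
Proof. by apply/ffunP => i; rewrite !ffunE addnA. Qed.
Lemma madd0 s : madd s mon0 = s.
Proof. by apply/ffunP => i; rewrite !ffunE addn0. Qed.
Lemma munit0 i : munit i 0 = mon0.
Proof. by apply/ffunP => j; rewrite !ffunE if_same. Qed.
Lemma munitD i k l : munit i (k + l) = madd (munit i k) (munit i l).
Proof. by apply/ffunP => j; rewrite !ffunE; case: eqP. Qed.
Lemma mdegD s t : mdeg (madd s t) = (mdeg s + mdeg t)%N.
Proof. by rewrite /mdeg -big_split; apply: eq_bigr => i _; rewrite ffunE. Qed.
Lemma mdeg0 : mdeg mon0 = 0%N.
Proof. by rewrite /mdeg big1 // => i _; rewrite ffunE. Qed.
Lemma mdeg_unit i k : mdeg (munit i k) = k.
Proof.
rewrite /mdeg (bigD1 i) //= ffunE eqxx big1 ?addn0 // => j ji.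
by rewrite ffunE (negPf ji).
Qed.
Lemma mdeg_ge s i : (s i <= mdeg s)%N.
Proof. by rewrite /mdeg (bigD1 i) //= leq_addr. Qed.

(** Cauchy estimates; r is the inverse of a polyradius. *)
Definition geo c (K r : R) := forall s, nrm (c s) <= K * r ^+ mdeg s.
Definition mshift i k c : mon -> C := fun s => c (madd s (munit i k)).
Definition dcoef i c : mon -> C := fun s => (s i).+1%:R * c (madd s (munit i 1)).

Lemma geo_ge0 c (K r : R) : geo c K r -> 0 <= K.
Proof. by move=> /(_ mon0); rewrite mdeg0 expr0 mulr1; apply: le_trans; rewrite nrm_ge0. Qed.
Lemma geo_mshift c (K r : R) i k : geo c K r -> geo (mshift i k c) (K * r ^+ k) r.
Proof. by move=> h s; apply: le_trans (h _) _; rewrite mdegD mdeg_unit exprD mulrA mulrAC. Qed.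
(** The factor s_i + 1 is absorbed by 2^|s|, whence the passage from r to 2 r. *)
Lemma geo_dcoef c (K r : R) i : 0 <= r -> geo c K r -> geo (dcoef i c) (K * r) (2 * r).
Proof.
move=> r0 h s; rewrite /dcoef nrmM nrm_nat.
apply: (@le_trans _ _ ((2 ^ mdeg s)%:R * (K * r ^+ (mdeg s).+1))).
  apply: ler_pM; rewrite ?ler0n ?nrm_ge0 // ?ler_nat.
    by apply: leq_trans (ltn_expl _ (isT : 1 < 2)%N); rewrite ltnS mdeg_ge.
  by have := h (madd s (munit i 1)); rewrite mdegD mdeg_unit addn1.
by rewrite natrX exprS exprMn le_eqVlt; apply/orP; left; apply/eqP; ring.
Qed.

(** A power series in the variables of S, as a one-variable series whose coefficients are power
    series in the remaining ones; [mshift] records the exponent already chosen. *)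
Fixpoint FS S c x : C :=
  if S is i :: S' then ser (fun k => x 0 i ^+ k * FS S' (mshift i k c) x) else c mon0.
Fixpoint IS S N c x : C :=
  if S is i :: S' then \sum_(k < N) x 0 i ^+ k * IS S' N (mshift i k c) x else c mon0.

Definition insupp S s := forall i, i \notin S -> s i = 0%N.

Lemma insupp_mshift i S s k : insupp S s -> insupp (i :: S) (madd s (munit i k)).
Proof.
move=> h j; rewrite inE negb_or => /andP[ji jS].
by rewrite !ffunE h // (negPf ji).
Qed.

Lemma FS_ext S c c' x : (forall s, insupp S s -> c s = c' s) -> FS S c x = FS S c' x.
Proof.
elim: S c c' => [|i S IH] c c' h /=; first by apply: h => j _; rewrite ffunE.
congr ser; apply/funext => k; congr (_ * _); apply: IH => s hs.
by apply: h; exact: insupp_mshift.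
Qed.
Lemma IS_ext S N c c' x : (forall s, insupp S s -> c s = c' s) -> IS S N c x = IS S N c' x.
Proof.
elim: S c c' => [|i S IH] c c' h /=; first by apply: h => j _; rewrite ffunE.
apply: eq_bigr => k _; congr (_ * _); apply: IH => s hs.
by apply: h; exact: insupp_mshift.
Qed.

Definition pdisc (d : R) x := forall i, nrm (x 0 i) <= d.

Lemma FS_le S c x (K d r : R) : 0 <= r -> d * r <= 1 / 2 -> geo c K r -> pdisc d x ->
  nrm (FS S c x) <= K * 4 ^+ size S.
Proof.
move=> r0 dr gc px; elim: S c K gc => [|i S IH] c K gc /=.
  by have := gc mon0; rewrite mdeg0 expr0.
have -> : K * 4 ^+ (size S).+1 = 4 * (K * 4 ^+ size S) by rewrite exprS; ring.
apply: ser_le => k; have K0 := geo_ge0 gc.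
have d0 : 0 <= d by apply: le_trans (px i); rewrite nrm_ge0.
rewrite nrmM nrmX; apply: (@le_trans _ _ (d ^+ k * (K * r ^+ k * 4 ^+ size S))).
  apply: ler_pM; rewrite ?exprn_ge0 ?nrm_ge0 //; first by rewrite lerXn2r ?nnegrE ?nrm_ge0.
  by apply: IH; exact: geo_mshift.
have -> : d ^+ k * (K * r ^+ k * 4 ^+ size S) = K * 4 ^+ size S * (d * r) ^+ k.
  by rewrite exprMn; ring.
apply: ler_wpM2l; first by rewrite mulr_ge0 ?exprn_ge0.
by rewrite -exprVn lerXn2r ?nnegrE ?mulr_ge0 ?invr_ge0 //; lra.
Qed.

Lemma FS_term S c i k x (K d r : R) : 0 <= r -> d * r <= 1 / 2 -> geo c K r -> pdisc d x ->
  nrm (x 0 i ^+ k * FS S (mshift i k c) x) <= K * 4 ^+ size S * 2 ^- k.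
Proof.
move=> r0 dr gc px; have K0 := geo_ge0 gc.
have d0 : 0 <= d by apply: le_trans (px i); rewrite nrm_ge0.
rewrite nrmM nrmX; apply: (@le_trans _ _ (d ^+ k * (K * r ^+ k * 4 ^+ size S))).
  apply: ler_pM; rewrite ?exprn_ge0 ?nrm_ge0 //; first by rewrite lerXn2r ?nnegrE ?nrm_ge0.
  by apply: (FS_le S r0 dr _ px); exact: geo_mshift.
have -> : d ^+ k * (K * r ^+ k * 4 ^+ size S) = K * 4 ^+ size S * (d * r) ^+ k.
  by rewrite exprMn; ring.
apply: ler_wpM2l; first by rewrite mulr_ge0 ?exprn_ge0.
by rewrite -exprVn lerXn2r ?nnegrE ?mulr_ge0 ?invr_ge0 //; lra.
Qed.

Lemma FS_is_ser S c i x (K d r : R) : 0 <= r -> d * r <= 1 / 2 -> geo c K r -> pdisc d x ->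
  is_ser (fun k => x 0 i ^+ k * FS S (mshift i k c) x) (FS (i :: S) c x).
Proof. by move=> r0 dr gc px; apply: is_ser_ser => k; exact: (FS_term S i k r0 dr gc px). Qed.

Lemma FSZ S c x (a : C) (K d r : R) : 0 <= r -> d * r <= 1 / 2 -> geo c K r -> pdisc d x ->
  FS S (fun s => a * c s) x = a * FS S c x.
Proof.
move=> r0 dr + px; elim: S c K => [|i S IH] c K gc //.
rewrite -(is_ser_eq (is_serZ a (FS_is_ser S i r0 dr gc px))) /=.
congr ser; apply/funext => k; rewrite mulrCA; congr (_ * _).
by rewrite -(IH _ (K * r ^+ k)) //; exact: geo_mshift.
Qed.

Lemma FS_at0 S c : FS S c 0 = c mon0.
Proof.
elim: S c => [|i S IH] c //=; apply: is_ser_eq.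
have -> : c mon0 = (0 : V) 0 i ^+ 0 * FS S (mshift i 0 c) 0 + 0.
  by rewrite addr0 expr0 mul1r IH /mshift munit0 madd0.
apply: (@is_serS (fun k => (0 : V) 0 i ^+ k * FS S (mshift i k c) 0)).
rewrite (_ : (fun k => _) = fun=> 0); first exact: is_ser0.
by apply/funext => k; rewrite mxE exprS !mul0r.
Qed.

Lemma IS_FS S N c x (K d r : R) : 0 <= r -> d * r <= 1 / 2 -> geo c K r -> pdisc d x ->
  nrm (IS S N c x - FS S c x) <= 2 * K * 4 ^+ size S * 2 ^- N.
Proof.
move=> r0 dr + px; elim: S c K => [|i S IH] c K gc.
  by rewrite subrr nrm0 !mulr_ge0 ?invr_ge0 ?exprn_ge0 // (geo_ge0 gc).
have K0 := geo_ge0 gc; have d0 : 0 <= d by apply: le_trans (px i); rewrite nrm_ge0.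
rewrite [IS _ _ _ _]/=; set U := \sum_(k < N) _.
pose W := \sum_(k < N) x 0 i ^+ k * FS S (mshift i k c) x.
apply: (le_trans (nrm_tri U W _)).
have h1 : nrm (W - FS (i :: S) c x) <= 4 * (K * 4 ^+ size S) * 2 ^- N.
  by apply: serP => k; exact: (FS_term S i k r0 dr gc px).
have h2 : nrm (U - W) <= 2 * (2 * K * 4 ^+ size S * 2 ^- N).
  rewrite /U /W -sumrB; apply: le_trans (nrm_sum _ _ _) _.
  set Q := 2 * K * 4 ^+ size S * 2 ^- N.
  have Q0 : 0 <= Q by rewrite !mulr_ge0 ?invr_ge0 ?exprn_ge0.
  have : \sum_(k < N) 2 ^- k <= 2 - 2 * 2 ^- N :> R.
    elim: (N) => [|m IHm]; first by rewrite big_ord0 expr0 invr1; lra.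
    by rewrite big_ord_recr /= exprS invfM; lra.
  have : 0 < 2 ^- N :> R by rewrite invr_gt0 exprn_gt0.
  move=> p1 p2; apply: (@le_trans _ _ (\sum_(k < N) Q * 2 ^- k)); last first.
    by rewrite -mulr_sumr mulrC; apply: ler_wpM2r => //; lra.
  apply: ler_sum => k _; rewrite -mulrBr nrmM nrmX.
  apply: (@le_trans _ _ (d ^+ k * (2 * (K * r ^+ k) * 4 ^+ size S * 2 ^- N))).
    apply: ler_pM; rewrite ?exprn_ge0 ?nrm_ge0 //; first by rewrite lerXn2r ?nnegrE ?nrm_ge0.
    by apply: IH; exact: geo_mshift.
  have -> : d ^+ k * (2 * (K * r ^+ k) * 4 ^+ size S * 2 ^- N) = Q * (d * r) ^+ k.
    by rewrite exprMn /Q; ring.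
  apply: ler_wpM2l => //.
  by rewrite -exprVn lerXn2r ?nnegrE ?mulr_ge0 ?invr_ge0 //; lra.
apply: (le_trans (lerD h2 h1)); rewrite [size (i :: S)]/= exprS.
by rewrite le_eqVlt; apply/orP; left; apply/eqP; ring.
Qed.

Definition FD S c x u : C := \sum_(j <- S) u 0 j * FS S (dcoef j c) x.

Lemma FD_le S c x u (K d r e : R) : 0 <= r -> d * r <= 1 / 16 -> geo c K r -> pdisc d x ->
  0 <= e -> pdisc (e * d) u -> nrm (FD S c x u) <= K * 8 ^+ size S * e.
Proof.
move=> r0 dr gc px e0 pu; have K0 := geo_ge0 gc; rewrite /FD.
apply: le_trans (nrm_sum _ _ _) _.
apply: (@le_trans _ _ (\sum_(j <- S) (K * 4 ^+ size S * e))).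
  apply: ler_sum => j _; rewrite nrmM.
  have d0 : 0 <= d by apply: le_trans (px j); rewrite nrm_ge0.
  apply: (@le_trans _ _ (e * d * (K * r * 4 ^+ size S))).
    apply: ler_pM; rewrite ?nrm_ge0 //.
    by apply: (@FS_le S _ x _ d (2 * r)) => //; [lra | lra | exact: geo_dcoef].
  have -> : e * d * (K * r * 4 ^+ size S) = K * 4 ^+ size S * e * (d * r) by ring.
  by rewrite ler_piMr ?mulr_ge0 ?exprn_ge0 //; lra.
rewrite big_const_seq count_predT iter_addr_0 -[_ *+ size S]mulr_natr.
have -> : K * 8 ^+ size S * e = K * 4 ^+ size S * e * 2 ^+ size S.
  by rewrite (_ : 8 = 4 * 2 :> R) ?exprMn; ring.
apply: ler_wpM2l; first by rewrite !mulr_ge0 ?exprn_ge0.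
by rewrite -natrX ler_nat ltnW // ltn_expl.
Qed.

Lemma powD_rem (p q : C) (d e : R) k : 0 <= e -> nrm p <= d -> nrm (p + q) <= 2 * d -> nrm q <= e * d ->
  nrm ((p + q) ^+ k - p ^+ k - k%:R * q * p ^+ k.-1) <= 4 ^+ k * d ^+ k * e ^+ 2.
Proof.
move=> e0 hp hpq hq; have d0 : 0 <= d by apply: le_trans hp; rewrite nrm_ge0.
elim: k => [|k IH].
  by rewrite !expr0 subrr !mul0r subr0 nrm0 mulr_ge0 ?exprn_ge0 // mulr_ge0.
set t := _ - _ in IH.
have -> : (p + q) ^+ k.+1 - p ^+ k.+1 - k.+1%:R * q * p ^+ k.+1.-1 =
   (p + q) * t + k%:R * q ^+ 2 * p ^+ k.-1.
  rewrite /t; case: (k) => [|m]; first by rewrite !expr0 !expr1; ring.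
  by rewrite /= !exprS -[m.+2]add1n -[m.+1]add1n !natrD; ring.
apply: (le_trans (nrmD _ _)); rewrite !nrmM nrm_nat !nrmX.
have h1 : nrm (p + q) * nrm t <= 2 * d * (4 ^+ k * d ^+ k * e ^+ 2).
  by apply: ler_pM; rewrite ?nrm_ge0.
have h2 : k%:R * nrm q ^+ 2 * nrm p ^+ k.-1 <= 2 * 4 ^+ k * d ^+ k.+1 * e ^+ 2.
  case: (k) => [|m]; first by rewrite !mul0r !mulr_ge0 ?exprn_ge0.
  apply: (@le_trans _ _ (m.+1%:R * (e * d) ^+ 2 * d ^+ m)).
    apply: ler_pM; rewrite ?mulr_ge0 ?exprn_ge0 ?nrm_ge0 //; last by rewrite lerXn2r ?nnegrE ?nrm_ge0.
    by apply: ler_wpM2l; rewrite ?ler0n // lerXn2r ?nnegrE ?nrm_ge0 // mulr_ge0.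
  have -> : m.+1%:R * (e * d) ^+ 2 * d ^+ m = m.+1%:R * (d ^+ m.+2 * e ^+ 2).
    by rewrite !exprS; ring.
  rewrite -[X in _ <= X]mulrA; apply: ler_wpM2r; first by rewrite mulr_ge0 ?exprn_ge0.
  have : m.+1%:R <= 4 ^+ m.+1 :> R by rewrite -natrX ler_nat ltnW // ltn_expl.
  have : 0 <= 4 ^+ m.+1 :> R by rewrite exprn_ge0.
  lra.
by apply: (le_trans (lerD h1 h2)); rewrite !exprS le_eqVlt; apply/orP; left; apply/eqP; ring.
Qed.

(** Induction on the variables. The displacement is measured by its ratio e to the polyradius d; the
    k-th term splits by the product rule into the remainder of the k-th power, a mixed term and the
    inductive remainder, each of order e^2 and decaying like 2^-k. *)
Lemma FS_rem S c x u (K d r e : R) : uniq S -> 0 <= r -> d * r <= 1 / 16 -> geo c K r -> pdisc d x ->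
  0 <= e -> e <= 1 -> pdisc (e * d) u ->
  nrm (FS S c (x + u) - FS S c x - FD S c x u) <= K * 16 ^+ size S * e ^+ 2.
Proof.
move=> uS r0 dr + px e0 e1 pu; elim: S uS c K => [_|i S IH /= /andP[iS uS]] c K gc.
  by rewrite /FD big_nil /= subrr subr0 nrm0 !mulr_ge0 ?exprn_ge0 // (geo_ge0 gc).
have K0 := geo_ge0 gc; have d0 : 0 <= d by apply: le_trans (px i); rewrite nrm_ge0.
have pxu : pdisc (2 * d) (x + u).
  move=> j; rewrite mxE; apply: le_trans (nrmD _ _) _; rewrite mulr_natl mulr2n.
  by apply: lerD => //; apply: le_trans (pu j) _; rewrite ler_piMl.
have dr2 : 2 * d * r <= 1 / 2 by lra.
have dr1 : d * r <= 1 / 2 by lra.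
have dr3 : d * (2 * r) <= 1 / 2 by lra.
pose p := x 0 i; pose q := u 0 i.
pose a k y := FS S (mshift i k c) y.
pose Dk k := FD S (mshift i k c) x u.
have hq : nrm q <= e * d by exact: pu.
have gs k : geo (mshift i k c) (K * r ^+ k) r by exact: geo_mshift.
have tk k := @powD_rem p q d e k e0 (px i) (_ : nrm (p + q) <= 2 * d) hq.
have {}tk k : nrm ((p + q) ^+ k - p ^+ k - k%:R * q * p ^+ k.-1) <= 4 ^+ k * d ^+ k * e ^+ 2.
  by apply: tk; have := pxu i; rewrite mxE.
pose T k := (p + q) ^+ k * a k (x + u) - p ^+ k * a k x - (k%:R * q * p ^+ k.-1 * a k x + p ^+ k * Dk k).
have dk k : nrm (k%:R * q * p ^+ k.-1) <= 2 ^+ k * d ^+ k * e.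
  rewrite !nrmM nrm_nat nrmX; case: k => [|k]; first by rewrite !mul0r !mulr_ge0 ?exprn_ge0.
  apply: (@le_trans _ _ (k.+1%:R * (e * d) * d ^+ k)).
    apply: ler_pM; rewrite ?mulr_ge0 ?exprn_ge0 ?nrm_ge0 //; first by rewrite ler_wpM2l.
    by rewrite /= lerXn2r ?nnegrE ?nrm_ge0 //; exact: px.
  have -> : k.+1%:R * (e * d) * d ^+ k = k.+1%:R * (d ^+ k.+1 * e) by rewrite exprS; ring.
  rewrite -mulrA; apply: ler_wpM2r; first by rewrite mulr_ge0 ?exprn_ge0.
  by rewrite -natrX ler_nat ltnW // ltn_expl.
have e2 : e ^+ 2 <= e by rewrite expr2 ler_piMr.
have hT k : nrm (T k) <= K * (2 * 8 ^+ size S + 2 * 16 ^+ size S) * e ^+ 2 * 2 ^- k.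
  pose t := (p + q) ^+ k - p ^+ k - k%:R * q * p ^+ k.-1; pose rk := a k (x + u) - a k x - Dk k.
  pose w := k%:R * q * p ^+ k.-1.
  have -> : T k = (t * a k (x + u) + w * (Dk k + rk)) + p ^+ k * rk.
    by rewrite /T /rk /t /w; ring.
  have h1 : nrm (a k (x + u)) <= K * r ^+ k * 4 ^+ size S by apply: (FS_le S r0 dr2 (gs k) pxu).
  have h2 : nrm rk <= K * r ^+ k * 16 ^+ size S * e ^+ 2 by exact: IH.
  have h3 : nrm (Dk k) <= K * r ^+ k * 8 ^+ size S * e by apply: (FD_le S r0 dr (gs k) px e0 pu).
  have Kr : 0 <= K * r ^+ k by rewrite mulr_ge0 ?exprn_ge0.
  have h4 : nrm (Dk k + rk) <= K * r ^+ k * (8 ^+ size S + 16 ^+ size S) * e.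
    apply: (le_trans (nrmD _ _)); apply: (le_trans (lerD h3 h2)).
    rewrite mulrDr mulrDl lerD2l; apply: ler_wpM2l => //.
    by rewrite mulr_ge0 ?exprn_ge0.
  have hp : nrm (p ^+ k) <= d ^+ k by rewrite nrmX lerXn2r ?nnegrE ?nrm_ge0 //; exact: px.
  have h5 := ler_pM (nrm_ge0 _) (nrm_ge0 _) (tk k) h1.
  have h6 := ler_pM (nrm_ge0 _) (nrm_ge0 _) (dk k) h4.
  have h7 := ler_pM (nrm_ge0 _) (nrm_ge0 _) hp h2.
  apply: (le_trans (nrmD _ _)); apply: (le_trans (lerD (nrmD _ _) (lexx _))).
  rewrite (nrmM t) (nrmM w) (nrmM (p ^+ k)).
  apply: (le_trans (lerD (lerD h5 h6) h7)).
  set A := 4 ^+ size S; set B := 8 ^+ size S; set D := 16 ^+ size S.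
  have A0 : 0 <= A by rewrite exprn_ge0.
  have B0 : 0 <= B by rewrite exprn_ge0.
  have D0 : 0 <= D by rewrite exprn_ge0.
  have AB : A <= B by rewrite /A /B lerXn2r ?nnegrE //; lra.
  pose m := (4 * d * r) ^+ k.
  have m0 : 0 <= m by rewrite exprn_ge0 // !mulr_ge0.
  have m1 : m <= 2 ^- k by rewrite /m -exprVn lerXn2r ?nnegrE ?invr_ge0 ?mulr_ge0 //; lra.
  have mE : m = 4 ^+ k * (d ^+ k * r ^+ k) by rewrite /m !exprMn; ring.
  have l2 : 2 ^+ k <= 4 ^+ k :> R by rewrite lerXn2r ?nnegrE //; lra.
  have l1 : 1 <= 4 ^+ k :> R by rewrite exprn_ege1 //; lra.
  pose y := d ^+ k * r ^+ k; have y0 : 0 <= y by rewrite mulr_ge0 ?exprn_ge0.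
  apply: (@le_trans _ _ (K * (2 * B + 2 * D) * e ^+ 2 * m)); last first.
    by apply: ler_wpM2l m1; rewrite !mulr_ge0 ?addr_ge0 ?mulr_ge0 ?exprn_ge0.
  have -> : 4 ^+ k * d ^+ k * e ^+ 2 * (K * r ^+ k * A) + 2 ^+ k * d ^+ k * e * (K * r ^+ k * (B + D) * e)
     + d ^+ k * (K * r ^+ k * D * e ^+ 2) = K * e ^+ 2 * y * (4 ^+ k * A + 2 ^+ k * (B + D) + D).
    by rewrite /y; ring.
  have -> : K * (2 * B + 2 * D) * e ^+ 2 * m = K * e ^+ 2 * y * (4 ^+ k * B + 4 ^+ k * (B + D) + 4 ^+ k * D).
    by rewrite mE /y; ring.
  apply: ler_wpM2l; first by rewrite !mulr_ge0 ?exprn_ge0.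
  apply: lerD; first apply: lerD.
  - by apply: ler_wpM2l => //; lra.
  - by apply: ler_wpM2r => //; rewrite addr_ge0.
  - by apply: ler_peMl.
(* The remainder is summed term by term: in the direction i the derivative is the series with k
   p^(k-1), shifted by one index; the other directions differentiate the coefficients. *)
have sT : is_ser T (FS (i :: S) c (x + u) - FS (i :: S) c x - FD (i :: S) c x u).
  have s1 := FS_is_ser S i r0 dr2 gc pxu.
  have s2 := FS_is_ser S i r0 dr1 gc px.
  have gd j : geo (dcoef j c) (K * r) (2 * r) by exact: geo_dcoef.
  have r20 : 0 <= 2 * r by lra.
  have s3 : is_ser (fun k => q * (k%:R * p ^+ k.-1 * a k x)) (q * FS (i :: S) (dcoef i c) x).
    apply: is_serZ; rewrite -[FS _ _ _]add0r.
    have -> : 0 = 0%:R * p ^+ 0.-1 * a 0%N x by rewrite !mul0r.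
    apply: (@is_serS (fun k => k%:R * p ^+ k.-1 * a k x)).
    have := FS_is_ser S i r20 dr3 (gd i) px.
    congr is_ser; apply/funext => k; rewrite -/p /= [k.+1%:R * _]mulrC -mulrA; congr (_ * _).
    rewrite -(FSZ S k.+1%:R r0 dr1 (gs k.+1) px); apply: FS_ext => s hs.
    rewrite /mshift /dcoef !ffunE hs // eqxx add0n -maddA -munitD addn1 //.
  have s4 : is_ser (fun k => p ^+ k * Dk k) (\sum_(j <- S) u 0 j * FS (i :: S) (dcoef j c) x).
    have E : (fun k => p ^+ k * Dk k) = fun k => \sum_(j <- S) u 0 j * (p ^+ k * FS S (mshift i k (dcoef j c)) x).
      apply/funext => k; rewrite /Dk /FD mulr_sumr; apply: eq_big_seq => j jS.
      rewrite mulrCA; congr (_ * (_ * _)); apply: FS_ext => s hs.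
      have ji : j != i by apply: contraNneq iS => <-.
      rewrite /mshift /dcoef !ffunE (negPf ji) addn0 -!maddA; congr (_ * c (madd _ _)).
      exact: maddC.
    rewrite E; apply: is_ser_sum => j; apply: is_serZ.
    exact: (FS_is_ser S i r20 dr3 (gd j) px).
  have s5 := is_serD (is_serD s1 (is_serZ (-1) s2)) (is_serZ (-1) (is_serD s3 s4)).
  rewrite /FD big_cons.
  move: s5; congr is_ser; last by rewrite -/q; ring.
  by apply/funext => k; rewrite /T /a mxE -/p -/q; ring.
apply: (le_trans (is_ser_le sT hT)).
have : 0 <= K * e ^+ 2 by rewrite mulr_ge0 ?exprn_ge0.
have : 8 ^+ size S <= 16 ^+ size S :> R by rewrite lerXn2r ?nnegrE //; lra.
move=> h1 h2.
have -> : 4 * (K * (2 * 8 ^+ size S + 2 * 16 ^+ size S) * e ^+ 2) =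
  K * e ^+ 2 * (8 * 8 ^+ size S + 8 * 16 ^+ size S) by ring.
have -> : K * 16 ^+ (size S).+1 * e ^+ 2 = K * e ^+ 2 * (16 * 16 ^+ size S) by rewrite exprS; ring.
by apply: ler_wpM2l => //; lra.
Qed.
End IteratedSeries.

(** * Coefficient operators on functions of several variables *)

Section Osgood.
Variables (R : realType) (n : nat).
Local Notation C := (CC R).
Local Notation V := 'rV[CC R]_n.
Local Notation mon := {ffun 'I_n -> nat}.
Implicit Types (x y u : V) (s : mon) (i j : 'I_n) (S : seq 'I_n) (F G : V -> C).

Definition upd x i (t : C) : V := \row_j (if j == i then t else x 0 j).

Lemma upd_same x i t : upd x i t 0 i = t. Proof. by rewrite mxE eqxx. Qed.
Lemma upd_other x i j t : j != i -> upd x i t 0 j = x 0 j.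
Proof. by move=> ji; rewrite mxE (negPf ji). Qed.
Lemma upd_id x i : upd x i (x 0 i) = x.
Proof. by apply/rowP => j; rewrite mxE; case: eqP => [->|]. Qed.
Lemma updK x i t t' : upd (upd x i t) i t' = upd x i t'.
Proof. by apply/rowP => j; rewrite !mxE; case: eqP. Qed.
Lemma updC x i j t t' : i != j -> upd (upd x i t) j t' = upd (upd x j t') i t.
Proof.
move=> ij; apply/rowP => l; rewrite !mxE; case: eqP => [->|//].
by rewrite eq_sym (negPf ij).
Qed.
Lemma pdisc_upd (d : R) x i t : pdisc d x -> nrm t <= d -> pdisc d (upd x i t).
Proof. by move=> px ht j; rewrite mxE; case: ifP. Qed.
Lemma pdisc_weak (d e : R) x : d <= e -> pdisc d x -> pdisc e x.
Proof. by move=> de h i; apply: le_trans (h i) de. Qed.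

Variable r : R.
Hypothesis r0 : 0 < r.
Let r1 : 2 * r <= 3 * r. Proof. by rewrite ler_pM2r ?ler_nat. Qed.

(** This class replaces holomorphy in the remaining variables: it survives the coefficient operators
    [Lop] by their linearity and boundedness, with no differentiation under the integral sign. *)
Definition lips (M L : R) F :=
  (forall x, pdisc (3 * r) x -> nrm (F x) <= M) /\
  (forall x i t t', pdisc (3 * r) x -> nrm t <= 3 * r -> nrm t' <= 3 * r ->
     nrm (F (upd x i t) - F (upd x i t')) <= L * nrm (t - t')).
Definition lipc F := exists M L, 0 <= L /\ lips M L F.

Lemma lipc_slice F x i : lipc F -> pdisc (3 * r) x -> csq (fun t => F (upd x i t)) r.
Proof.
move=> [M [L [L0 [_ hL]]]] px a b ha hb _ e e0.
have hp : nrm (pt a b) <= 2 * r.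
  by apply: le_trans (nrm_ReIm _) _; rewrite /= mulr_natl mulr2n; apply: lerD; rewrite ler_norml.
exists (Num.min r (e / (1 + L))); first by rewrite lt_min r0 divr_gt0 //; lra.
move=> w; rewrite lt_min => /andP[h1 h2].
have hw : nrm w <= 3 * r.
  have := nrm_tri w (pt a b) 0; rewrite !subr0; lra.
apply: (le_lt_trans (hL _ _ _ _ px hw (le_trans hp r1))).
apply: (@le_lt_trans _ _ (L * (e / (1 + L)))); first by apply: ler_wpM2l => //; exact: ltW.
by rewrite mulrA ltr_pdivrMr ?ltr_pwDl // mulrC ltr_pM2l //; lra.
Qed.

Lemma lipcD F G : lipc F -> lipc G -> lipc (fun x => F x + G x).
Proof.
move=> [M [L [L0 [h1 h2]]]] [M' [L' [L0' [h1' h2']]]]; exists (M + M'), (L + L').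
split; first exact: addr_ge0.
split => [x px|x i t t' px ht ht']; first by apply: le_trans (nrmD _ _) _; apply: lerD; [exact: h1|exact: h1'].
rewrite opprD addrACA mulrDl; apply: le_trans (nrmD _ _) _; apply: lerD; [exact: h2|exact: h2'].
Qed.
Lemma lipcM F G : lipc F -> lipc G -> lipc (fun x => F x * G x).
Proof.
move=> [M [L [L0 [h1 h2]]]] [M' [L' [L0' [h1' h2']]]].
pose A := Num.max 0 M; pose B := Num.max 0 M'.
have A0 : 0 <= A by rewrite le_max lexx.
have B0 : 0 <= B by rewrite le_max lexx.
have hA x : pdisc (3 * r) x -> nrm (F x) <= A by move=> /h1 h; rewrite le_max h orbT.
have hB x : pdisc (3 * r) x -> nrm (G x) <= B by move=> /h1' h; rewrite le_max h orbT.
exists (A * B), (L * B + A * L'); split; first by rewrite addr_ge0 ?mulr_ge0.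
split => [x px|x i t t' px ht ht'].
  by rewrite nrmM; apply: ler_pM; rewrite ?nrm_ge0 ?hA ?hB.
have -> : F (upd x i t) * G (upd x i t) - F (upd x i t') * G (upd x i t') =
  (F (upd x i t) - F (upd x i t')) * G (upd x i t) + F (upd x i t') * (G (upd x i t) - G (upd x i t')).
  by ring.
apply: le_trans (nrmD _ _) _; rewrite !nrmM mulrDl; apply: lerD.
  rewrite mulrAC; apply: ler_pM; rewrite ?nrm_ge0 //; first exact: h2.
  by apply: hB; exact: pdisc_upd.
rewrite -mulrA; apply: ler_pM; rewrite ?nrm_ge0 //; last exact: h2'.
by apply: hA; exact: pdisc_upd.
Qed.
Lemma lipc_cst (c : C) : lipc (fun=> c).
Proof. by exists (nrm c), 0; do 2 split => //; move=> *; rewrite subrr nrm0 mul0r. Qed.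
Lemma lipc_coord i : lipc (fun x => x 0 i).
Proof.
exists (3 * r), 1; split => //; split; first by move=> x; exact.
move=> x j t t' px ht ht'; rewrite !mxE mul1r.
by case: eqP => // _; rewrite subrr nrm0 nrm_ge0.
Qed.
Lemma lipcX F k : lipc F -> lipc (fun x => F x ^+ k).
Proof.
move=> h; elim: k => [|k IH]; first exact: lipc_cst.
by under eq_fun do rewrite exprS; exact: lipcM.
Qed.
Lemma lipc_sum N (F : nat -> V -> C) : (forall k, lipc (F k)) -> lipc (fun x => \sum_(k < N) F k x).
Proof.
move=> h; elim: N => [|N IH].
  by under eq_fun do rewrite big_ord0; exact: lipc_cst.
by under eq_fun do rewrite big_ord_recr; exact: lipcD.
Qed.
Lemma lipcB F G : lipc F -> lipc G -> lipc (fun x => F x - G x).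
Proof.
move=> hF hG; under eq_fun do rewrite -mulN1r.
by apply: lipcD => //; apply: lipcM => //; exact: lipc_cst.
Qed.

Lemma tcoefB (f g : C -> C) k : csq f r -> csq g r ->
  csq (fun z => f z - g z) r /\ tcoef r (fun z => f z - g z) k = tcoef r f k - tcoef r g k.
Proof.
move=> cf cg; have cg' := csqM (csq_cst (-1) (r := r)) cg.
have E : (fun z => f z - g z) = fun z => f z + (-1) * g z by apply/funext => z; rewrite mulN1r.
by rewrite E tcoefD // tcoefZ // mulN1r; split => //; exact: csqD.
Qed.

Definition Lop i k F x : C := tcoef r (fun t => F (upd x i t)) k.

Lemma Lop_le i k F (M : R) x : lipc F -> pdisc (3 * r) x ->
  (forall t, nrm t <= 2 * r -> nrm (F (upd x i t)) <= M) -> nrm (Lop i k F x) <= 4 * M * r ^- k.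
Proof.
move=> lF px hM; apply: tcoef_le; [exact: r0 | exact: lipc_slice | ].
by move=> z hz _; exact: hM.
Qed.

Lemma lipc_Lop i k F : lipc F -> lipc (Lop i k F).
Proof.
move=> lF; have [M [L [L0 [h1 h2]]]] := lF.
have rk : 0 <= r ^- k by rewrite invr_ge0 exprn_ge0 // ltW.
exists (4 * M * r ^- k), (4 * L * r ^- k); split; first by rewrite !mulr_ge0.
split => [x px|x j t t' px ht ht'].
  by apply: Lop_le => // t ht; apply: h1; apply: pdisc_upd => //; exact: le_trans ht r1.
have [->|ji] := eqVneq j i.
  rewrite /Lop.
  rewrite (_ : (fun t0 => F (upd (upd x i t) i t0)) = (fun t0 => F (upd x i t0))).
    rewrite (_ : (fun t0 => F (upd (upd x i t') i t0)) = (fun t0 => F (upd x i t0))).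
      by rewrite subrr nrm0 !mulr_ge0 ?nrm_ge0.
    by apply/funext => t0; rewrite updK.
  by apply/funext => t0; rewrite updK.
have c1 := lipc_slice i lF (pdisc_upd j px ht).
have c2 := lipc_slice i lF (pdisc_upd j px ht').
have [c3 <-] := tcoefB k c1 c2.
rewrite [X in _ <= X](_ : _ = 4 * (L * nrm (t - t')) * r ^- k); last by ring.
apply: tcoef_le => // z z1 _; rewrite !(@updC x j i) //.
by apply: h2 => //; apply: pdisc_upd => //; exact: le_trans z1 r1.
Qed.

(** Taylor polynomial of length N in the variable i, the other variables being parameters. *)
Definition Pop i N F x : C := \sum_(k < N) x 0 i ^+ k * Lop i k F x.
Lemma lipc_Pop i N F : lipc F -> lipc (Pop i N F).
Proof.
move=> lF; apply: (@lipc_sum N (fun k x => x 0 i ^+ k * Lop i k F x)) => k.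
by apply: lipcM; [apply: lipcX; exact: lipc_coord | exact: lipc_Lop].
Qed.

Lemma sum_half N : \sum_(k < N) 2 ^- k <= 2 :> R.
Proof.
suff : \sum_(k < N) 2 ^- k <= 2 - 2 * 2 ^- N :> R.
  have : 0 < 2 ^- N :> R by rewrite invr_gt0 exprn_gt0.
  lra.
elim: N => [|m IHm]; first by rewrite big_ord0 expr0 invr1; lra.
by rewrite big_ord_recr /= exprS invfM; lra.
Qed.

Lemma Pop_le i N F (M : R) x : lipc F -> pdisc (3 * r) x -> nrm (x 0 i) <= r / 2 ->
  (forall t, nrm t <= 2 * r -> nrm (F (upd x i t)) <= M) -> nrm (Pop i N F x) <= 8 * M.
Proof.
move=> lF px hx hM.
have M0 : 0 <= M by apply: le_trans (hM 0 _); rewrite ?nrm_ge0 // nrm0; move: (r0); lra.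
apply: le_trans (nrm_sum _ _ _) _.
apply: (@le_trans _ _ (\sum_(k < N) 4 * M * 2 ^- k)); last first.
  by rewrite -mulr_sumr; have := ler_wpM2l (_ : 0 <= 4 * M) (sum_half N); lra.
apply: ler_sum => k _; rewrite nrmM nrmX.
apply: (@le_trans _ _ ((r / 2) ^+ k * (4 * M * r ^- k))).
  apply: ler_pM; rewrite ?exprn_ge0 ?nrm_ge0 //; last exact: Lop_le.
  by rewrite lerXn2r ?nnegrE ?nrm_ge0 // divr_ge0 // ltW.
by rewrite exprMn -exprVn le_eqVlt; apply/orP; left; apply/eqP; field; rewrite expf_neq0 // gt_eqF.
Qed.

Fixpoint PS S N F : V -> C := if S is i :: S' then Pop i N (PS S' N F) else F.
Fixpoint opL S s F : V -> C := if S is i :: S' then Lop i (s i) (opL S' s F) else F.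

Lemma lipc_PS S N F : lipc F -> lipc (PS S N F).
Proof. by move=> lF; elim: S => //= i S IH; exact: lipc_Pop. Qed.
Lemma lipc_opL S s F : lipc F -> lipc (opL S s F).
Proof. by move=> lF; elim: S => //= i S IH; exact: lipc_Lop. Qed.

Lemma Pop_sub i N F G x : lipc F -> lipc G -> pdisc (3 * r) x ->
  Pop i N (fun y => F y - G y) x = Pop i N F x - Pop i N G x.
Proof.
move=> lF lG px; rewrite /Pop -sumrB; apply: eq_bigr => k _; rewrite -mulrBr; congr (_ * _).
by case: (tcoefB k (lipc_slice i lF px) (lipc_slice i lG px)).
Qed.

(** The variables are treated one at a time. By [Pop_le] each [Pop] multiplies an error by at most
    8, and M + 8 M 9^k <= M 9^(k+1). *)
Lemma PS_approx S N F (M : R) : 0 <= M -> lipc F ->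
  (forall x i, pdisc (3 * r) x -> nrm (x 0 i) <= r / 2 -> nrm (F x - Pop i N F x) <= M) ->
  forall x, pdisc (3 * r) x -> (forall i, i \in S -> nrm (x 0 i) <= r / 2) -> uniq S ->
  nrm (F x - PS S N F x) <= M * 9 ^+ size S.
Proof.
move=> M0 lF hF; elim: S => [|i S IH] x px hx /=.
  by rewrite subrr nrm0 expr0 mulr1.
move=> /andP[iS uS]; have hi : nrm (x 0 i) <= r / 2 by apply: hx; rewrite mem_head.
apply: le_trans (nrm_tri _ (Pop i N F x) _) _.
rewrite -Pop_sub //; last exact: lipc_PS.
apply: (@le_trans _ _ (M + 8 * (M * 9 ^+ size S))); last first.
  have : 1 <= 9 ^+ size S :> R by rewrite exprn_ege1 //; lra.
  by move=> h; have := ler_wpM2l M0 h; rewrite exprS; lra.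
apply: lerD; first exact: hF.
apply: Pop_le => //; first by apply: lipcB => //; exact: lipc_PS.
move=> t ht; apply: IH => //; first by apply: pdisc_upd => //; exact: le_trans ht r1.
move=> j jS; rewrite upd_other; last by apply: contraNneq iS => <-.
by apply: hx; rewrite inE jS orbT.
Qed.

Lemma opL_indep S s F x y : (forall j, j \notin S -> x 0 j = y 0 j) -> opL S s F x = opL S s F y.
Proof.
elim: S x y => [|i S IH] x y h /=; first by congr F; apply/rowP => j; exact: h.
rewrite /Lop; apply: eq_tcoef => // z _ _; apply: IH => j jS; rewrite !mxE.
by case: eqP => // /eqP ji; apply: h; rewrite inE negb_or ji.
Qed.
Lemma opL_ext S s s' F x : (forall j, j \in S -> s j = s' j) -> opL S s F x = opL S s' F x.
Proof.
elim: S x => [|i S IH] x h; first by [].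
rewrite /= /Lop h ?mem_head; last by [].
by apply: eq_tcoef => // z _ _; apply: IH => j jS; apply: h; rewrite inE jS orbT.
Qed.
Lemma opL_le S s F (M : R) x : lipc F -> (forall x, pdisc (3 * r) x -> nrm (F x) <= M) ->
  pdisc (3 * r) x -> nrm (opL S s F x) <= M * 4 ^+ size S * \prod_(i <- S) r ^- s i.
Proof.
move=> lF hM; elim: S x => [|i S IH] x px /=; first by rewrite big_nil !mulr1; exact: hM.
rewrite big_cons exprS; set b := \prod_(_ <- _) _ in IH *; set a := r ^- s i.
have -> : M * (4 * 4 ^+ size S) * (a * b) = 4 * (M * 4 ^+ size S * b) * a by ring.
apply: Lop_le => //; first exact: lipc_opL.
by move=> t ht; apply: IH; apply: pdisc_upd => //; exact: le_trans ht r1.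
Qed.

Lemma IS_indep S N (c : mon -> C) x y : (forall j, j \in S -> x 0 j = y 0 j) -> IS S N c x = IS S N c y.
Proof.
elim: S c => [|i S IH] c h //=; rewrite h ?mem_head //.
by apply: eq_bigr => k _; rewrite (IH (mshift i k c)) // => j jS; apply: h; rewrite inE jS orbT.
Qed.

Lemma tcoef_IS S N (g : mon -> C -> C) x k : (forall s, csq (g s) r) ->
  csq (fun t => IS S N (fun s => g s t) x) r /\
  tcoef r (fun t => IS S N (fun s => g s t) x) k = IS S N (fun s => tcoef r (g s) k) x.
Proof.
elim: S g => [|i S IH] g cg; first by split => //; exact: cg.
have cS l : csq (fun t => IS S N (fun s => g (madd s (munit i l)) t) x) r.
  by case: (IH (fun s => g (madd s (munit i l)))).
have cP l : csq (fun t => x 0 i ^+ l * IS S N (fun s => g (madd s (munit i l)) t) x) r.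
  by apply: csqM => //; exact: csq_cst.
suff H m : csq (fun t => \sum_(l < m) x 0 i ^+ l * IS S N (mshift i l (fun s => g s t)) x) r /\
    tcoef r (fun t => \sum_(l < m) x 0 i ^+ l * IS S N (mshift i l (fun s => g s t)) x) k =
    \sum_(l < m) x 0 i ^+ l * IS S N (mshift i l (fun s => tcoef r (g s) k)) x by exact: (H N).
elim: m => [|m [IH1 IH2]].
  have E : (fun t => \sum_(l < 0) x 0 i ^+ l * IS S N (mshift i l (fun s => g s t)) x) = fun=> 0.
    by apply/funext => t; rewrite big_ord0.
  rewrite E big_ord0; split; first exact: csq_cst.
  have c0 : csq (fun=> 0 : C) r by exact: csq_cst.
  have h0 : tcoef r (fun=> 0 * 0 : C) k = 0 * tcoef r (fun=> 0) k := tcoefZ k 0 r0 c0.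
  by move: h0; rewrite (mul0r (0 : C)) => ->; exact: mul0r.
have E : (fun t => \sum_(l < m.+1) x 0 i ^+ l * IS S N (mshift i l (fun s => g s t)) x) =
  fun t => \sum_(l < m) x 0 i ^+ l * IS S N (mshift i l (fun s => g s t)) x +
     x 0 i ^+ m * IS S N (fun s => g (madd s (munit i m)) t) x.
  by apply/funext => t; rewrite big_ord_recr.
rewrite E; split; first exact: csqD.
rewrite tcoefD // IH2 big_ord_recr /=; congr (_ + _).
rewrite tcoefZ //; congr (_ * _).
by case: (IH (fun s => g (madd s (munit i m)))) => [|_ ->].
Qed.

(** Taking coefficients commutes with finite sums, so successive Taylor polynomials form a single
    polynomial whose coefficients are the iterated ones of [opL]. *)
Lemma PS_IS S N F x : uniq S -> lipc F -> pdisc (3 * r) x ->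
  PS S N F x = IS S N (fun s => opL S s F x) x.
Proof.
move=> + lF; elim: S x => [|i S IH] x //= /andP[iS uS] px.
rewrite /Pop; apply: eq_bigr => k _; congr (_ * _).
pose g s t := opL S s F (upd x i t).
have cg s : csq (g s) r by apply: lipc_slice => //; exact: lipc_opL.
transitivity (tcoef r (fun t => IS S N (fun s => g s t) x) k).
  apply: eq_tcoef => // t ht _; rewrite IH //; last first.
    by apply: pdisc_upd => //; exact: le_trans ht r1.
  apply: IS_indep => j jS; rewrite upd_other //; by apply: contraNneq iS => <-.
rewrite (tcoef_IS S N x k cg).2; apply: IS_ext => s hs.
rewrite /mshift !ffunE hs // eqxx /= /Lop; apply: eq_tcoef => // t _ _.
apply: opL_ext => j jS; rewrite !ffunE; case: eqP => [ji|_]; last by rewrite addn0.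
by move: iS; rewrite -ji jS.
Qed.
End Osgood.

(** * Osgood's lemma: separately holomorphic bounded functions are power series *)

Section OsgoodTheorem.
Variables (R : realType) (n : nat).
Local Notation C := (CC R).
Local Notation V := 'rV[CC R]_n.
Local Notation mon := {ffun 'I_n -> nat}.

(** The factor q on the left avoids the exponent k - 1. *)
Lemma subX_le (t t' : C) (q : R) k : nrm t <= q -> nrm t' <= q ->
  q * nrm (t ^+ k - t' ^+ k) <= nrm (t - t') * k%:R * q ^+ k.
Proof.
move=> h1 h2; have q0 : 0 <= q by apply: le_trans h1; rewrite nrm_ge0.
elim: k => [|k IH]; first by rewrite !expr0 subrr nrm0 !mulr0 mul0r.
have -> : t ^+ k.+1 - t' ^+ k.+1 = t * (t ^+ k - t' ^+ k) + (t - t') * t' ^+ k.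
  by rewrite !exprS; ring.
apply: (@le_trans _ _ (q * (q * nrm (t ^+ k - t' ^+ k) + nrm (t - t') * q ^+ k))).
  apply: ler_wpM2l => //; apply: le_trans (nrmD _ _) _; rewrite !nrmM nrmX.
  apply: lerD; first by apply: ler_wpM2r => //; rewrite nrm_ge0.
  by apply: ler_wpM2l; rewrite ?nrm_ge0 // lerXn2r ?nnegrE ?nrm_ge0.
have := ler_wpM2l q0 IH; rewrite -[k.+1]add1n natrD exprS; lra.
Qed.

(** The Taylor polynomials of length N satisfy the estimate with a constant independent of N, and
    the two approximation errors vanish as N grows. *)
Lemma lipschitz1 (r M : R) (f : C -> C) t t' : 0 < r ->
  (forall z, nrm z <= 2 * r -> cdiff f z) -> (forall z, nrm z <= 2 * r -> nrm (f z) <= M) ->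
  nrm t <= r / 4 -> nrm t' <= r / 4 -> nrm (f t - f t') <= 128 * M / r * nrm (t - t').
Proof.
move=> r0 df hM ht ht'; rewrite -subr_le0; apply: (@le_all_small _ _ (32 * M)) => N.
have M0 : 0 <= M by apply: le_trans (hM 0 _); rewrite ?nrm_ge0 // nrm0; lra.
have h1 := taylor1 r0 df hM N (_ : nrm t <= r / 2).
have h2 := taylor1 r0 df hM N (_ : nrm t' <= r / 2).
move: h1 h2; set A := \sum_(k < N) _; set B := \sum_(k < N) _ => h1 h2.
have {}h1 : nrm (f t - A) <= 16 * M * 2 ^- N by apply: h1; lra.
have {}h2 : nrm (f t' - B) <= 16 * M * 2 ^- N by apply: h2; lra.
have cf : csq f r.
  move=> x y hx hy hb; apply/cdiff_cont/df.
  by apply: le_trans (nrm_ReIm _) _; rewrite /= mulr_natl mulr2n; apply: lerD; rewrite ler_norml.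
have h3 : nrm (A - B) <= 128 * M / r * nrm (t - t').
  rewrite /A /B -sumrB; apply: le_trans (nrm_sum _ _ _) _.
  apply: (@le_trans _ _ (\sum_(k < N) 64 * M / r * nrm (t - t') * 2 ^- k)); last first.
    rewrite -mulr_sumr; have E : 0 <= 64 * M / r * nrm (t - t').
      by rewrite !mulr_ge0 ?nrm_ge0 ?invr_ge0 // ltW.
    by have := ler_wpM2l E (sum_half R N); clear - R; lra.
  apply: ler_sum => k _; rewrite -mulrBr nrmM.
  have q0 : 0 <= r / 4 by move: (r0); clear - R; lra.
  have h4 := subX_le k ht ht'.
  have h5 : nrm (tcoef r f k) <= 4 * M * r ^- k by apply: tcoef_le => // z z1 z2; exact: hM.
  have h6 : nrm (t ^+ k - t' ^+ k) <= 4 / r * (nrm (t - t') * k%:R * (r / 4) ^+ k).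
    by rewrite mulrAC ler_pdivlMr //; move: h4; clear - R; lra.
  apply: le_trans (ler_pM (nrm_ge0 _) (nrm_ge0 _) h5 h6) _.
  have -> : 4 * M * r ^- k * (4 / r * (nrm (t - t') * k%:R * (r / 4) ^+ k)) =
     16 * M / r * nrm (t - t') * (k%:R * 4 ^- k).
    by rewrite exprMn exprVn; field; rewrite !expf_neq0 // gt_eqF.
  rewrite -subr_ge0.
  have -> : 64 * M / r * nrm (t - t') * 2 ^- k - 16 * M / r * nrm (t - t') * (k%:R * 4 ^- k) =
    16 * M / r * nrm (t - t') * (4 * 2 ^- k - k%:R * 4 ^- k) by ring.
  apply: mulr_ge0; first by rewrite !mulr_ge0 ?nrm_ge0 ?invr_ge0 // ltW.
  have -> : 4 ^- k = 2 ^- k * 2 ^- k :> R by rewrite -invfM -exprMn; congr (_ ^- k); clear - R; lra.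
  have : k%:R * 2 ^- k <= 1 :> R.
    by rewrite ler_pdivrMr ?exprn_gt0 // mul1r -natrX ler_nat ltnW // ltn_expl.
  have : 0 <= 2 ^- k :> R by rewrite invr_ge0 exprn_ge0.
  move=> a b; have := ler_wpM2l a b; move: a b; clear - R; lra.
have h4 : nrm (f t - f t') <= 16 * M * 2 ^- N + (128 * M / r * nrm (t - t') + 16 * M * 2 ^- N).
  apply: le_trans (nrm_tri _ A _) (lerD h1 _); apply: le_trans (nrm_tri _ B _) (lerD h3 _).
  by rewrite nrmBC.
rewrite lerBlDr; apply: (le_trans h4); rewrite le_eqVlt; apply/orP; left; apply/eqP; ring.
Qed.

(** The coefficients are iterated Cauchy integrals. The iterated Taylor polynomial is within O(2^-N)
    of f on one side and of the power series on the other. *)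
Theorem osgood (f : V -> C) (r M : R) : 0 < r ->
  (forall x i, pdisc (24 * r) x -> cdiff (fun t => f (upd x i t)) (x 0 i)) ->
  (forall x, pdisc (24 * r) x -> nrm (f x) <= M) ->
  exists c, geo c (M * 4 ^+ n) r^-1 /\
    forall x, pdisc (r / 2) x -> f x = FS (enum 'I_n) c x.
Proof.
move=> r0 df hM.
have M0 : 0 <= M by apply: le_trans (hM 0 _); rewrite ?nrm_ge0 // => i; rewrite mxE nrm0; lra.
have hM3 x : pdisc (3 * r) x -> nrm (f x) <= M by move=> px; apply: hM; apply: pdisc_weak px; lra.
have ds x i z : pdisc (24 * r) x -> nrm z <= 24 * r -> cdiff (fun t => f (upd x i t)) z.
  move=> px hz; have := df (upd x i z) i (pdisc_upd i px hz); rewrite upd_same.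
  by under eq_fun do rewrite updK.
(* Radius 12 r is used: the Lipschitz bound then holds on 12 r / 4 = 3 r, the polydisc of [lips],
   and consumes f on 2 (12 r) = 24 r. *)
have lf : lipc r f.
  exists M, (128 * M / (12 * r)); split; first by rewrite divr_ge0 ?mulr_ge0 //; lra.
  split => // x i t t' px ht ht'.
  have px24 : pdisc (24 * r) x by apply: pdisc_weak px; lra.
  apply: (@lipschitz1 (12 * r) M (fun t => f (upd x i t))); try lra.
  - by move=> z hz; apply: ds => //; lra.
  - by move=> z hz; apply: hM; apply: pdisc_upd => //; lra.
exists (fun s => opL r (enum 'I_n) s f 0).
have px0 (d : R) : 0 <= d -> pdisc d (0 : V) by move=> d0 i; rewrite mxE nrm0.
have gc : geo (fun s => opL r (enum 'I_n) s f 0) (M * 4 ^+ n) r^-1.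
  move=> s; have := @opL_le _ _ r r0 (enum 'I_n) s f M 0 lf hM3 (px0 _ _).
  rewrite size_enum_ord big_enum /= => h; apply: le_trans (h _) _; first lra.
  by under eq_bigr do rewrite -exprVn; rewrite prodrXr.
split => // x px; apply/eqP; rewrite -subr_eq0; apply/eqP/nrm_eq0.
apply/eqP; rewrite eq_le nrm_ge0 andbT.
have px3 : pdisc (3 * r) x by apply: pdisc_weak px; lra.
apply: (@le_all_small _ _ (16 * M * 9 ^+ n + 2 * (M * 4 ^+ n) * 4 ^+ n)) => N.
have h1 : nrm (f x - PS r (enum 'I_n) N f x) <= 16 * M * 2 ^- N * 9 ^+ n.
  rewrite -[X in 9 ^+ X](size_enum_ord n); apply: PS_approx => //.
  - by rewrite !mulr_ge0 ?invr_ge0 ?exprn_ge0.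
  - move=> y i py hy; have := @taylor1 _ r (fun t => f (upd y i t)) M r0 _ _ (y 0 i) N hy.
    rewrite upd_id /Pop /Lop; under eq_bigr do rewrite mulrC; apply.
    + by move=> z hz; apply: ds; [apply: pdisc_weak py; lra | lra].
    + by move=> z hz; apply: hM3; apply: pdisc_upd => //; lra.
  - exact: enum_uniq.
rewrite PS_IS ?enum_uniq // in h1.
have h2 : nrm (IS (enum 'I_n) N (fun s => opL r (enum 'I_n) s f 0) x -
    FS (enum 'I_n) (fun s => opL r (enum 'I_n) s f 0) x) <= 2 * (M * 4 ^+ n) * 4 ^+ n * 2 ^- N.
  have := @IS_FS R n (enum 'I_n) N _ x _ (r / 2) r^-1 _ _ gc px; rewrite size_enum_ord.
  by apply; rewrite ?invr_ge0 ?(ltW r0) // mulrAC divff ?gt_eqF // mul1r div1r.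
have E : IS (enum 'I_n) N (fun s => opL r (enum 'I_n) s f x) x =
         IS (enum 'I_n) N (fun s => opL r (enum 'I_n) s f 0) x.
  by apply: IS_ext => s _; apply: opL_indep => // j; rewrite mem_enum.
rewrite E in h1; apply: le_trans (nrm_tri _ (IS (enum 'I_n) N (fun s => opL r (enum 'I_n) s f 0) x) _) _.
by rewrite mulrDl; have := lerD h1 h2; rewrite [16 * M * 2 ^- N * _]mulrAC.
Qed.
End OsgoodTheorem.

(** * Complex differentiable functions as convergent power series *)

Section Differentiability.
Variables (R : realType) (n : nat).
Local Notation C := (CC R).
Local Notation V := 'rV[CC R]_n.
Local Notation mon := {ffun 'I_n -> nat}.
Implicit Types (x y u p : V) (i j : 'I_n) (f : V -> C) (G : 'I_n -> C).

Lemma rc_le (a b : R) : (rc a <= rc b) = (a <= b). Proof. exact: lecR. Qed.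
Lemma rc_lt (a b : R) : (rc a < rc b) = (a < b). Proof. exact: ltcR. Qed.
Lemma gt0_rc (e : C) : 0 < e -> exists2 d : R, 0 < d & e = rc d.
Proof.
move=> e0; have er : e \is Num.real by rewrite gtr0_real.
have [d E] := complex_realP _ er; exists d => //.
by rewrite -rc_lt -[rc d]/(d%:C)%C -E.
Qed.

Lemma mxnorm_le x (d : R) : 0 <= d -> `|x| <= rc d <-> pdisc d x.
Proof.
move=> d0; split=> [h i|h].
  rewrite -rc_le -normC_nrm; apply: le_trans h.
  rewrite [X in _ <= X]mx_normE.
  have := @le_bigmax _ {nonneg C} _ 0%:nng (fun ij : 'I_1 * 'I_n => `|x ij.1 ij.2|%:nng) (0, i).
  by move=> h; exact: h.
have [->|x0] := eqVneq `|x| 0; first by rewrite (_ : 0 = rc 0) // rc_le.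
have [[a i]] := @mx_norm_neq0 _ _ _ x x0; rewrite /= ord1 -[mx_norm x]/(`|x|) => ->.
by rewrite normC_nrm rc_le; exact: h.
Qed.

Lemma nearV p (P : set V) :
  (\forall y \near p, P y) <-> exists2 e : R, 0 < e & forall y, pdisc e (y - p) -> P y.
Proof.
split.
  move=> /nbhs_ballP[e' /= e'0 he]; have [e e0 E] := gt0_rc e'0; subst e'.
  exists (e / 2); first by rewrite divr_gt0.
  move=> y hy; apply: he; rewrite -ball_normE /ball_ /= distrC.
  by apply: (@le_lt_trans _ _ (rc (e / 2))); [apply/mxnorm_le => //; lra | rewrite rc_lt; lra].
move=> [e e0 he]; apply/nbhs_ballP; exists (rc e) => /=; first by rewrite -[0]/(rc 0) rc_lt.
move=> y; rewrite -ball_normE /ball_ /= distrC => h; apply: he.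
by apply/mxnorm_le; exact: ltW.
Qed.

Lemma near0 (P : set V) :
  (\forall y \near (0 : V), P y) <-> exists2 e : R, 0 < e & forall y, pdisc e y -> P y.
Proof.
split=> [/nearV [e e0 h]|[e e0 h]].
  by exists e => // y hy; apply: h; rewrite subr0.
by apply/nearV; exists e => // y hy; apply: h; move: hy; rewrite subr0.
Qed.

Definition lincomb G (u : V) : C := \sum_i u 0 i * G i.
Lemma lincomb_linear G : linear (lincomb G).
Proof.
move=> a u v; rewrite /lincomb scaler_sumr -big_split; apply: eq_bigr => i _.
by rewrite !mxE mulrDl -mulrA.
Qed.
HB.instance Definition _ G := GRing.isLinear.Build C V C _ (lincomb G) (lincomb_linear G).

Lemma lincomb_le G (d : R) u : pdisc d u -> nrm (lincomb G u) <= d * \sum_i nrm (G i).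
Proof.
move=> pu; apply: le_trans (nrm_sum _ _ _) _; rewrite mulr_sumr; apply: ler_sum => i _.
by rewrite nrmM; apply: ler_wpM2r; rewrite ?nrm_ge0.
Qed.
Lemma lincomb_continuous G : continuous (lincomb G).
Proof.
move=> p A /nearC [e e0 he]; pose S := \sum_i nrm (G i).
have S0 : 0 <= S by apply: sumr_ge0 => i _; rewrite nrm_ge0.
apply/nearV; exists (e / (1 + S)); first by rewrite divr_gt0 //; lra.
move=> y hy; apply: he; rewrite -raddfB; apply: le_lt_trans (lincomb_le G hy) _.
by rewrite -/S -mulrA gtr_pMr // mulrC ltr_pdivrMr; lra.
Qed.

(** Frechet differentiability with real constants; t is any bound of the coordinates of u and stands
    for its norm. *)
Definition has_diff f p G := forall e : R, 0 < e -> exists2 d : R, 0 < d &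
  forall u (t : R), pdisc d u -> 0 <= t -> pdisc t u ->
    nrm (f (p + u) - f p - lincomb G u) <= e * t.

Lemma has_diffP f p G : has_diff f p G -> differentiable f p /\ forall u, 'D_u f p = lincomb G u.
Proof.
move=> h.
have ho : f \o shift p = cst (f p) + lincomb G +o_ (0 : V) id.
  apply/eqaddoP => e' e'0; have [e e0 E] := gt0_rc e'0; subst e'.
  have [d d0 hd] := h e e0; apply/near0; exists d => // u hu.
  have [t t0 Et] : exists2 t : R, 0 <= t & `|u| = rc t.
    have ur : `|u| \is Num.real by rewrite ger0_real.
    have [t Et] := complex_realP _ ur; exists t => //.
    have : rc 0 <= `|u| by exact: normr_ge0.
    by rewrite Et -[(t%:C)%C]/(rc t) rc_le.
  rewrite Et /= normC_nrm -rcM rc_le.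
  have -> : (f \o shift p - (cst (f p) + lincomb G)) u = f (p + u) - f p - lincomb G u.
    by rewrite /= !fctE /= /shift [u + p]addrC opprD addrA.
  by apply: hd => //; apply/mxnorm_le; rewrite ?Et.
have dE : 'd f p = lincomb G :> (V -> C) by apply: diff_unique => //; exact: lincomb_continuous.
have df : differentiable f p.
  by apply/diff_locallyP; rewrite dE; split => //; exact: lincomb_continuous.
by split => // u; rewrite deriveE // dE.
Qed.

Lemma differentiable_has_diff f p : differentiable f p ->
  has_diff f p (fun i => 'D_('e_i) f p) /\ forall u, 'D_u f p = lincomb (fun i => 'D_('e_i) f p) u.
Proof.
move=> df; have dE u : 'D_u f p = lincomb (fun i => 'D_('e_i) f p) u.
  rewrite deriveE // {1}[u]row_sum_delta linear_sum /lincomb; apply: eq_bigr => i _.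
  by rewrite linearZ /= deriveE.
split => // e e0.
have /eqaddoP ho := diff_locally df.
have e00 : 0 < rc e by rewrite -[0]/(rc 0) rc_lt.
have /near0 [d d0 hd] := ho _ e00.
exists d => // u t hu t0 ht; move: (dE u); rewrite deriveE // => <-.
have := hd u hu.
have -> : (f \o shift p - (cst (f p) + 'd f p)) u = f (p + u) - f p - 'd f p u.
  by rewrite /= !fctE /= /shift [u + p]addrC opprD addrA.
rewrite normC_nrm => h; rewrite -rc_le; apply: le_trans h _.
by rewrite rcM; apply: ler_wpM2l; [exact: ltW | apply/mxnorm_le].
Qed.

Lemma differentiable_cdiff f p i : differentiable f p ->
  cdiff (fun t => f (upd p i t)) (p 0 i).
Proof.
move=> /differentiable_has_diff [h _]; set G := fun i => 'D_('e_i) f p in h.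
pose z := p 0 i.
exists (fun w => if w == z then G i else (f (upd p i w) - f (upd p i z)) / (w - z)).
  move=> e e0; have e2 : 0 < e / 2 by lra.
  have [d d0 hd] := h _ e2; exists d => // w hw.
  rewrite /= -/z eqxx; case: eqP => [_|/eqP wz]; first by rewrite subrr nrm0.
  have wz0 : w - z != 0 by rewrite subr_eq0.
  pose u : V := \row_j (if j == i then w - z else 0).
  have pu (t : R) : nrm (w - z) <= t -> pdisc t u.
    move=> ht j; rewrite mxE; case: ifP => // _; rewrite nrm0.
    by apply: le_trans ht; rewrite nrm_ge0.
  have -> : upd p i w = p + u.
    apply/rowP => j; rewrite !mxE; case: eqP => [->|_]; last by rewrite addr0.
    by rewrite addrC subrK.
  have -> : upd p i z = p by rewrite upd_id.
  have := hd u _ (pu _ (ltW hw)) (nrm_ge0 _) (pu _ (lexx _)).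
  have -> : lincomb G u = (w - z) * G i.
    rewrite /lincomb (bigD1 i) //= mxE eqxx big1 ?addr0 // => j ji.
    by rewrite mxE (negPf ji) mul0r.
  have -> : f (p + u) - f p - (w - z) * G i = ((f (p + u) - f p) / (w - z) - G i) * (w - z).
    by rewrite [RHS]mulrBl divfK // [G i * _]mulrC.
  rewrite nrmM ler_pM2r ?nrm_gt0 // => h'; apply: le_lt_trans h' _; lra.
move=> w; case: eqP => [->|/eqP wz]; first by rewrite subrr mulr0 addr0.
by rewrite divfK ?subr_eq0 // addrC subrK.
Qed.

Lemma pdisc0 (d : R) : 0 <= d -> pdisc d (0 : V).
Proof. by move=> d0 i; rewrite mxE nrm0. Qed.
Lemma pdiscD (d e : R) x y : pdisc d x -> pdisc e y -> pdisc (d + e) (x + y).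
Proof. by move=> hx hy i; rewrite mxE; apply: le_trans (nrmD _ _) (lerD (hx i) (hy i)). Qed.
Lemma pdiscN (d : R) x : pdisc d x -> pdisc d (- x).
Proof. by move=> hx i; rewrite mxE nrmN. Qed.

(** Sealed by [Qed], so that conversion does not unfold the iterated series. *)
Lemma fsum_def : {F : (mon -> C) -> V -> C | F = FS (enum 'I_n)}. Proof. by exists (FS (enum 'I_n)). Qed.
Definition fsum : (mon -> C) -> V -> C := sval fsum_def.
Lemma fsumE c x : fsum c x = FS (enum 'I_n) c x. Proof. by rewrite /fsum (proj2_sig fsum_def). Qed.

Definition convergent (c : mon -> C) := exists K r : R, 0 < r /\ geo c K r.

(** Differentiability near 0 makes the slices holomorphic; the boundedness that [osgood] also asks
    for comes from differentiability at 0 alone. *)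
Lemma On_taylor f : On f -> exists2 c, convergent c & germ_eq f (fsum c).
Proof.
move=> /near0 [e e0 df].
have [hd _] := differentiable_has_diff (df 0 (pdisc0 (ltW e0))).
have [d d0 hb] := hd 1 ltr01.
pose r := Num.min d e / 24; have r0 : 0 < r by rewrite divr_gt0 // lt_min d0.
have [rd re] : 24 * r <= d /\ 24 * r <= e.
  have : Num.min d e <= d /\ Num.min d e <= e by rewrite !ge_min !lexx orbT.
  by rewrite /r; lra.
pose M := nrm (f 0) + d * \sum_i nrm ('D_('e_i) f 0) + d.
have [||c [gc hc]] := @osgood R n f r M r0; last first.
- exists c; first by exists (M * 4 ^+ n), r^-1; rewrite invr_gt0.
  by apply/near0; exists (r / 2); [rewrite divr_gt0 | move=> x px; rewrite fsumE; exact: hc].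
- move=> x px; have px' := pdisc_weak rd px.
  have := hb x d px' (ltW d0) px'; rewrite add0r => h1.
  have h2 := lincomb_le (fun i => 'D_('e_i) f 0) px'.
  have -> : f x = f 0 + lincomb (fun i => 'D_('e_i) f 0) x + (f x - f 0 - lincomb (fun i => 'D_('e_i) f 0) x) by ring.
  apply: le_trans (nrmD _ _) _; rewrite mul1r in h1; apply: lerD h1.
  by apply: le_trans (nrmD _ _) _; rewrite lerD2l.
- by move=> x i px; apply: differentiable_cdiff; apply: df; exact: pdisc_weak px.
Qed.

Lemma fsum_has_diff (c : mon -> C) (K r d : R) x : 0 <= r -> 0 < d -> d * r <= 1 / 16 -> geo c K r ->
  pdisc d x -> has_diff (fsum c) x (fun i => fsum (dcoef i c) x).
Proof.
move=> r0 d0 dr gc px e e0; have K0 := geo_ge0 gc.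
pose B := K * 16 ^+ n / d ^+ 2.
have B0 : 0 <= B by rewrite divr_ge0 ?mulr_ge0 ?exprn_ge0 // ltW.
exists (Num.min d (e / (1 + B))); first by rewrite lt_min d0 divr_gt0 //; lra.
move=> u t pu t0 pt.
(* The bound t may be far larger than u. The quadratic estimate is applied with s, which still
   bounds u but stays below e / (1 + B). *)
pose s := Num.min t (Num.min d (e / (1 + B))).
have ps : pdisc s u by move=> i; rewrite le_min pt pu.
have [st sd se] : [/\ s <= t, s <= d & s <= e / (1 + B)] by rewrite /s !ge_min !lexx !orbT.
have s0 : 0 <= s by rewrite /s !le_min t0 (ltW d0) divr_ge0 // ?ltW //; lra.
have := @FS_rem R n (enum 'I_n) c x u K d r (s / d) (enum_uniq _) r0 dr gc px.
rewrite divfK ?gt_eqF // ler_pdivrMr // mul1r size_enum_ord => /(_ _ sd ps) h.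
have -> : lincomb (fun i => fsum (dcoef i c) x) u = FD (enum 'I_n) c x u.
  by rewrite /lincomb /FD big_enum; apply: eq_bigr => i _; rewrite fsumE.
rewrite !fsumE.
apply: le_trans (h _) _; first by rewrite divr_ge0 // ltW.
rewrite [X in X <= _](_ : _ = B * s * s); last by rewrite /B; field; rewrite gt_eqF.
apply: ler_pM => //; first exact: mulr_ge0.
apply: (@le_trans _ _ (B * (e / (1 + B)))); first exact: ler_wpM2l.
by rewrite mulrA ler_pdivrMr; [rewrite mulrC; apply: ler_wpM2l; lra | lra].
Qed.

Lemma fsum_diff (c : mon -> C) : convergent c ->
  \forall x \near (0 : V), differentiable (fsum c) x /\
    forall u, 'D_u (fsum c) x = \sum_i u 0 i * fsum (dcoef i c) x.
Proof.
move=> [K [r [r0 gc]]]; apply/near0; exists ((16 * r)^-1); first by rewrite invr_gt0; lra.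
move=> x px; apply/has_diffP; apply: (@fsum_has_diff c K r (16 * r)^-1) => //.
- exact: ltW.
- by rewrite invr_gt0; lra.
- by rewrite (_ : _ * r = 1 / 16) //; field; rewrite gt_eqF.
Qed.

Lemma fsum_On c : convergent c -> On (fsum c).
Proof. by move=> /fsum_diff; apply: filterS => x []. Qed.

Lemma convergent_dcoef i c : convergent c -> convergent (dcoef i c).
Proof.
move=> [K [r [r0 gc]]]; exists (K * r), (2 * r); split; first by lra.
by apply: geo_dcoef => //; exact: ltW.
Qed.
End Differentiability.

(** * The ring of germs *)

Section GermDef.
Variables (R : realType) (n : nat).
Local Notation C := (CC R).
Local Notation V := 'rV[CC R]_n.
Local Notation mon := {ffun 'I_n -> nat}.

(* A germ is represented by its Taylor coefficients. *)
Definition germ := {c : mon -> C | convergent c}.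
Definition cf (a : germ) : mon -> C := sval a.
Definition fn (a : germ) : V -> C := fsum (cf a).
HB.instance Definition _ := gen_eqMixin germ.
HB.instance Definition _ := gen_choiceMixin germ.

Lemma convergent0 : convergent (fun _ : mon => 0 : C).
Proof. by exists 0, 1; split => // s; rewrite nrm0 mul0r. Qed.
(* Opaque on purpose: conversion must never unfold germs down to power series. *)
Lemma taylor_germ : {mk : (V -> C) -> germ | forall f, On f -> germ_eq f (fn (mk f))}.
Proof.
exists (fun f => xget (exist _ _ convergent0 : germ) [set a | germ_eq f (fn a)]).
move=> f /On_taylor [c cc hc].
have h : [set a | germ_eq f (fn a)] (exist _ c cc : germ) by [].
by have := xgetI (exist _ _ convergent0 : germ) h.
Qed.
Definition mk : (V -> C) -> germ := sval taylor_germ.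

Lemma germ_eq_refl (f : V -> C) : germ_eq f f.
Proof. by apply/near0; exists 1. Qed.
Lemma germ_eq_sym (f g : V -> C) : germ_eq f g -> germ_eq g f.
Proof. by apply: filterS => x ->. Qed.
Lemma germ_eq_trans (f g h : V -> C) : germ_eq f g -> germ_eq g h -> germ_eq f h.
Proof. by apply: filterS2 => x -> ->. Qed.
Lemma germ_eq0 (f g : V -> C) : germ_eq f g -> f 0 = g 0.
Proof. exact: nbhs_singleton. Qed.
(** Differentiability at x depends on the values around x, so the radius is halved to keep a ball
    around x inside the region where f = g. *)
Lemma germ_eq_On (f g : V -> C) : germ_eq f g -> On f -> On g.
Proof.
move=> /near0 [e e0 he] /near0 [d d0 hd]; apply/near0.
exists (Num.min e d / 2); first by rewrite divr_gt0 // lt_min e0.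
move=> x px; have [h1 h2] : Num.min e d <= e /\ Num.min e d <= d by rewrite !ge_min !lexx orbT.
have m0 : 0 < Num.min e d by rewrite lt_min e0.
have fg : \near x, f x = g x.
  apply/nearV; exists (Num.min e d / 2); first by rewrite divr_gt0.
  move=> y hy; apply: he; rewrite -[y](subrK x); apply: (pdisc_weak _ (pdiscD hy px)); lra.
have [hd1 hd2] : has_diff f x (fun i => 'D_('e_i) f x) /\ True.
  split => //; have [] // := @differentiable_has_diff _ _ f x _.
  by apply: hd; apply: pdisc_weak px; lra.
have [] // := @has_diffP _ _ g x (fun i => 'D_('e_i) f x) _.
move=> t t0; have [r r0 hr] := hd1 t t0; move/nearV: fg => [q q0 hq].
exists (Num.min q r); first by rewrite lt_min q0.
move=> u s pu s0 ps; have [k1 k2] : Num.min q r <= q /\ Num.min q r <= r by rewrite !ge_min !lexx orbT.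
rewrite -hq; last by rewrite addrC addKr; exact: pdisc_weak pu.
rewrite -[g x]hq; last by rewrite subrr; apply: pdisc0; exact: ltW.
by apply: hr => //; exact: pdisc_weak pu.
Qed.

Lemma fn_On a : On (fn a). Proof. exact: fsum_On (proj2_sig a). Qed.
Lemma fn_mk (f : V -> C) : On f -> germ_eq f (fn (mk f)).
Proof. exact: (proj2_sig taylor_germ f). Qed.

Lemma germ_eq_derive (f g : V -> C) : germ_eq f g -> forall v : V -> V,
  germ_eq (fun x => 'D_(v x) f x) (fun x => 'D_(v x) g x).
Proof.
move=> /near0 [e e0 he] v; apply/near0; exists (e / 2); first by rewrite divr_gt0.
move=> x px; apply: near_eq_derive; apply/nearV; exists (e / 2); first by rewrite divr_gt0.
by move=> y hy; apply: he; rewrite -[y](subrK x); apply: (pdisc_weak _ (pdiscD hy px)); lra.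
Qed.

(** Identity principle, by induction on the degree: the value at 0 gives the constant coefficient,
    and differentiation lowers the degree of any other. *)
Lemma convergent_inj (c c' : mon -> C) : convergent c -> convergent c' ->
  germ_eq (fsum c) (fsum c') -> c = c'.
Proof.
move=> cc cc' E; apply/funext => s.
have [k] := ubnP (mdeg s); elim: k => // k IH in s c c' cc cc' E *.
rewrite ltnS => hs; have [s0|] := boolP [forall i, s i == 0%N].
  have -> : s = mon0 n by apply/ffunP => i; rewrite ffunE; apply/eqP/(forallP s0).
  by have := germ_eq0 E; rewrite !fsumE !FS_at0.
rewrite negb_forall => /existsP [i si].
pose t : mon := [ffun j => if j == i then (s j).-1 else s j].
have st : s = madd t (munit i 1).
  apply/ffunP => j; rewrite !ffunE; case: eqP => [->|]; last by rewrite addn0.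
  by rewrite addn1 prednK // lt0n.
have : dcoef i c t = dcoef i c' t.
  apply: IH; try exact: convergent_dcoef; last by move: hs; rewrite {1}st mdegD mdeg_unit addn1.
  have h1 := fsum_diff cc; have h2 := fsum_diff cc'; have h3 := germ_eq_derive E (fun=> 'e_i).
  move: h1 h2 h3; apply: filterS3 => x [_ h1] [_ h2]; rewrite h1 h2.
  have key (F : 'I_n -> C) : \sum_j ('e_i : V) 0 j * F j = F i.
    rewrite (bigD1 i) //= mxE !eqxx mul1r big1 ?addr0 // => j ji.
    by rewrite mxE (negPf ji) andbF mul0r.
  by rewrite !key.
rewrite /dcoef -st => /mulfI; apply; by rewrite pnatr_eq0.
Qed.

Lemma cf_inj (a b : germ) : cf a = cf b -> a = b.
Proof.
case: a b => [c hc] [d hd] /= E; subst d; congr (exist _ c _); exact: Prop_irrelevance.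
Qed.
Lemma germ_inj (a b : germ) : germ_eq (fn a) (fn b) -> a = b.
Proof. by move=> h; apply/cf_inj/convergent_inj => //; [exact: (proj2_sig a)|exact: (proj2_sig b)]. Qed.
Lemma mkE (f : V -> C) a : germ_eq f (fn a) -> mk f = a.
Proof.
move=> h; apply: germ_inj; apply: (germ_eq_trans _ h); apply: germ_eq_sym; apply: fn_mk.
by apply: (germ_eq_On (germ_eq_sym h)); exact: fn_On.
Qed.
Lemma mkK a : mk (fn a) = a. Proof. by apply: mkE; exact: germ_eq_refl. Qed.
Lemma mk_eq (f g : V -> C) : On f -> germ_eq f g -> mk f = mk g.
Proof.
move=> hf h; apply: mkE; apply: (germ_eq_trans h); apply: fn_mk; exact: germ_eq_On h hf.
Qed.

Lemma On_cst (k : C) : On (fun _ : V => k).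
Proof. by apply/near0; exists 1 => // x _; exact: differentiable_cst. Qed.
Lemma On_coord i : On (fun x : V => x 0 i).
Proof. by apply/near0; exists 1 => // x _; exact: differentiable_coord. Qed.
Lemma On_add (f g : V -> C) : On f -> On g -> On (fun x => f x + g x).
Proof. by apply: filterS2 => x hf hg; exact: differentiableD. Qed.
Lemma On_mul (f g : V -> C) : On f -> On g -> On (fun x => f x * g x).
Proof. by apply: filterS2 => x hf hg; exact: differentiableM. Qed.
Lemma On_opp (f : V -> C) : On f -> On (fun x => - f x).
Proof. by apply: filterS => x hf; exact: differentiableN. Qed.

(** The operations are those of functions, carried over by [mk]; the ring axioms reduce to pointwise
    identities and no product of power series is written. *)
Definition gadd a b := mk (fun x => fn a x + fn b x).
Definition gmul a b := mk (fun x => fn a x * fn b x).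
Definition gopp a := mk (fun x => - fn a x).
Definition gC (k : C) := mk (fun=> k).
Definition gX i := mk (fun x => x 0 i).

Lemma fn_gadd a b : germ_eq (fn (gadd a b)) (fun x => fn a x + fn b x).
Proof. by apply/germ_eq_sym/fn_mk/On_add; exact: fn_On. Qed.
Lemma fn_gmul a b : germ_eq (fn (gmul a b)) (fun x => fn a x * fn b x).
Proof. by apply/germ_eq_sym/fn_mk/On_mul; exact: fn_On. Qed.
Lemma fn_gopp a : germ_eq (fn (gopp a)) (fun x => - fn a x).
Proof. by apply/germ_eq_sym/fn_mk/On_opp; exact: fn_On. Qed.
Lemma fn_gC k : germ_eq (fn (gC k)) (fun=> k).
Proof. by apply/germ_eq_sym/fn_mk/On_cst. Qed.
Lemma fn_gX i : germ_eq (fn (gX i)) (fun x => x 0 i).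
Proof. by apply/germ_eq_sym/fn_mk/On_coord. Qed.

Lemma mk_gadd f g : On f -> On g -> gadd (mk f) (mk g) = mk (fun x => f x + g x).
Proof.
move=> hf hg; symmetry; apply: mk_eq; first exact: On_add.
by move: (fn_mk hf) (fn_mk hg); apply: filterS2 => x -> ->.
Qed.
Lemma mk_gmul f g : On f -> On g -> gmul (mk f) (mk g) = mk (fun x => f x * g x).
Proof.
move=> hf hg; symmetry; apply: mk_eq; first exact: On_mul.
by move: (fn_mk hf) (fn_mk hg); apply: filterS2 => x -> ->.
Qed.
Lemma mk_gopp f : On f -> gopp (mk f) = mk (fun x => - f x).
Proof.
move=> hf; symmetry; apply: mk_eq; first exact: On_opp.
by move: (fn_mk hf); apply: filterS => x ->.
Qed.

Local Ltac On_tac := repeat first [exact: fn_On | exact: On_cst | apply: On_add | apply: On_mul | apply: On_opp].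
Local Ltac ring_ax := rewrite ?(mk_gadd, mk_gmul, mk_gopp); try On_tac;
  congr mk; apply/funext => x; ring.

Lemma gaddA : associative gadd.
Proof. by move=> a b c; rewrite -[a]mkK -[b]mkK -[c]mkK; ring_ax. Qed.
Lemma gaddC : commutative gadd.
Proof. by move=> a b; rewrite -[a]mkK -[b]mkK; ring_ax. Qed.
Lemma gadd0 : left_id (gC 0) gadd.
Proof. by move=> a; rewrite -[a]mkK /gC; ring_ax. Qed.
Lemma gaddN : left_inverse (gC 0) gopp gadd.
Proof. by move=> a; rewrite -[a]mkK /gC; ring_ax. Qed.
Lemma gmulA : associative gmul.
Proof. by move=> a b c; rewrite -[a]mkK -[b]mkK -[c]mkK; ring_ax. Qed.
Lemma gmulC : commutative gmul.
Proof. by move=> a b; rewrite -[a]mkK -[b]mkK; ring_ax. Qed.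
Lemma gmul1 : left_id (gC 1) gmul.
Proof. by move=> a; rewrite -[a]mkK /gC; ring_ax. Qed.
Lemma gmulDl : left_distributive gmul gadd.
Proof. by move=> a b c; rewrite -[a]mkK -[b]mkK -[c]mkK; ring_ax. Qed.
Lemma gC_neq : gC 1 != gC 0.
Proof.
apply/eqP => E; have := germ_eq0 (fn_gC 1); rewrite E (germ_eq0 (fn_gC 0)).
by move/eqP; rewrite eq_sym oner_eq0.
Qed.
HB.instance Definition _ := GRing.isZmodule.Build germ gaddA gaddC gadd0 gaddN.
HB.instance Definition _ := GRing.Zmodule_isComNzRing.Build germ gmulA gmulC gmul1 gmulDl gC_neq.
End GermDef.

Section FilterExtra.
Context {T : Type} {F : set_system T} {FF : Filter F}.
Lemma filterS4 (P1 P2 P3 P4 Q : set T) :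
  (forall x, P1 x -> P2 x -> P3 x -> P4 x -> Q x) ->
  F P1 -> F P2 -> F P3 -> F P4 -> F Q.
Proof.
move=> h h1 h2 h3 h4; apply: filterS (filterI (filterI h1 h2) (filterI h3 h4)).
by move=> x [[? ?] [? ?]]; exact: h.
Qed.
End FilterExtra.

(** * Evaluation, partial derivatives and Taylor coefficients of germs *)

Section GermTheory.
Variables (R : realType) (n : nat).
Local Notation C := (CC R).
Local Notation V := 'rV[CC R]_n.
Local Notation mon := {ffun 'I_n -> nat}.
Local Notation germ := (germ R n).
Implicit Types (a b : germ) (i j : 'I_n) (s t : mon).

Lemma mkD (f g : V -> C) : On f -> On g -> mk (fun x => f x + g x) = mk f + mk g.
Proof. by move=> hf hg; rewrite -mk_gadd. Qed.
Lemma mkM (f g : V -> C) : On f -> On g -> mk (fun x => f x * g x) = mk f * mk g.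
Proof. by move=> hf hg; rewrite -mk_gmul. Qed.
Lemma fnD a b : germ_eq (fn (a + b)) (fun x => fn a x + fn b x).
Proof. exact: fn_gadd. Qed.
Lemma fnM a b : germ_eq (fn (a * b)) (fun x => fn a x * fn b x).
Proof. exact: fn_gmul. Qed.
Lemma fnN a : germ_eq (fn (- a)) (fun x => - fn a x).
Proof. exact: fn_gopp. Qed.

Lemma gC_additive : additive (@gC R n).
Proof.
move=> k l; rewrite /gC.
have -> : mk (fun _ : V => k - l) = mk (fun _ : V => k) + mk (fun _ : V => - l).
  by rewrite -mkD //; exact: On_cst.
congr (_ + _).
by symmetry; apply: mk_gopp; exact: On_cst.
Qed.
Lemma gC_multiplicative : multiplicative (@gC R n).
Proof. by split => // k l; rewrite -mkM //; exact: On_cst. Qed.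
HB.instance Definition _ := GRing.isAdditive.Build C germ (@gC R n) gC_additive.
HB.instance Definition _ := GRing.isMultiplicative.Build C germ (@gC R n) gC_multiplicative.

Definition ev a : C := fn a 0.
Lemma ev_additive : additive ev.
Proof. by move=> a b; rewrite /ev (germ_eq0 (fnD _ _)) (germ_eq0 (fnN _)). Qed.
Lemma ev_multiplicative : multiplicative ev.
Proof. by split => [a b|]; rewrite /ev ?(germ_eq0 (fnM _ _)) ?(germ_eq0 (fn_gC _ 1)). Qed.
HB.instance Definition _ := GRing.isAdditive.Build germ C ev ev_additive.
HB.instance Definition _ := GRing.isMultiplicative.Build germ C ev ev_multiplicative.
Lemma ev_gC k : ev (gC n k) = k. Proof. exact: (germ_eq0 (fn_gC _ k)). Qed.
Lemma ev_gX i : ev (gX R i) = 0. Proof. by rewrite /ev (germ_eq0 (fn_gX R i)) mxE. Qed.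
Lemma ev_cf a : ev a = cf a (mon0 n). Proof. by rewrite /ev /fn fsumE FS_at0. Qed.

(** Defined on coefficients, so that [cf_gd] holds by computation; [fn_gd] identifies it with the
    analytic derivative. *)
Definition gd i a : germ := exist _ _ (convergent_dcoef i (proj2_sig a)).
Lemma cf_gd i a s : cf (gd i a) s = (s i).+1%:R * cf a (madd s (munit i 1)).
Proof. by []. Qed.

Lemma fn_derive a : \forall x \near (0 : V), differentiable (fn a) x /\
  forall u, 'D_u (fn a) x = \sum_i u 0 i * fn (gd i a) x.
Proof. exact: (fsum_diff (proj2_sig a)). Qed.

Lemma sum_delta i (F : 'I_n -> C) : \sum_j ('e_i : V) 0 j * F j = F i.
Proof.
rewrite (bigD1 i) //= mxE !eqxx mul1r big1 ?addr0 // => j ji.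
by rewrite mxE (negPf ji) andbF mul0r.
Qed.

Lemma fn_gd i a : germ_eq (fn (gd i a)) (fun x => 'D_('e_i) (fn a) x).
Proof. by move: (fn_derive a); apply: filterS => x [_ ->]; rewrite sum_delta. Qed.

Lemma gd_mk i (f : V -> C) : On f -> gd i (mk f) = mk (fun x => 'D_('e_i) f x).
Proof.
move=> hf; symmetry; apply: mkE; apply: germ_eq_sym; apply: germ_eq_trans (fn_gd _ _) _.
by apply: (germ_eq_derive _ (fun=> 'e_i)); apply/germ_eq_sym/fn_mk.
Qed.

Lemma gd_additive i : additive (gd i).
Proof.
move=> a b; suff h c d : gd i (c + d) = gd i c + gd i d.
  by apply/eqP; rewrite eq_sym subr_eq -h subrK.
rewrite -[c in LHS]mkK -[d in LHS]mkK -mkD; try exact: fn_On.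
rewrite gd_mk; last by apply: On_add; exact: fn_On.
apply: mkE; apply: germ_eq_sym; apply: germ_eq_trans (fnD _ _) _.
move: (fn_gd i c) (fn_gd i d) (fn_On c) (fn_On d).
by apply: filterS4 => x -> -> dc dd; rewrite deriveD //; exact: diff_derivable.
Qed.
HB.instance Definition _ i := GRing.isAdditive.Build germ germ (gd i) (gd_additive i).

Lemma gdM i a b : gd i (a * b) = gd i a * b + a * gd i b.
Proof.
rewrite -[a in LHS]mkK -[b in LHS]mkK -mkM; try exact: fn_On.
rewrite gd_mk; last by apply: On_mul; exact: fn_On.
apply: mkE; apply: germ_eq_sym.
have h1 : germ_eq (fn (gd i a * b + a * gd i b))
    (fun x => fn (gd i a) x * fn b x + fn a x * fn (gd i b) x).
  move: (fnD (gd i a * b) (a * gd i b)) (fnM (gd i a) b) (fnM a (gd i b)).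
  by apply: filterS3 => x -> -> ->.
apply: (germ_eq_trans h1); move: (fn_gd i a) (fn_gd i b) (fn_On a) (fn_On b).
apply: filterS4 => x -> -> da db; rewrite deriveM; try exact: diff_derivable.
by rewrite addrC; congr (_ + _); exact: mulrC.
Qed.
Lemma gd_gC i k : gd i (gC n k) = 0.
Proof.
rewrite /gC gd_mk; last exact: On_cst.
by apply: mkE; rewrite [X in germ_eq _ (fn X)]/(gC n 0); apply: germ_eq_sym; apply: filterS (fn_gC n 0) => x ->; rewrite derive_cst.
Qed.
Lemma gd_gX i j : gd i (gX R j) = (i == j)%:R.
Proof.
rewrite /gX gd_mk; last exact: On_coord.
rewrite (_ : (i == j)%:R = gC n (i == j)%:R); last by rewrite rmorph_nat.
apply: mkE; apply: germ_eq_sym; apply: filterS (fn_gC n (i == j)%:R) => x ->.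
have [|_ ->] := @has_diffP R n (fun x => x 0 j) x (fun i => (i == j)%:R).
  move=> e e0; exists 1 => // u t _ t0 _.
  have -> : (x + u) 0 j - x 0 j = u 0 j by rewrite mxE [x 0 j + _]addrC addrK.
  rewrite /lincomb (bigD1 j) //= eqxx mulr1 big1 ?addr0.
    by rewrite subrr nrm0 mulr_ge0 // ltW.
  by move=> l lj; rewrite (negPf lj) mulr0.
rewrite /lincomb (bigD1 j) //= eqxx mulr1 big1 ?addr0 ?mxE //.
  by rewrite eq_sym.
by move=> l lj; rewrite (negPf lj) mulr0.
Qed.

Lemma mon_split s : s = mon0 n \/ exists i t, s = madd t (munit i 1).
Proof.
have [s0|] := boolP [forall i, s i == 0%N].
  by left; apply/ffunP => i; rewrite ffunE; apply/eqP/(forallP s0).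
rewrite negb_forall => /existsP [i si]; right; exists i, [ffun j => if j == i then (s j).-1 else s j].
apply/ffunP => j; rewrite !ffunE; case: eqP => [->|]; last by rewrite addn0.
by rewrite addn1 prednK // lt0n.
Qed.

Lemma mon_ind (P : mon -> Prop) : P (mon0 n) -> (forall i s, P s -> P (madd s (munit i 1))) -> forall s, P s.
Proof.
move=> h0 h s; have [k] := ubnP (mdeg s); elim: k s => // k IH s.
have [->//|[i [t ->]]] := mon_split s.
by rewrite mdegD mdeg_unit addn1 ltnS => /IH; exact: h.
Qed.

(** Coefficients as normalised derivatives at 0: together with [mon_ind], formulas for them follow
    from the rules for [gd], without a Cauchy product. *)
Lemma cf_shift i a s : cf a (madd s (munit i 1)) = (s i).+1%:R^-1 * cf (gd i a) s.
Proof. by rewrite cf_gd mulKf // pnatr_eq0. Qed.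

Lemma cf_add a b s : cf (a + b) s = cf a s + cf b s.
Proof.
elim/mon_ind: s a b => [|i s IH] a b; first by rewrite -!ev_cf raddfD.
by rewrite !cf_shift raddfD IH mulrDr.
Qed.
Lemma cf_gCM k a s : cf (gC n k * a) s = k * cf a s.
Proof.
elim/mon_ind: s a => [|i s IH] a; first by rewrite -!ev_cf rmorphM /= ev_gC.
by rewrite !cf_shift gdM gd_gC mul0r add0r IH mulrCA.
Qed.
Lemma cf_additive s : additive (fun a => cf a s).
Proof.
move=> a b; rewrite cf_add; congr (_ + _).
by rewrite -mulN1r -[X in X * b](_ : gC n (-1) = _) ?cf_gCM ?mulN1r // rmorphN rmorph1.
Qed.
Lemma cf0 s : cf 0 s = 0 :> C.
Proof. by have := cf_additive s 0 0; rewrite subrr => ->; rewrite subrr. Qed.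
Lemma cf_opp a s : cf (- a) s = - cf a s.
Proof. by have := cf_additive s 0 a; rewrite sub0r cf0 sub0r. Qed.
Lemma cf_sub a b s : cf (a - b) s = cf a s - cf b s.
Proof. exact: cf_additive. Qed.
Lemma cf_sum (I : Type) (r : seq I) (P : pred I) (F : I -> germ) s :
  cf (\sum_(i <- r | P i) F i) s = \sum_(i <- r | P i) cf (F i) s.
Proof. by apply: (big_morph (fun a => cf a s)) => [a b|]; rewrite ?cf_add ?cf0. Qed.

Lemma cf_gXM0 i a s : s i = 0%N -> cf (gX R i * a) s = 0.
Proof.
elim/mon_ind: s a => [|j s IH] a; first by rewrite -ev_cf rmorphM /= ev_gX mul0r.
rewrite !ffunE; have [<-|ji] := eqVneq j i; first by rewrite addn1.
rewrite addn0 => si.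
by rewrite cf_shift gdM gd_gX (negPf ji) mul0r add0r IH ?mulr0.
Qed.
Lemma mon_pred s i : s i != 0%N ->
  s = madd [ffun j => if j == i then (s j).-1 else s j] (munit i 1).
Proof.
move=> si; apply/ffunP => j; rewrite !ffunE; case: eqP => [->|]; last by rewrite addn0.
by rewrite addn1 prednK // lt0n.
Qed.
Lemma cf_gXM i a s : cf (gX R i * a) (madd s (munit i 1)) = cf a s.
Proof.
have [k] := ubnP (s i); elim: k s a => // k IH s a; rewrite ltnS => sk.
rewrite cf_shift gdM gd_gX eqxx mul1r cf_add.
have [s0|s0] := eqVneq (s i) 0%N.
  by rewrite cf_gXM0 // s0 addr0 invr1 mul1r.
rewrite [in X in _ + X](mon_pred s0) IH; last first.
  by rewrite ffunE eqxx; apply: leq_trans sk; rewrite prednK // lt0n.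
rewrite cf_gd -(mon_pred s0) ffunE eqxx prednK ?lt0n //.
have -> : cf a s + (s i)%:R * cf a s = (s i).+1%:R * cf a s by rewrite -nat1r mulrDl mul1r.
by rewrite mulKf // pnatr_eq0.
Qed.
End GermTheory.

(** * The m-adic filtration and derivations of the ring of germs *)

Section OrderFiltration.
Variables (R : realType) (n : nat).
Local Notation C := (CC R).
Local Notation V := 'rV[CC R]_n.
Local Notation mon := {ffun 'I_n -> nat}.
Local Notation germ := (germ R n).
Local Notation gX := (gX R).
Local Notation gC := (gC n).
Implicit Types (a b : germ) (i j : 'I_n) (s t : mon).

(** The k-th power of the maximal ideal, read on Taylor coefficients; [hadamard] recovers the
    products. *)
Definition ordM (k : nat) a := forall s, (mdeg s < k)%N -> cf a s = 0.

Lemma ordM0 a : ordM 0 a. Proof. by []. Qed.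
Lemma ordM_zero k : ordM k 0. Proof. by move=> s _; exact: cf0. Qed.
Lemma ordMD k a b : ordM k a -> ordM k b -> ordM k (a + b).
Proof. by move=> ha hb s hs; rewrite cf_add ha ?hb ?addr0. Qed.
Lemma ordMN k a : ordM k a -> ordM k (- a).
Proof. by move=> ha s hs; rewrite cf_opp ha ?oppr0. Qed.
Lemma ordMB k a b : ordM k a -> ordM k b -> ordM k (a - b).
Proof. by move=> ha hb; apply: ordMD => //; exact: ordMN. Qed.
Lemma ordM_sum k (I : Type) (r : seq I) (P : pred I) (F : I -> germ) :
  (forall e, P e -> ordM k (F e)) -> ordM k (\sum_(e <- r | P e) F e).
Proof.
move=> h; elim/big_ind: _ => [|? ?|//]; [exact: ordM_zero | exact: ordMD].
Qed.
Lemma ordM_weak k l a : (l <= k)%N -> ordM k a -> ordM l a.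
Proof. by move=> lk h s hs; apply: h; exact: leq_trans lk. Qed.
Lemma mdeg_eq0 s : mdeg s = 0%N -> s = mon0 n.
Proof.
move=> h; apply/ffunP => i; rewrite ffunE; apply/eqP; rewrite -leqn0.
by rewrite -h mdeg_ge.
Qed.
Lemma ordM1P a : ordM 1 a <-> ev a = 0.
Proof.
rewrite ev_cf; split=> [|h s]; first by apply; rewrite mdeg0.
by rewrite ltnS leqn0 => /eqP /mdeg_eq0 ->.
Qed.
Lemma ordM_gX k i a : ordM k a -> ordM k.+1 (gX i * a).
Proof.
move=> h s hs; have [s0|s0] := eqVneq (s i) 0%N; first exact: cf_gXM0.
rewrite (mon_pred s0) cf_gXM; apply: h; move: hs.
by rewrite {1}(mon_pred s0) mdegD mdeg_unit addn1.
Qed.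
Lemma ordM_gd k i a : ordM k.+1 a -> ordM k (gd i a).
Proof. by move=> h s hs; rewrite cf_gd h ?mulr0 // mdegD mdeg_unit addn1. Qed.
Lemma ordM_eq0 a : (forall k, ordM k a) -> a = 0.
Proof.
by move=> h; apply: cf_inj; apply/funext => s; rewrite cf0 (h (mdeg s).+1).
Qed.

(** Each monomial is charged to its first variable: [c i] collects the coefficients of the monomials
    that involve x_i and no earlier variable, so nothing is counted twice. *)
Lemma hadamard k a : ordM k.+1 a -> exists2 b : 'I_n -> germ, a = \sum_i gX i * b i & forall i, ordM k (b i).
Proof.
move=> ha; have [K [r [r0 gc]]] := proj2_sig a.
pose c i s := if [forall j : 'I_n, (j < i)%N ==> (s j == 0%N)] then cf a (madd s (munit i 1)) else 0.
have cc i : convergent (c i).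
  exists (K * r), r; split => // s; rewrite /c; have K0 := geo_ge0 gc.
  case: ifP => _; last by rewrite nrm0 !mulr_ge0 ?exprn_ge0 ?(ltW r0).
  by apply: le_trans (gc _) _; rewrite mdegD mdeg_unit addn1 exprS mulrA.
exists (fun i => exist _ _ (cc i)); last first.
  by move=> i s hs; rewrite /cf /= /c; case: ifP => // _; rewrite ha // mdegD mdeg_unit addn1.
apply: cf_inj; apply/funext => s; rewrite cf_sum.
have [s0|s0] := eqVneq s (mon0 n).
  rewrite s0 [LHS]ha ?mdeg0 // big1 // => i _; by rewrite cf_gXM0 // ffunE.
have [i0 si0] : exists i, s i != 0%N.
  apply/existsP; rewrite -negb_forall; apply: contra s0 => /forallP h.
  by apply/eqP/ffunP => i; rewrite ffunE; apply/eqP.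
have [i /= si imin] := @arg_minnP _ i0 (fun i => s i != 0%N) (fun i : 'I_n => i : nat) si0.
rewrite (bigD1 i) //= [X in _ + X]big1 ?addr0 => [|j ji].
  rewrite [in RHS](mon_pred si) cf_gXM /cf /= /c -(mon_pred si).
  case: ifP => // /negP[]; apply/forallP => j; apply/implyP => ji.
  rewrite ffunE; case: (j =P i) => [E|_]; first by move: ji; rewrite E ltnn.
  by apply: contraLR ji => sj; rewrite -leqNgt; exact: imin.
have [sj|sj] := eqVneq (s j) 0%N; first exact: cf_gXM0.
rewrite (mon_pred sj) cf_gXM /cf /= /c; case: ifP => // /forallP /(_ i).
have ij : (i < j)%N by rewrite ltn_neqAle imin // andbT; apply: contraNneq ji => /val_inj ->.
by rewrite ij /= ffunE [i == j]eq_sym (negPf ji) (negPf si).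
Qed.

Lemma ordM_mulr k a b : ordM k b -> ordM k (a * b).
Proof.
elim: k b => [|k IH] b hb; first exact: ordM0.
have [c -> hc] := hadamard hb; rewrite mulr_sumr; apply: ordM_sum => i _.
by rewrite mulrCA; apply: ordM_gX; exact: IH.
Qed.
Lemma ordM_mull k a b : ordM k a -> ordM k (a * b).
Proof. by rewrite mulrC; exact: ordM_mulr. Qed.
Lemma ordM_mul k l a b : ordM k a -> ordM l b -> ordM (k + l) (a * b).
Proof.
elim: k a => [|k IH] a ha hb; first exact: ordM_mulr.
have [c -> hc] := hadamard ha; rewrite mulr_suml; apply: ordM_sum => i _.
by rewrite -mulrA addSn; apply: ordM_gX; exact: IH.
Qed.
Lemma ordM1_gX i : ordM 1 (gX i). Proof. by apply/ordM1P; exact: ev_gX. Qed.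

Definition gm s : germ := \prod_i gX i ^+ s i.
Lemma gm0 : gm (mon0 n) = 1.
Proof. by rewrite /gm big1 // => i _; rewrite ffunE expr0. Qed.
Lemma gm_add s t : gm (madd s t) = gm s * gm t.
Proof. by rewrite /gm -big_split; apply: eq_bigr => i _; rewrite ffunE exprD. Qed.
Lemma gm_unit i : gm (munit i 1) = gX i.
Proof.
rewrite /gm (bigD1 i) //= ffunE eqxx expr1 big1 ?mulr1 // => j ji.
by rewrite ffunE (negPf ji) expr0.
Qed.
Lemma cf_gmM t a s : cf (gm t * a) (madd s t) = cf a s.
Proof.
elim/mon_ind: t s => [|i t IH] s; first by rewrite gm0 mul1r madd0.
by rewrite maddA gm_add gm_unit mulrAC mulrC cf_gXM IH.
Qed.
Lemma cf_gmM0 t a s i : (s i < t i)%N -> cf (gm t * a) s = 0.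
Proof.
elim/mon_ind: t s => [|j t IH] s; first by rewrite ffunE ltn0.
rewrite gm_add gm_unit mulrAC mulrC => h.
have [s0|s0] := eqVneq (s j) 0%N; first exact: cf_gXM0.
rewrite (mon_pred s0) cf_gXM; apply: IH; move: h; rewrite !ffunE.
case: eqP => [->|_]; last by rewrite addn0.
by rewrite addn1 ltnS => h; rewrite prednK // lt0n.
Qed.
Lemma cf_one s : cf (1 : germ) s = (s == mon0 n)%:R.
Proof.
case: eqP => [->|/eqP s0]; first by rewrite -ev_cf rmorph1.
have [//|[i [t E]]] := mon_split s; first by move=> E; rewrite E eqxx in s0.
by rewrite E cf_shift (_ : 1 = gC 1) ?rmorph1 // gd_gC cf0 mulr0.
Qed.
Lemma cf_gm t s : cf (gm t) s = (s == t)%:R.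
Proof.
have [[i h]|h] := pselect (exists i, (s i < t i)%N).
  rewrite -[gm t]mulr1 (cf_gmM0 1 h); case: eqP => // E.
  by move: h; rewrite E ltnn.
have E : s = madd t [ffun i => (s i - t i)%N].
  apply/ffunP => i; rewrite !ffunE subnKC // leqNgt; apply/negP => hi; apply: h; by exists i.
rewrite -[gm t]mulr1 [in LHS]E maddC cf_gmM cf_one; congr (nat_of_bool _)%:R.
apply/eqP/eqP => [h'|->]; last by apply/ffunP => i; rewrite !ffunE subnn.
by rewrite E h' madd0.
Qed.

Definition mons (K : nat) : seq mon :=
  [seq s <- [seq [ffun i => val (e i)] | e : {ffun 'I_n -> 'I_K}] | (mdeg s < K)%N].
Lemma mons_uniq K : uniq (mons K).
Proof.
apply: filter_uniq; rewrite map_inj_uniq ?enum_uniq // => e f /ffunP h.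
by apply/ffunP => i; apply: val_inj; have := h i; rewrite !ffunE.
Qed.
Lemma mem_mons K s : (s \in mons K) = (mdeg s < K)%N.
Proof.
rewrite mem_filter; case: ltnP => //= h; apply/mapP.
have hs i : (s i < K)%N by exact: leq_ltn_trans (mdeg_ge s i) h.
exists [ffun i => Ordinal (hs i)]; first by rewrite mem_enum.
by apply/ffunP => i; rewrite !ffunE.
Qed.
Lemma cf_lin (r : seq mon) (c : mon -> C) t : uniq r ->
  cf (\sum_(s <- r) gC (c s) * gm s) t = if t \in r then c t else 0.
Proof.
move=> ur; rewrite cf_sum; under eq_bigr do rewrite cf_gCM cf_gm.
case: ifP => tr.
  rewrite (bigD1_seq t) //= eqxx mulr1 big1 ?addr0 // => s st.
  by rewrite eq_sym (negPf st) mulr0.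
rewrite big_seq big1 // => s sr; case: eqP => [E|_]; last by rewrite mulr0.
by move: tr; rewrite E sr.
Qed.
Definition trunc (K : nat) a : germ := \sum_(s <- mons K) gC (cf a s) * gm s.
Lemma truncP K a : ordM K (a - trunc K a).
Proof. by move=> s hs; rewrite cf_sub cf_lin ?mons_uniq // mem_mons hs subrr. Qed.

Definition gderivation (T : germ -> germ) :=
  [/\ forall a b, T (a + b) = T a + T b,
      forall a b, T (a * b) = T a * b + a * T b & forall k, T (gC k) = 0].
Definition dv (w : 'I_n -> germ) a : germ := \sum_i w i * gd i a.

Lemma gder_dv w : gderivation (dv w).
Proof.
split=> [a b|a b|k].
- by rewrite /dv -big_split; apply: eq_bigr => i _; rewrite raddfD mulrDr.
- rewrite /dv mulr_suml mulr_sumr -big_split; apply: eq_bigr => i _.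
  by rewrite gdM /=; ring.
- by rewrite /dv big1 // => i _; rewrite gd_gC mulr0.
Qed.
Section Derivn.
Variable T : germ -> germ.
Hypothesis dT : gderivation T.
Lemma gderD a b : T (a + b) = T a + T b. Proof. by case: dT. Qed.
Lemma gderM a b : T (a * b) = T a * b + a * T b. Proof. by case: dT. Qed.
Lemma gderC k : T (gC k) = 0. Proof. by case: dT. Qed.
Lemma gderZ k a : T (gC k * a) = gC k * T a.
Proof. by rewrite gderM gderC mul0r add0r. Qed.
Lemma gder0 : T 0 = 0.
Proof. by rewrite -[0](rmorph0 gC) gderC rmorph0. Qed.
Lemma gder1 : T 1 = 0.
Proof. by rewrite -[1](rmorph1 gC) gderC. Qed.
Lemma gderN a : T (- a) = - T a.
Proof. by apply/eqP; rewrite -addr_eq0 addrC -gderD subrr gder0. Qed.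
Lemma gderB a b : T (a - b) = T a - T b.
Proof. by rewrite gderD gderN. Qed.
Lemma gder_sum (I : Type) (r : seq I) (P : pred I) (F : I -> germ) :
  T (\sum_(e <- r | P e) F e) = \sum_(e <- r | P e) T (F e).
Proof. by apply: (big_morph T gderD gder0). Qed.
Lemma gderX a k : T (a ^+ k) = k%:R * a ^+ k.-1 * T a.
Proof.
elim: k => [|k IH]; first by rewrite expr0 gder1 !mul0r.
rewrite exprS gderM IH; case: k {IH} => [|k]; first by rewrite !expr0; ring.
by rewrite /= -[k.+2%:R]nat1r exprS; ring.
Qed.
Lemma gder_ordM k a : ordM k.+1 a -> ordM k (T a).
Proof.
elim: k a => [|k IH] a ha; first exact: ordM0.
have [b -> hb] := hadamard ha; rewrite gder_sum; apply: ordM_sum => i _.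
rewrite gderM; apply: ordMD; first exact: ordM_mulr.
by apply: ordM_gX; exact: IH.
Qed.
End Derivn.

(** A derivation lowers the order by at most one, hence is continuous for the m-adic topology, and
    agreement on polynomials suffices. *)
Lemma gderE T : gderivation T -> T = dv (fun i => T (gX i)).
Proof.
move=> dT; apply/funext => a; apply/eqP; rewrite -subr_eq0; apply/eqP/ordM_eq0 => k.
have dd := gder_dv (fun i => T (gX i)).
have key s : T (gm s) = dv (fun i => T (gX i)) (gm s).
  elim/mon_ind: s => [|i s IH]; first by rewrite gm0 (gder1 dT) (gder1 dd).
  rewrite gm_add (gderM dT) (gderM dd) IH; congr (_ + _ * _).
  rewrite gm_unit /dv (bigD1 i) //= gd_gX eqxx mulr1 big1 ?addr0 // => j ji.
  by rewrite gd_gX (negPf ji) mulr0.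
rewrite -[a](subrK (trunc k.+1 a)) (gderD dT) (gderD dd) opprD addrACA.
have -> : T (trunc k.+1 a) = dv (fun i => T (gX i)) (trunc k.+1 a).
  rewrite (gder_sum dT) (gder_sum dd); apply: eq_bigr => s _.
  by rewrite (gderZ dT) (gderZ dd) key.
rewrite subrr addr0; apply: ordMB; [apply: (gder_ordM dT) | apply: (gder_ordM dd)];
  exact: truncP.
Qed.

Definition ginv a : germ := mk (fun x => (fn a x)^-1).
Lemma ginvP a : ev a != 0 -> a * ginv a = 1.
Proof.
move=> ha.
have nz : \forall x \near (0 : V), fn a x != 0.
  have /nbhs_singleton da := fn_On a; have ca := differentiable_continuous da.
  have h : \forall z \near (fn a 0), z != 0.
    apply/nearC; exists (nrm (ev a)); first exact: nrm_gt0.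
    move=> w hw; apply/eqP => E; move: hw; rewrite E sub0r nrmN ltxx //.
  exact: (ca [set z | z != 0] h).
have hi : On (fun x => (fn a x)^-1).
  by move: nz (fn_On a); apply: filterS2 => x ax dx; exact: differentiableV.
rewrite -{1}[a]mkK /ginv -mkM //; last exact: fn_On.
apply: mkE; move: nz (fn_gC n (1 : C)); rewrite rmorph1; apply: filterS2 => x ax ->.
by rewrite mulfV.
Qed.
End OrderFiltration.

(** * Local inversion of maps tangent to the identity *)

Section InverseFunction.
Variables (R : realType) (n : nat).
Local Notation C := (CC R).
Local Notation V := 'rV[CC R]_n.
Local Notation germ := (germ R n).
Implicit Types (a b : germ) (i j : 'I_n) (x y u p q v : V).

Lemma fn_small a (e : R) : ev a = 0 -> 0 < e -> \forall x \near (0 : V), nrm (fn a x) <= e.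
Proof.
move=> a0 e0; have /nbhs_singleton da := fn_On a; have ca := differentiable_continuous da.
have h : \forall z \near (fn a 0), nrm z <= e.
  apply/nearC; exists e => // w; rewrite -[fn a 0]/(ev a) a0 subr0; exact: ltW.
exact: (ca [set z | nrm z <= e] h).
Qed.

(** Smallness is used twice: the bound on the gradient makes the differential of p + Psi p
    invertible near 0, the Lipschitz bound makes the iteration contract. *)
Lemma ordM2_strict a (e : R) : ordM 2 a -> 0 < e -> exists2 d : R, 0 < d & forall x, pdisc d x ->
  \sum_i nrm (fn (gd i a) x) <= e /\
  forall u (t : R), pdisc d (x + u) -> 0 <= t -> pdisc t u -> nrm (fn a (x + u) - fn a x) <= e * t.
Proof.
move=> ha e0; have [K [r [r0 gc]]] := proj2_sig a; have K0 := geo_ge0 gc.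
pose d := (16 * r)^-1; have d0 : 0 < d by rewrite invr_gt0; lra.
have dr : d * r <= 1 / 16 by rewrite /d (_ : (16 * r)^-1 * r = 1 / 16) //; field; rewrite gt_eqF.
pose B := K * 16 ^+ n / d ^+ 2.
have B0 : 0 <= B by rewrite divr_ge0 ?mulr_ge0 ?exprn_ge0 // ltW.
pose e1 := e / 2 / n.+1%:R.
have e10 : 0 < e1 by rewrite !divr_gt0.
have /near0 [d1 d10 hd1] : \forall x \near (0 : V), forall i, nrm (fn (gd i a) x) <= e1.
  apply: (@filter_forall _ 'I_n (fun i x => nrm (fn (gd i a) x) <= e1) (nbhs (0 : V)) _) => i; apply: fn_small => //.
  by apply/ordM1P; exact: ordM_gd.
pose rho := Num.min d1 (Num.min (d / 2) (e / 2 / (1 + 2 * B))).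
have [k1 k2 k3] : [/\ rho <= d1, rho <= d / 2 & rho <= e / 2 / (1 + 2 * B)].
  by rewrite /rho !ge_min !lexx !orbT.
have rho0 : 0 < rho by rewrite /rho !lt_min d10 !divr_gt0 //; lra.
exists rho => // x px.
have hs : \sum_i nrm (fn (gd i a) x) <= e / 2.
  apply: (@le_trans _ _ (\sum_(i < n) e1)).
    by apply: ler_sum => i _; apply: hd1; exact: pdisc_weak px.
  rewrite sumr_const card_ord /e1 -[_ *+ n]mulr_natr -mulrA ler_piMr //; first lra.
  by rewrite mulrC ler_pdivrMr ?ltr0Sn // mul1r ler_nat.
split; first by lra.
move=> u t pxu t0 pt.
have pu : pdisc (2 * rho) u.
  have -> : u = (x + u) + - x by rewrite addrC addKr.
  by rewrite mulr_natl mulr2n; apply: pdiscD => //; exact: pdiscN.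
pose s := Num.min t (2 * rho).
have ps : pdisc s u by move=> i; rewrite le_min pt pu.
have [st s2] : s <= t /\ s <= 2 * rho by rewrite /s !ge_min !lexx orbT.
have s0 : 0 <= s by rewrite /s le_min t0 mulr_ge0 // ltW.
have pxd : pdisc d x by apply: pdisc_weak px; lra.
have := @FS_rem R n (enum 'I_n) (cf a) x u K d r (s / d) (enum_uniq _) (ltW r0) dr gc pxd.
rewrite divfK ?gt_eqF // ler_pdivrMr // mul1r size_enum_ord => /(_ _ _ ps) h.
have {}h : nrm (fn a (x + u) - fn a x - FD (enum 'I_n) (cf a) x u) <= B * s * s.
  rewrite /fn !fsumE; apply: le_trans (h _ _) _; [by rewrite divr_ge0 // ltW | lra |].
  by rewrite [X in X <= _](_ : _ = B * s * s) //; rewrite /B; field; rewrite gt_eqF.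
have h2 : nrm (FD (enum 'I_n) (cf a) x u) <= e / 2 * s.
  rewrite /FD big_enum /=; apply: le_trans (nrm_sum _ _ _) _.
  apply: (@le_trans _ _ (\sum_i s * nrm (fn (gd i a) x))).
    apply: ler_sum => i _; rewrite nrmM; apply: ler_pM; rewrite ?nrm_ge0 //.
    by rewrite /fn fsumE.
  by rewrite -mulr_sumr mulrC; apply: ler_wpM2r.
have -> : fn a (x + u) - fn a x = (fn a (x + u) - fn a x - FD (enum 'I_n) (cf a) x u) + FD (enum 'I_n) (cf a) x u.
  by rewrite subrK.
apply: (le_trans (nrmD _ _)); apply: (le_trans (lerD h h2)).
apply: (@le_trans _ _ (e * s)); last by apply: ler_wpM2l => //; exact: ltW.
have : B * s <= e / 2.
  apply: (@le_trans _ _ (B * (2 * (e / 2 / (1 + 2 * B))))).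
    by apply: ler_wpM2l => //; lra.
  have -> : B * (2 * (e / 2 / (1 + 2 * B))) = (2 * B * (e / 2)) / (1 + 2 * B) by ring.
  rewrite ler_pdivrMr; last by lra.
  by rewrite mulrDr mulr1 [2 * B * _]mulrC lerDr; lra.
move=> /(ler_wpM2r s0); lra.
Qed.

Lemma differentiable_row (F : V -> V) x :
  (forall j, differentiable (fun p => F p 0 j) x) -> differentiable F x.
Proof.
move=> h; have -> : F = \sum_j (fun p => F p 0 j *: ('e_j : V)).
  by apply/funext => p; rewrite fct_sumE {1}[F p]row_sum_delta.
by apply: differentiable_sum => j; exact: differentiableZl.
Qed.
Lemma differentiable_coordinate (F : V -> V) x j :
  differentiable F x -> differentiable (fun p => F p 0 j) x.
Proof.
move=> h; have d2 := @differentiable_coord C 1 n (F x) 0 j.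
by have := differentiable_comp h d2.
Qed.

Lemma comp_near (F : V -> V) (P : set V) : vector_fields F -> F 0 = 0 ->
  (\forall x \near (0 : V), P x) -> \forall x \near (0 : V), P (F x).
Proof.
move=> /nbhs_singleton dF F0 hP; have cF := differentiable_continuous dF.
by apply: (cF P); rewrite F0.
Qed.
Lemma comp_On (f : V -> C) (F : V -> V) : On f -> vector_fields F -> F 0 = 0 -> On (f \o F).
Proof.
move=> hf hF F0; have := comp_near hF F0 hf; move: hF; apply: filterS2 => x dF df.
exact: (differentiable_comp dF df).
Qed.

Variable psi : 'I_n -> germ.
Hypothesis psi2 : forall j, ordM 2 (psi j).
Let Psi (p : V) : V := \row_j fn (psi j) p.

Let Psi0 : Psi 0 = 0.
Proof.
by apply/rowP => j; rewrite !mxE; apply/(ordM1P (psi j)).1/(@ordM_weak _ _ 2).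
Qed.

Let vn (u : V) : exists2 t : R, 0 <= t & forall s : R, 0 <= s -> (t <= s) <-> pdisc s u.
Proof.
have ur : `|u| \is Num.real by rewrite ger0_real.
have [t Et] := complex_realP _ ur; exists t.
  have : rc 0 <= `|u| by exact: normr_ge0.
  by rewrite Et -[(t%:C)%C]/(rc t) rc_le.
by move=> s s0; rewrite -mxnorm_le // Et -[(t%:C)%C]/(rc t) rc_le.
Qed.

(** Fixed point iteration p -> q - Psi p, of ratio 1/2. The inverse is Lipschitz of constant 2,
    which carries the first-order expansion of [Psi] over to the inverse. *)
Lemma local_inverse : exists y : V -> V, [/\ vector_fields y, y 0 = 0,
  \forall p \near (0 : V), y (p + Psi p) = p & \forall q \near (0 : V), y q + Psi (y q) = q].
Proof.
have /choice [dl hdl] : forall j, exists d : R, 0 < d /\ forall x, pdisc d x ->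
  \sum_i nrm (fn (gd i (psi j)) x) <= 1 / 2 /\
  forall u (t : R), pdisc d (x + u) -> 0 <= t -> pdisc t u -> nrm (fn (psi j) (x + u) - fn (psi j) x) <= 1 / 2 * t.
  have half0 : 0 < 1 / 2 :> R by lra.
  by move=> j; have [d d0 hd] := ordM2_strict (psi2 j) half0; exists d.
have /near0 [rho rho0 hrho] : \forall x \near (0 : V), forall j, pdisc (dl j) x.
  by apply: (@filter_forall _ 'I_n (fun j x => pdisc (dl j) x) (nbhs (0 : V)) _) => j; apply/near0; exists (dl j) => //; case: (hdl j).
have rho1 := ltW rho0.
have lipP p p' (t : R) : pdisc rho p -> pdisc rho p' -> 0 <= t -> pdisc t (p' - p) -> pdisc (t / 2) (Psi p' - Psi p).
  move=> hp hp' t0 ht j; rewrite !mxE mulrC -[2^-1]div1r.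
  have [_ h] := (hdl j).2 p (hrho _ hp j); have := h (p' - p) t.
  rewrite (_ : p + (p' - p) = p'); last by rewrite addrC subrK.
  apply => //.
  exact: hrho.
have bndP p : pdisc rho p -> pdisc (rho / 2) (Psi p).
  move=> hp; have := @lipP 0 p rho (pdisc0 rho1) hp rho1; rewrite Psi0 !subr0; exact.
have sol q : pdisc (rho / 2) q -> exists p, pdisc rho p /\ p + Psi p = q.
  move=> hq; pose it k := iter k (fun p => q - Psi p) 0.
  have step p : pdisc rho p -> pdisc rho (q - Psi p).
    move=> hp; have := pdiscD hq (pdiscN (bndP _ hp)); apply: pdisc_weak; lra.
  have hit k : pdisc rho (it k) by elim: k => [|k IH]; [exact: pdisc0 | exact: step].
  have hd k : pdisc (rho * 2 ^- k) (it k.+1 - it k).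
    elim: k => [|k IH]; first by rewrite expr0 invr1 mulr1 /= subr0; exact: (hit 1%N).
    have -> : it k.+2 - it k.+1 = - (Psi (it k.+1) - Psi (it k)).
      by rewrite /it !iterS; set A := Psi _; set B := Psi _; apply/rowP => j; rewrite !mxE; ring.
    apply: pdiscN; rewrite exprS invfM mulrCA mulrC; apply: lipP => //.
    by rewrite mulr_ge0 // invr_ge0 exprn_ge0.
  have /choice [z hz] : forall j, exists z : C, forall k, nrm (it k 0 j - z) <= 4 * rho * 2 ^- k.
    move=> j; apply: (@geom_limit R (fun k => it k 0 j) rho) => k.
    by have := hd k j; rewrite !mxE.
  pose p : V := \row_j z j.
  have hp k : pdisc (4 * rho * 2 ^- k) (it k - p) by move=> j; rewrite !mxE; have := hz j k.
  have pp : pdisc rho p.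
    move=> j; rewrite -subr_le0; apply: (@le_all_small _ _ (4 * rho)) => k.
    have := hp k j; rewrite mxE [(- p) 0 j]mxE.
    have := hit k j; have := nrm_tri (p 0 j) (it k 0 j) 0.
    rewrite !subr0 (nrmBC (p 0 j)); lra.
  exists p; split => //; apply/rowP => j; apply/eqP; rewrite -subr_eq0; apply/eqP/nrm_eq0.
  apply/eqP; rewrite eq_le nrm_ge0 andbT; apply: (@le_all_small _ _ (8 * rho)) => k.
  have h1 := hp k.+1 j; have h2 := lipP _ _ _ pp (hit k) (_ : 0 <= 4 * rho * 2 ^- k) (hp k).
  have {}h2 := h2 (_ : 0 <= 4 * rho * 2 ^- k) j.
  have E : (p + Psi p) 0 j - q 0 j = - ((it k.+1 - p) 0 j) - (Psi (it k) - Psi p) 0 j.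
    by rewrite /it iterS !mxE; ring.
  rewrite E; apply: (le_trans (nrmB _ _)); rewrite nrmN; apply: (le_trans (lerD h1 (h2 _))).
    by rewrite !mulr_ge0 ?invr_ge0 ?exprn_ge0.
  have : 0 <= rho * 2 ^- k by rewrite mulr_ge0 // invr_ge0 exprn_ge0.
  rewrite exprS invfM; lra.
have lipI p p' (t : R) : pdisc rho p -> pdisc rho p' -> 0 <= t ->
    pdisc t ((p' + Psi p') - (p + Psi p)) -> pdisc (2 * t) (p' - p).
  move=> hp hp' t0 ht; have [s s0 hs] := vn (p' - p).
  have h1 := lipP _ _ _ hp hp' s0 ((hs s s0).1 (lexx _)).
  have h2 : s <= t + s / 2.
    apply/(hs _ _).2; first by rewrite addr_ge0 // divr_ge0.
    have -> : p' - p = ((p' + Psi p') - (p + Psi p)) + - (Psi p' - Psi p).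
      by apply/rowP => j; rewrite !mxE; ring.
    by apply: pdiscD => //; exact: pdiscN.
  by apply/(hs _ _).1; lra.
have injI p p' : pdisc rho p -> pdisc rho p' -> p + Psi p = p' + Psi p' -> p = p'.
  move=> hp hp' E; have := lipI _ _ 0 hp' hp (lexx _); rewrite E subrr mulr0 => /(_ (pdisc0 (lexx _))) h.
  apply/rowP => j; apply/eqP; rewrite -subr_eq0; apply/eqP/nrm_eq0.
  by have := h j; rewrite !mxE => h'; apply/eqP; rewrite eq_le h' nrm_ge0.
pose y q : V := xget 0 [set p | pdisc rho p /\ p + Psi p = q].
have yP q : pdisc (rho / 2) q -> pdisc rho (y q) /\ y q + Psi (y q) = q.
  by move=> /sol [p hp]; exact: (xgetI 0 (hp : [set p | pdisc rho p /\ p + Psi p = q] p)).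
have r20 : 0 < rho / 2 by rewrite divr_gt0.
have y00 : y 0 = 0.
  have [h1 h2] := yP 0 (pdisc0 (ltW r20)).
  by apply: injI => //; [exact: pdisc0 | rewrite h2 Psi0 addr0].
exists y; split => //; last 1 first.
- by apply/near0; exists (rho / 2) => // q /yP [].
- have dpsi : \forall p \near (0 : V), forall j, has_diff (fn (psi j)) p (fun i => fn (gd i (psi j)) p).
    apply: (@filter_forall _ 'I_n
      (fun j p => has_diff (fn (psi j)) p (fun i => fn (gd i (psi j)) p)) (nbhs (0 : V)) _) => j; move: (fn_derive (psi j)); apply: filterS => p [dp hp].
    have [h _] := differentiable_has_diff dp.
    have E : (fun i => 'D_('e_i) (fn (psi j)) p) = (fun i => fn (gd i (psi j)) p).
      by apply/funext => i; rewrite hp sum_delta.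
    by rewrite -E.
  have /near0 [r1 r10 hr1] := dpsi.
  pose r2 := Num.min rho r1 / 4.
  have [l1 l2] : Num.min rho r1 <= rho /\ Num.min rho r1 <= r1 by rewrite !ge_min !lexx orbT.
  have m0 : 0 < Num.min rho r1 by rewrite lt_min rho0.
  apply/near0; exists r2; first by rewrite divr_gt0.
  move=> q hq; have hq2 : pdisc (rho / 2) q by apply: pdisc_weak hq; rewrite /r2; lra.
  have [yq1 yq2] := yP q hq2; set p := y q in yq1 yq2.
  have pr1 : pdisc r1 p.
    have := lipI 0 p r2 (pdisc0 rho1) yq1; rewrite Psi0 yq2 !subr0 addr0 subr0 => h.
    by apply: pdisc_weak (h _ hq); rewrite /r2; lra.
  have hdp := hr1 _ pr1.
  (* Differential of p + Psi p acting on rows. By the gradient bound a row in its kernel has norm at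
     most half of itself, hence is 0. *)
  pose M : 'M[C]_n := \matrix_(i, j) ((i == j)%:R + fn (gd i (psi j)) p).
  have vM v j : (v *m M) 0 j = v 0 j + lincomb (fun i => fn (gd i (psi j)) p) v.
    rewrite !mxE /lincomb; under eq_bigr do rewrite mxE mulrDr.
    rewrite big_split /=; congr (_ + _); rewrite (bigD1 j) //= eqxx mulr1 big1 ?addr0 // => i ij.
    by rewrite (negPf ij) mulr0.
  have uM : M \in unitmx.
    rewrite -row_free_unit -kermx_eq0; apply/eqP/row_matrixP => k; rewrite row0.
    set v := row k _; have vM0 : v *m M = 0 by rewrite /v -row_mul mulmx_ker row0.
    have [s s0 hs] := vn v.
    have hv := (hs s s0).1 (lexx _).
    have : s <= s / 2.
      apply/(hs _ _).2; first by rewrite divr_ge0.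
      move=> j; have := vM v j; rewrite vM0 mxE => /eqP; rewrite eq_sym addr_eq0 => /eqP ->.
      rewrite nrmN; apply: le_trans (lincomb_le _ hv) _; rewrite -[2^-1]div1r; apply: ler_wpM2l => //.
      by case: ((hdl j).2 p (hrho _ yq1 j)).
    move=> h; have s00 : s <= 0 by lra.
    have h0 := (hs 0 (lexx _)).1 s00.
    apply/rowP => j; rewrite [RHS]mxE; apply: nrm_eq0; apply/eqP.
    by rewrite eq_le nrm_ge0 andbT; exact: (h0 j).
  apply: differentiable_row => j.
  pose Minv := invmx M.
  have [] // := @has_diffP _ _ (fun q => y q 0 j) q (fun i => Minv i j) _.
  (* The preimage moves by at most 2 t and [Minv] enlarges an error by at most S, hence the
     tolerance e / (2 S). *)
  move=> e e0; pose S := 1 + \sum_k nrm (Minv k j).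
  have S0 : 0 < S by rewrite ltr_pwDl // sumr_ge0 // => k _; rewrite nrm_ge0.
  have e20 : 0 < e / (2 * S) by rewrite divr_gt0 // mulr_gt0.
  have /choice [dk hdk] : forall k, exists d : R, 0 < d /\ forall u (t : R), pdisc d u -> 0 <= t -> pdisc t u ->
     nrm (fn (psi k) (p + u) - fn (psi k) p - lincomb (fun i => fn (gd i (psi k)) p) u) <= e / (2 * S) * t.
    by move=> k; have [d d0 hd] := hdp k _ e20; exists d.
  have /near0 [d d0 hd] : \forall u \near (0 : V), forall k, pdisc (dk k) u.
    by apply: (@filter_forall _ 'I_n (fun k x => pdisc (dk k) x) (nbhs (0 : V)) _) => k; apply/near0; exists (dk k) => //; case: (hdk k).
  exists (Num.min (d / 2) r2); first by rewrite lt_min !divr_gt0.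
  move=> v t pv t0 pt.
  have pv1 : pdisc (d / 2) v by apply: pdisc_weak pv; rewrite ge_min lexx.
  have pv2 : pdisc r2 v by apply: pdisc_weak pv; rewrite ge_min lexx orbT.
  have hqv : pdisc (rho / 2) (q + v) by apply: pdisc_weak (pdiscD hq pv2); rewrite /r2; lra.
  have [w1 w2] := yP _ hqv; set p' := y (q + v) in w1 w2 *.
  pose u := p' - p.
  have Ev : (p' + Psi p') - (p + Psi p) = v by rewrite w2 yq2 addrC addKr.
  have pu (s : R) : 0 <= s -> pdisc s v -> pdisc (2 * s) u by move=> s0 hs; apply: lipI => //; rewrite Ev.
  have pud : pdisc d u by apply: pdisc_weak (pu _ _ pv1); lra.
  have p'E : p' = p + u by rewrite /u addrC subrK.
  pose o : V := \row_k (fn (psi k) (p + u) - fn (psi k) p - lincomb (fun i => fn (gd i (psi k)) p) u).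
  have ho k : nrm (o 0 k) <= e / S * t.
    rewrite mxE; apply: le_trans ((hdk k).2 u (2 * t) (hd _ pud k) _ (pu _ t0 pt)) _; first by rewrite mulr_ge0.
    by rewrite le_eqVlt; apply/orP; left; apply/eqP; field; rewrite gt_eqF.
  have vE : v = u *m M + o.
    apply/rowP => k; rewrite mxE vM !mxE -Ev p'E !mxE; ring.
  have uE : u = (v - o) *m Minv by rewrite vE addrK mulmxK.
  have -> : y (q + v) 0 j - y q 0 j - lincomb (fun i => Minv i j) v = - (o *m Minv) 0 j.
    have : u 0 j = ((v - o) *m Minv) 0 j by rewrite -uE.
    by rewrite mulmxBl /u /lincomb !mxE => ->; ring.
  rewrite nrmN mxE; apply: le_trans (nrm_sum _ _ _) _.
  apply: (@le_trans _ _ (\sum_k e / S * t * nrm (Minv k j))).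
    by apply: ler_sum => k _; rewrite nrmM; apply: ler_wpM2r; rewrite ?nrm_ge0.
  rewrite -mulr_sumr mulrAC; apply: ler_wpM2r => //.
  rewrite mulrAC ler_pdivrMr //; apply: ler_wpM2l; first exact: ltW.
  by rewrite /S lerDr.
- apply/near0; exists (rho / 4); first by rewrite divr_gt0.
  move=> p hp; have hp' : pdisc rho p by apply: pdisc_weak hp; lra.
  have h := @lipP 0 p (rho / 4) (pdisc0 rho1) hp'.
  have hq : pdisc (rho / 2) (p + Psi p).
    apply: pdisc_weak (pdiscD hp _); last first.
      by have := h _ _; rewrite Psi0 !subr0; apply => //; lra.
    lra.
  by have [h1 h2] := yP _ hq; apply: injI.
Qed.
End InverseFunction.

(** * Substitution and changes of coordinates *)

Section Substitution.
Variables (R : realType) (n : nat).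
Local Notation C := (CC R).
Local Notation V := 'rV[CC R]_n.
Local Notation germ := (germ R n).
Local Notation gX := (gX R).
Local Notation gC := (gC n).
Implicit Types (a b : germ) (i j : 'I_n) (x y : V -> V).

Lemma fn_gCM k a : germ_eq (fn (gC k * a)) (fun p => k * fn a p).
Proof. by move: (fnM (gC k) a) (fn_gC n k); apply: filterS2 => p -> ->. Qed.
Lemma fn_sum (T : Type) (r : seq T) (F : T -> germ) (f : T -> V -> C) : (forall z, germ_eq (fn (F z)) (f z)) ->
  germ_eq (fn (\sum_(z <- r) F z)) (fun p => \sum_(z <- r) f z p).
Proof.
move=> hF; elim: r => [|z r IH].
  rewrite big_nil; have := fn_gC n (0 : C); rewrite rmorph0.
  by apply: filterS => p ->; rewrite big_nil.
rewrite big_cons; move: (fnD (F z) (\sum_(j <- r) F j)) (hF z) IH.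
by apply: filterS3 => p -> -> ->; rewrite big_cons.
Qed.

Definition cmap y := vector_fields y /\ y 0 = 0.
(** Substitution, the pullback along [y]; mutually inverse coordinate changes give mutually inverse
    ring automorphisms. *)
Definition sub y a : germ := mk (fn a \o y).

Lemma comp_germ_eq (f g : V -> C) y : cmap y -> germ_eq f g -> germ_eq (f \o y) (g \o y).
Proof. by move=> [h1 h2] h; exact: (comp_near h1 h2 h). Qed.
Lemma cmap_On (f : V -> C) y : cmap y -> On f -> On (f \o y).
Proof. by move=> [h1 h2] h; exact: comp_On. Qed.
Lemma cmap_comp x y : cmap x -> cmap y -> cmap (x \o y).
Proof.
move=> [hx x0] [hy y0]; split; last by rewrite /= y0.
have := comp_near hy y0 hx; move: hy; apply: filterS2 => p dy dx.
exact: (differentiable_comp dy dx).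
Qed.

Section Sub.
Variable y : V -> V.
Hypothesis cy : cmap y.
Lemma fn_sub a : germ_eq (fn (sub y a)) (fn a \o y).
Proof. by apply/germ_eq_sym/fn_mk/cmap_On => //; exact: fn_On. Qed.
Lemma sub_mk (f : V -> C) : On f -> sub y (mk f) = mk (f \o y).
Proof.
move=> hf; symmetry; apply: mk_eq; first exact: cmap_On.
by apply: comp_germ_eq => //; exact: fn_mk.
Qed.
Lemma subD a b : sub y (a + b) = sub y a + sub y b.
Proof.
rewrite -[a in LHS]mkK -[b in LHS]mkK -mkD; try exact: fn_On.
rewrite sub_mk; last by apply: On_add; exact: fn_On.
by rewrite -mkD //; apply: cmap_On => //; exact: fn_On.
Qed.
Lemma subM a b : sub y (a * b) = sub y a * sub y b.
Proof.
rewrite -[a in LHS]mkK -[b in LHS]mkK -mkM; try exact: fn_On.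
rewrite sub_mk; last by apply: On_mul; exact: fn_On.
by rewrite -mkM //; apply: cmap_On => //; exact: fn_On.
Qed.
Lemma sub_gC k : sub y (gC k) = gC k.
Proof. by rewrite /gC sub_mk //; exact: On_cst. Qed.
Lemma sub0 : sub y 0 = 0. Proof. by rewrite -[0](rmorph0 gC) sub_gC. Qed.
Lemma sub1 : sub y 1 = 1. Proof. by rewrite -[1](rmorph1 gC) sub_gC. Qed.
Lemma subN a : sub y (- a) = - sub y a.
Proof. by apply/eqP; rewrite -addr_eq0 addrC -subD subrr sub0. Qed.
Lemma subB a b : sub y (a - b) = sub y a - sub y b.
Proof. by rewrite subD subN. Qed.
Lemma sub_sum (I : Type) (r : seq I) (P : pred I) (F : I -> germ) :
  sub y (\sum_(e <- r | P e) F e) = \sum_(e <- r | P e) sub y (F e).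
Proof. by apply: (big_morph _ subD sub0). Qed.
Lemma subX a k : sub y (a ^+ k) = sub y a ^+ k.
Proof. by elim: k => [|k IH]; rewrite ?sub1 // !exprS subM IH. Qed.
Lemma sub_gX i : sub y (gX i) = mk (fun p => y p 0 i).
Proof. by rewrite /gX sub_mk //; exact: On_coord. Qed.
Lemma ev_sub a : ev (sub y a) = ev a.
Proof. by rewrite /ev (germ_eq0 (fn_sub a)) /=; case: cy => _ ->. Qed.
Lemma ordM_sub k a : ordM k a -> ordM k (sub y a).
Proof.
elim: k a => [|k IH] a ha; first exact: ordM0.
have [b -> hb] := hadamard ha; rewrite sub_sum; apply: ordM_sum => i _.
rewrite subM -add1n; apply: ordM_mul; last exact: IH.
by apply/ordM1P; rewrite ev_sub ev_gX.
Qed.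
End Sub.

Lemma sub_comp x y a : cmap x -> cmap y -> sub y (sub x a) = mk (fn a \o x \o y).
Proof. by move=> cx cy; rewrite [sub x a]/sub sub_mk //; apply: cmap_On => //; exact: fn_On. Qed.
Lemma subK x y a : cmap x -> cmap y -> (\forall q \near (0 : V), x (y q) = q) -> sub y (sub x a) = a.
Proof.
move=> cx cy h; rewrite sub_comp //; apply: mkE; move: h.
by apply: filterS => q /= ->.
Qed.

Lemma differentiable_lincomb (G : 'I_n -> C) (p : V) : differentiable (lincomb G) p.
Proof.
have [] // := @has_diffP R n (lincomb G) p G _.
move=> e e0; exists 1 => // u t _ t0 _.
by rewrite raddfD addrAC addrK subrr nrm0 mulr_ge0 // ltW.
Qed.
Lemma cmap_mulmx (A : 'M[C]_n) : cmap (fun q => q *m A).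
Proof.
split; last by rewrite mul0mx.
apply/near0; exists 1 => // p _; apply: differentiable_row => j.
rewrite (_ : (fun q : V => (q *m A) 0 j) = lincomb (fun i => A i j)); first exact: differentiable_lincomb.
by apply/funext => q; rewrite mxE.
Qed.

Lemma mdeg1 (s : {ffun 'I_n -> nat}) : mdeg s = 1%N -> exists i, s = munit i 1.
Proof.
move=> h; have [E|[i [t E]]] := mon_split s; first by move: h; rewrite E mdeg0.
exists i; move: h; rewrite E mdegD mdeg_unit addn1 => -[/mdeg_eq0 ->].
by rewrite maddC madd0.
Qed.
Lemma munit_inj i j : munit i 1 = munit j 1 -> i = j :> 'I_n.
Proof. by move=> /ffunP /(_ i); rewrite !ffunE eqxx; case: eqP. Qed.
Lemma cf_gX i s : cf (gX i) s = (s == munit i 1)%:R.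
Proof. by rewrite -gm_unit cf_gm. Qed.

(** Column j is the linear part of [ys j], in accordance with maps acting on row vectors. *)
Definition jac (ys : 'I_n -> germ) : 'M[C]_n := \matrix_(i, j) cf (ys j) (munit i 1).

(** Composing with the inverse [L] of the linear part leaves the identity plus terms of order 2, the
    case of [local_inverse]. *)
Lemma germ_coords (ys : 'I_n -> germ) : (forall j, ev (ys j) = 0) -> jac ys \in unitmx ->
  exists x y : V -> V, [/\ cmap x, cmap y, \forall p \near (0 : V), y (x p) = p,
     \forall q \near (0 : V), x (y q) = q & forall j, mk (fun p => x p 0 j) = ys j].
Proof.
move=> y0 uJ; set J := jac ys in uJ; pose L := invmx J.
pose psi j := \sum_k gC (L k j) * ys k - gX j.
have psi2 j : ordM 2 (psi j).
  move=> s; rewrite /psi cf_sub cf_sum; under eq_bigr do rewrite cf_gCM.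
  rewrite ltnS leq_eqVlt ltnS leqn0 => /orP[/eqP /mdeg1 [i ->]|/eqP /mdeg_eq0 ->]; last first.
    rewrite -ev_cf ev_gX subr0 big1 // => k _.
    by rewrite -ev_cf y0 mulr0.
  have := congr1 (fun A : 'M[C]_n => A i j) (mulmxV uJ); rewrite /= mxE => E.
  have -> : \sum_(k < n) L k j * cf (ys k) (munit i 1) = \sum_k J i k * L k j.
    by apply: eq_bigr => k _; rewrite /J /jac mxE mulrC.
  rewrite E cf_gX mxE; have [->|ij] := eqVneq i j; first by rewrite eqxx subrr.
  by case: eqP => [/munit_inj E'|_]; [rewrite E' eqxx in ij | rewrite subrr].
have [y' [dy' y'0 h1 h2]] := local_inverse psi2.
set Psi := fun p : V => \row_j fn (psi j) p in h1 h2.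
pose x p : V := \row_j fn (ys j) p.
have hx : \forall p \near (0 : V), x p *m L = p + Psi p.
  have : \forall p \near (0 : V), forall j, fn (psi j) p = \sum_k L k j * fn (ys k) p - p 0 j.
    apply: (@filter_forall _ 'I_n (fun j p => fn (psi j) p = \sum_k L k j * fn (ys k) p - p 0 j)
       (nbhs (0 : V)) _) => j.
    have hs : germ_eq (fn (\sum_k gC (L k j) * ys k)) (fun p => \sum_k L k j * fn (ys k) p).
      by apply: fn_sum => k; exact: fn_gCM.
    move: (fnD (\sum_k gC (L k j) * ys k) (- gX j)) hs (fnN (gX j)) (fn_gX R j).
    by apply: filterS4 => p -> -> -> ->.
  apply: filterS => p hp; apply/rowP => j; rewrite !mxE hp addrC subrK.
  by apply: eq_bigr => k _; rewrite mxE mulrC.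
have cx : cmap x.
  split; last by apply/rowP => j; rewrite !mxE; exact: y0.
  have : \forall p \near (0 : V), forall j, differentiable (fn (ys j)) p.
    by apply: (@filter_forall _ 'I_n (fun j p => differentiable (fn (ys j)) p) (nbhs (0 : V)) _) => j; exact: fn_On.
  apply: filterS => p hp; apply: differentiable_row => j.
  by under eq_fun do rewrite mxE; exact: hp.
have cy' : cmap y' by [].
exists x, (y' \o (fun q => q *m L)); split => //.
- by apply: cmap_comp => //; exact: cmap_mulmx.
- by move: hx h1; apply: filterS2 => p /= ->.
- have [c1 c2] := cmap_comp cy' (cmap_mulmx L).
  have [c3 c4] := cmap_mulmx L.
  move: (comp_near c1 c2 hx) (comp_near c3 c4 h2); apply: filterS2 => q /= e1 e2.
  by rewrite -[LHS](mulmxKV uJ) e1 e2 mulmxKV.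
- by move=> j; rewrite -[RHS]mkK; congr mk; apply/funext => p; rewrite mxE.
Qed.

(** Bridge between vector fields and derivations of germs; with [gderE] it identifies logarithmic
    fields with derivations preserving the ideal of X. *)
Lemma fn_derivation (v : V -> V) (f : V -> C) : vector_fields v -> On f ->
  germ_eq (derivation v f) (fn (dv (fun i => mk (fun p => v p 0 i)) (mk f))).
Proof.
move=> dv_ hf.
have hv i : On (fun p => v p 0 i) by move: dv_; apply: filterS => p; exact: differentiable_coordinate.
have hs : germ_eq (fn (dv (fun i => mk (fun p => v p 0 i)) (mk f)))
   (fun p => \sum_i v p 0 i * fn (gd i (mk f)) p).
  apply: fn_sum => i; move: (fnM (mk (fun p => v p 0 i)) (gd i (mk f))) (fn_mk (hv i)).
  by apply: filterS2 => p -> ->.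
apply: germ_eq_trans (germ_eq_sym hs).
apply: germ_eq_trans (germ_eq_derive (fn_mk hf) v) _.
by move: (fn_derive (mk f)); apply: filterS => p [_ ->].
Qed.
End Substitution.

(** * Generalized eigenvectors of a derivation modulo a subspace *)

Section GeneralizedEigen.
Variables (R : realType) (n : nat).
Local Notation C := (CC R).
Local Notation germ := (germ R n).
Local Notation gX := (gX R).
Local Notation gC := (gC n).
Local Notation mon := {ffun 'I_n -> nat}.
Implicit Types (a b g : germ) (mu nu : C) (s : mon).

Definition gsubspace (S : germ -> Prop) :=
  [/\ S 0, forall a b, S a -> S b -> S (a + b) & forall k a, S a -> S (gC k * a)].
Definition gideal (S : germ -> Prop) :=
  [/\ S 0, forall a b, S a -> S b -> S (a + b) & forall a b, S b -> S (a * b)].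

Lemma gideal_subspace S : gideal S -> gsubspace S.
Proof. by move=> [h0 hD hM]; split => // k a; exact: hM. Qed.
Lemma subspaceN S a : gsubspace S -> S a -> S (- a).
Proof. by move=> [_ _ hZ] /(hZ (-1)); rewrite rmorphN rmorph1 mulN1r. Qed.
Lemma subspaceB S a b : gsubspace S -> S a -> S b -> S (a - b).
Proof. by move=> hS ha hb; case: (hS) => _ hD _; apply: hD => //; exact: subspaceN. Qed.
Lemma subspace_sum S (I : Type) (r : seq I) (P : pred I) (F : I -> germ) : gsubspace S ->
  (forall e, P e -> S (F e)) -> S (\sum_(e <- r | P e) F e).
Proof. by move=> [h0 hD _] h; elim/big_ind: _ => //; exact: hD. Qed.
Lemma gideal_ordM k : gideal (@ordM R n k).
Proof. by split; [exact: ordM_zero | move=> a b; exact: ordMD | move=> a b; exact: ordM_mulr]. Qed.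

Variable T : germ -> germ.
Hypothesis dT : gderivation T.

Definition Tm mu a := T a - gC mu * a.
Definition itT mu N a := iter N (Tm mu) a.

Lemma TmD mu a b : Tm mu (a + b) = Tm mu a + Tm mu b.
Proof. by rewrite /Tm (gderD dT); ring. Qed.
Lemma TmZ mu k a : Tm mu (gC k * a) = gC k * Tm mu a.
Proof. by rewrite /Tm (gderZ dT); ring. Qed.
Lemma TmB mu a b : Tm mu (a - b) = Tm mu a - Tm mu b.
Proof. by rewrite /Tm (gderB dT); ring. Qed.
Lemma Tm0 mu : Tm mu 0 = 0.
Proof. by rewrite /Tm (gder0 dT) mulr0 subrr. Qed.
Lemma TmC mu nu a : Tm mu (Tm nu a) = Tm nu (Tm mu a).
Proof.
have E k l : Tm k (Tm l a) = T (T a) - (gC k + gC l) * T a + gC k * gC l * a.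
  by rewrite [Tm l a]/Tm TmB TmZ /Tm; ring.
by rewrite !E; ring.
Qed.
Lemma Tm_diff mu nu a : Tm mu a = Tm nu a + gC (nu - mu) * a.
Proof. by rewrite /Tm rmorphB /=; ring. Qed.
Lemma TmM mu nu a b : Tm (mu + nu) (a * b) = Tm mu a * b + a * Tm nu b.
Proof. by rewrite /Tm (gderM dT) rmorphD /=; ring. Qed.
Lemma TmE mu a : Tm mu a = T a - gC mu * a. Proof. by []. Qed.
Opaque Tm.
Lemma itTS mu N a : itT mu N.+1 a = Tm mu (itT mu N a). Proof. by []. Qed.
Lemma itTSr mu N a : itT mu N.+1 a = itT mu N (Tm mu a). Proof. by rewrite /itT iterSr. Qed.
Lemma itT_add mu N M a : itT mu (N + M) a = itT mu N (itT mu M a).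
Proof. by rewrite /itT iterD. Qed.
Lemma itTD mu N a b : itT mu N (a + b) = itT mu N a + itT mu N b.
Proof. by elim: N => [|N IH]; [reflexivity | rewrite !itTS IH TmD]. Qed.
Lemma itTB mu N a b : itT mu N (a - b) = itT mu N a - itT mu N b.
Proof. by apply/eqP; rewrite eq_sym subr_eq -itTD subrK. Qed.
Lemma itTZ mu N k a : itT mu N (gC k * a) = gC k * itT mu N a.
Proof. by elim: N => [|N IH]; [reflexivity | rewrite !itTS IH TmZ]. Qed.
Lemma itT0 mu N : itT mu N 0 = 0.
Proof. by elim: N => [|N IH]; [reflexivity | rewrite itTS IH Tm0]. Qed.
Lemma itT_sum mu N (I : Type) (r : seq I) (F : I -> germ) :
  itT mu N (\sum_(e <- r) F e) = \sum_(e <- r) itT mu N (F e).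
Proof. by apply: (big_morph _ (itTD mu N) (itT0 mu N)). Qed.
Lemma itT_Tm mu nu N a : itT mu N (Tm nu a) = Tm nu (itT mu N a).
Proof. by elim: N => [|N IH]; [reflexivity | rewrite !itTS IH (TmC mu nu)]. Qed.
Lemma itT_itT mu nu N M a : itT mu N (itT nu M a) = itT nu M (itT mu N a).
Proof. by elim: M => [|M IH]; [reflexivity | rewrite !itTS itT_Tm IH]. Qed.

Section Subspace.
Variable S : germ -> Prop.
Hypotheses (sS : gsubspace S) (TS : forall a, S a -> S (T a)).
Let S0 : S 0. Proof. by case: sS. Qed.
Let SD a b : S a -> S b -> S (a + b). Proof. by case: sS => _ h _; exact: h. Qed.
Let SZ k a : S a -> S (gC k * a). Proof. by case: sS => _ _ h; exact: h. Qed.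
Let SB a b : S a -> S b -> S (a - b). Proof. exact: subspaceB. Qed.

Lemma S_Tm mu a : S a -> S (Tm mu a).
Proof. by move=> h; rewrite TmE; apply: SB; [exact: TS | exact: SZ]. Qed.
Lemma S_itT mu N a : S a -> S (itT mu N a).
Proof. by move=> h; elim: N => // N IH; rewrite itTS; exact: S_Tm. Qed.

(** Generalized eigenvectors of T in the quotient by S. The quotient is not formed: S is a power of
    m, a larger subspace, or 0, carried as a predicate. *)
Definition gev mu a := exists N, S (itT mu N a).

Lemma gev_S mu a : S a -> gev mu a. Proof. by exists 0%N. Qed.
Lemma gev_Tm mu a : gev mu (Tm mu a) -> gev mu a.
Proof. by move=> [N h]; exists N.+1; rewrite itTSr. Qed.
Lemma gevD mu a b : gev mu a -> gev mu b -> gev mu (a + b).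
Proof.
move=> [N h1] [M h2]; exists (N + M)%N; rewrite itTD; apply: SD.
  by rewrite addnC itT_add; exact: S_itT.
by rewrite itT_add; exact: S_itT.
Qed.
Lemma gevZ mu k a : gev mu a -> gev mu (gC k * a).
Proof. by move=> [N h]; exists N; rewrite itTZ; exact: SZ. Qed.
Lemma gevB mu a b : gev mu a -> gev mu b -> gev mu (a - b).
Proof. by move=> ha hb; apply: gevD => //; rewrite -mulN1r -(rmorph1 gC) -rmorphN; exact: gevZ. Qed.
Lemma gev_sum mu (I : Type) (r : seq I) (P : pred I) (F : I -> germ) :
  (forall e, P e -> gev mu (F e)) -> gev mu (\sum_(e <- r | P e) F e).
Proof. by move=> h; elim/big_ind: _ => //; [exact: gev_S | exact: gevD]. Qed.
Lemma gev_itT mu nu N a : gev mu a -> gev mu (itT nu N a).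
Proof. by move=> [M h]; exists M; rewrite itT_itT; exact: S_itT. Qed.

(** Induction on N + M: [Tm mu a] and [Tm nu a] lie in S, and their difference is a nonzero multiple
    of a. *)
Lemma gev_coprime mu nu a N M : mu != nu -> S (itT mu N a) -> S (itT nu M a) -> S a.
Proof.
move=> mn; have [k] := ubnP (N + M); elim: k N M a => // k IH [|N] [|M] a //.
rewrite ltnS => hk h1 h2.
have k1 : S (Tm mu a).
  apply: (IH N M.+1); first by move: hk; rewrite addSn.
  - by rewrite -itTSr.
  - by rewrite itT_Tm; exact: S_Tm.
have k2 : S (Tm nu a).
  apply: (IH N.+1 M); first by move: hk; rewrite addnS.
  - by rewrite itT_Tm; exact: S_Tm.
  - by rewrite -itTSr.
have -> : a = gC (nu - mu)^-1 * (Tm mu a - Tm nu a).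
  rewrite (Tm_diff mu nu a) [_ - Tm nu a]addrAC subrr add0r mulrA -rmorphM mulVf ?rmorph1 ?mul1r //.
  by rewrite subr_eq0 eq_sym.
by apply: SZ; exact: SB.
Qed.

(** Applying [itT nu N] sends the summand of eigenvalue nu into S and keeps the others generalized
    eigenvectors; [gev_coprime] then removes the operator. *)
Lemma gev_indep (rs : seq C) (h : C -> germ) : uniq rs ->
  (forall mu, mu \in rs -> gev mu (h mu)) -> S (\sum_(mu <- rs) h mu) ->
  forall mu, mu \in rs -> S (h mu).
Proof.
elim: rs h => [|nu rs IH] h //= /andP[nurs urs] hg; rewrite big_cons => hs.
have [N hN] := hg nu (mem_head _ _).
have hr mu : mu \in rs -> S (h mu).
  move=> mur; have [M hM] := hg mu (mem_behead (s := nu :: rs) mur).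
  apply: (@gev_coprime nu mu _ N M) => //; first by apply: contraNneq nurs => ->.
  apply: (IH (fun mu => itT nu N (h mu)) urs) mur => [mu' mur|].
    by apply/gev_itT/hg; rewrite inE mur orbT.
  rewrite -itT_sum; have -> : \sum_(mu0 <- rs) h mu0 = (h nu + \sum_(mu0 <- rs) h mu0) - h nu.
    by rewrite addrC addKr.
  by rewrite itTB; apply: SB => //; exact: S_itT.
move=> mu; rewrite inE => /orP[/eqP ->|]; last exact: hr.
have -> : h nu = (h nu + \sum_(mu0 <- rs) h mu0) - \sum_(mu0 <- rs) h mu0 by rewrite addrK.
by apply: SB => //; rewrite big_seq; apply: subspace_sum.
Qed.

Variable Q : germ -> Prop.
Hypotheses (sQ : gsubspace Q) (TQ : forall a, Q a -> Q (T a)).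

(** On the part of eigenvalue mu, T - nu is the nonzero scalar mu - nu plus the nilpotent T - mu;
    the inverse is built by recursion on the nilpotency exponent. *)
Lemma gev_inv mu nu b : mu != nu -> gev mu b -> Q b ->
  exists a, [/\ gev mu a, Q a & S (Tm nu a - b)].
Proof.
move=> mn [N]; have [q0 qD qZ] := sQ.
elim: N b => [|N IH] b h qb.
  exists 0; split => //; first exact: gev_S.
  by rewrite Tm0; apply: SB.
have qTb : Q (Tm mu b) by rewrite TmE; apply: subspaceB => //; [exact: TQ | exact: qZ].
have hb : S (itT mu N (Tm mu b)) by rewrite -itTSr.
have [a [h1 h2 h3]] := IH (Tm mu b) hb qTb.
exists (gC (mu - nu)^-1 * (b - a)); split.
- by apply/gevZ/gevB => //; exists N.+1.
- by apply: qZ; exact: subspaceB.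
- have mn0 : mu - nu != 0 by rewrite subr_eq0.
  have -> : Tm nu (gC (mu - nu)^-1 * (b - a)) - b = gC (- (mu - nu)^-1) * (Tm nu a - Tm mu b).
    rewrite TmZ TmB (Tm_diff nu mu b).
    have E : gC (mu - nu)^-1 * gC (mu - nu) = 1 by rewrite -rmorphM mulVf // rmorph1.
    set G := gC _ in E *; set H := gC (mu - nu) in E *; rewrite rmorphN /= -/G.
    transitivity (- G * (Tm nu a - Tm mu b) + (G * H - 1) * b); first by ring.
    by rewrite E subrr mul0r addr0.
  exact: SZ.
Qed.

(** The second subspace Q keeps the components inside the maximal ideal when the coordinates are
    decomposed. *)
Definition decomposed (rs : seq C) a := exists b : C -> germ,
  a = \sum_(mu <- rs) b mu /\ forall mu, gev mu (b mu) /\ Q (b mu).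

(** The components of (T - nu) a away from nu are lifted by [gev_inv]. What remains of a is sent by
    T - nu to the nu-component modulo S, hence is itself of eigenvalue nu. *)
Lemma decomposed_step (rs : seq C) nu a : uniq rs -> nu \in rs -> Q a ->
  decomposed rs (Tm nu a) -> decomposed rs a.
Proof.
move=> urs nurs qa [b [hb hg]].
have /choice [c hc] : forall mu, exists c, mu != nu -> [/\ gev mu c, Q c & S (Tm nu c - b mu)].
  move=> mu; have [->|mn] := eqVneq mu nu; first by exists 0.
  by have [c hc] := gev_inv mn (hg mu).1 (hg mu).2; exists c.
pose c0 := a - \sum_(mu <- rs | mu != nu) c mu.
have [q0 qD qZ] := sQ.
have qc0 : Q c0.
  apply: subspaceB => //; apply: subspace_sum => // mu mn; by case: (hc mu mn).
have gc0 : gev nu c0.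
  apply: gev_Tm; rewrite /c0 TmB hb (bigD1_seq nu) //=.
  rewrite (big_morph _ (TmD nu) (Tm0 nu)) -addrA -sumrB; apply: gevD; first by case: (hg nu).
  apply: gev_S; apply: subspace_sum => // mu mn.
  by rewrite -opprB; apply: subspaceN => //; case: (hc mu mn).
exists (fun mu => if mu == nu then c0 else if mu \in rs then c mu else 0); split.
  rewrite (bigD1_seq nu) //= eqxx /c0 -addrA -[LHS]addr0; congr (_ + _).
  rewrite addrC; apply/esym/eqP; rewrite subr_eq0; apply/eqP.
  rewrite big_seq_cond [in RHS]big_seq_cond; apply: eq_bigr => mu /andP[-> /negPf ->] //.
move=> mu; case: eqP => [->|/eqP mn]; first by split.
case: ifP => _; last by split => //; exact: gev_S.
by case: (hc mu mn).
Qed.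

(** Primary decomposition without dimensions: a product of factors T - mu annihilates a modulo S,
    and the innermost factor is peeled off at each step. *)
Lemma decomposed_all (rs r : seq C) a : uniq rs -> (0 < size rs)%N -> {subset r <= rs} -> Q a ->
  S (foldr Tm a r) -> decomposed rs a.
Proof.
move=> urs rs0; have [q0 qD qZ] := sQ.
elim/last_ind: r a => [|r nu IH] a hr qa.
  move=> /= Sa; case: rs urs rs0 {hr} => // nu rs /= /andP[nurs urs] _.
  exists (fun mu => if mu == nu then a else 0); split.
    rewrite big_cons eqxx big_seq big1 ?addr0 // => mu mur.
    by case: eqP => // E; move: nurs; rewrite -E mur.
  by move=> mu; case: eqP => // _; split => //; exact: gev_S.
rewrite -cats1 foldr_cat /= => h; apply: (@decomposed_step rs nu) => //.
  by apply: hr; rewrite mem_rcons mem_head.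
apply: IH => //; first by move=> mu mur; apply: hr; rewrite mem_rcons inE mur orbT.
by rewrite TmE; apply: subspaceB => //; [exact: TQ | exact: qZ].
Qed.
End Subspace.

Section Ideal.
Variable S : germ -> Prop.
Hypotheses (iS : gideal S) (TS : forall a, S a -> S (T a)).
Let sS := gideal_subspace iS.

(** Leibniz: T - mu - nu acts on a product as T - mu on one factor plus T - nu on the other, so the
    exponents N + M decrease. *)
Lemma gevM mu nu a b : gev S mu a -> gev S nu b -> gev S (mu + nu) (a * b).
Proof.
move=> [N +] [M +]; have [k] := ubnP (N + M); case: (iS) => _ _ hM.
elim: k N M a b => // k IH [|N] [|M] a b hk h1 h2.
- by apply: gev_S; exact: hM.
- by apply: gev_S; rewrite mulrC; exact: hM.
- by apply: gev_S; exact: hM.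
apply: gev_Tm; rewrite TmM; apply: gevD => //.
  by apply: (IH N M.+1) => //; rewrite -itTSr.
by apply: (IH N.+1 M) => //; [move: hk; rewrite addnS ltnS | rewrite -itTSr].
Qed.
Lemma gev1 : gev S 0 1.
Proof. by exists 1%N; rewrite itTS /itT /= TmE (gder1 dT) rmorph0 mul0r subrr; case: iS. Qed.

Definition wt (lam : 'I_n -> C) s : C := \sum_i lam i * (s i)%:R.
Lemma wt_add lam s t : wt lam (madd s t) = wt lam s + wt lam t.
Proof. by rewrite /wt -big_split; apply: eq_bigr => i _; rewrite ffunE natrD mulrDr. Qed.
Lemma wt0 lam : wt lam (mon0 n) = 0.
Proof. by rewrite /wt big1 // => i _; rewrite ffunE mulr0. Qed.
Lemma wt_unit lam i k : wt lam (munit i k) = lam i * k%:R.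
Proof.
rewrite /wt (bigD1 i) //= ffunE eqxx big1 ?addr0 // => j ji.
by rewrite ffunE (negPf ji) mulr0.
Qed.
Lemma gev_gm (lam : 'I_n -> C) s : (forall j, gev S (lam j) (gX j)) -> gev S (wt lam s) (gm R s).
Proof.
move=> h; elim/mon_ind: s => [|i s IH]; first by rewrite wt0 gm0; exact: gev1.
by rewrite wt_add wt_unit mulr1 gm_add gm_unit; exact: gevM.
Qed.
End Ideal.
End GeneralizedEigen.

(** * Rationality and bounds of the weights *)

Section RationalWeights.

(** The maximum M of the |e i| satisfies M <= M / 2. *)
Lemma contraction_zero (F : realFieldType) n (e : 'I_n -> F) (j : 'I_n -> 'I_n) :
  (forall i, `|e i| <= `|e (j i)| / 2) -> forall i, e i = 0.
Proof.
move=> h i; pose M := \big[Num.max/0]_l `|e l|.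
have hM l : `|e l| <= M by exact: le_bigmax.
have M2 : M <= M / 2.
  apply: bigmax_le; first by have := le_trans (normr_ge0 _) (hM i); lra.
  by move=> l _; apply: (le_trans (h l)); have := hM (j l); lra.
have M0 : M <= 0 by lra.
by apply/eqP; rewrite -normr_le0; apply: le_trans (hM i) M0.
Qed.

(** The matrix of the system is rational, and injective because k_i >= 2 makes the homogeneous
    system contracting. The rational solution equals the given complex one by the same
    contraction. *)
Lemma rational_weights (R : realType) n (k : 'I_n -> nat) (j : 'I_n -> 'I_n) (lam : 'I_n -> CC R) (d : nat) :
  (forall i, (2 <= k i <= d)%N) -> (forall i, lam i * (k i)%:R + lam (j i) = 1) ->
  exists q : 'I_n -> rat, (forall i, lam i = ratr (q i)) /\
    forall i, 0 < q i < 1 / 2 /\ 1 <= q i * (2 * d)%:R.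
Proof.
move=> hk hlam; have k2 i : (2 <= k i)%N by case/andP: (hk i).
have k2R (F : realFieldType) i : 2 <= (k i)%:R :> F by rewrite ler_nat.
pose A : 'M[rat]_n := \matrix_(i, l) ((l == i)%:R * (k i)%:R + (l == j i)%:R).
have rowA (v : 'I_n -> rat) i : \sum_l A i l * v l = (k i)%:R * v i + v (j i).
  have E (m : 'I_n) (c : rat) : \sum_l ((l == m)%:R * c) * v l = c * v m.
    rewrite (bigD1 m) //= eqxx mul1r big1 ?addr0 // => l lm.
    by rewrite (negPf lm) !mul0r.
  under eq_bigr do rewrite mxE mulrDl; rewrite big_split /= E; congr (_ + _).
  by rewrite -[RHS]mul1r -(E (j i) 1); apply: eq_bigr => l _; rewrite mulr1.
have kz (F : realFieldType) (a b : F) i : (k i)%:R * a + b = 0 -> `|a| <= `|b| / 2.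
  move=> /eqP; rewrite addr_eq0 => /eqP h.
  have -> : `|b| = (k i)%:R * `|a| by rewrite -[b]opprK -h normrN normrM normr_nat.
  by have := ler_wpM2r (normr_ge0 a) (k2R F i); lra.
have uA : A \in unitmx.
  rewrite -unitmx_tr -row_free_unit -kermx_eq0; apply/eqP/row_matrixP => r; rewrite row0.
  set v := row r _; have v0 : v *m A^T = 0 by rewrite /v -row_mul mulmx_ker row0.
  apply/rowP => i; rewrite [RHS]mxE.
  apply: (@contraction_zero _ _ (fun i => v 0 i) j) => l; apply: (kz _ _ _ l).
  have := congr1 (fun B : 'rV[rat]_n => B 0 l) v0; rewrite /= mxE [RHS]mxE => <-.
  rewrite -(rowA (fun i => v 0 i)); apply: eq_bigr => m _; by rewrite [A^T m l]mxE mulrC.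
pose q i := (invmx A *m (const_mx 1 : 'cV_n)) i 0.
have hq i : (k i)%:R * q i + q (j i) = 1.
  rewrite -rowA; have := congr1 (fun B : 'cV[rat]_n => B i 0) (mulKVmx uA (const_mx 1 : 'cV_n)).
  by rewrite /= mxE [RHS]mxE => <-.
have eq_q i : q i * (k i)%:R = 1 - q (j i).
  by apply/eqP; rewrite eq_sym subr_eq mulrC; apply/eqP/esym/hq.
(* From k_l |q_l| = |1 - q_(j l)| <= 1 + M and k_l >= 2 follows M <= (1 + M) / 2. Then q_i k_i = 1 -
   q_(j i) >= 0 gives the signs. *)
have b1 i : `|q i| <= 1.
  pose M := \big[Num.max/0]_l `|q l|.
  have hM l : `|q l| <= M by exact: le_bigmax.
  have M0 : 0 <= M := le_trans (normr_ge0 _) (hM i).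
  have M2 : M <= (1 + M) / 2.
    apply: bigmax_le => [|l _]; first by lra.
    have E : (k l)%:R * `|q l| = `|1 - q (j l)| by rewrite -eq_q normrM normr_nat mulrC.
    have := hM (j l); have := ler_normB 1 (q (j l)); rewrite normr1 -E.
    by have := ler_wpM2r (normr_ge0 (q l)) (k2R _ l); lra.
  by apply: (le_trans (hM i)); lra.

have q0 i : 0 <= q i.
  have := b1 (j i); rewrite ler_norml => /andP[_ h].
  have : 0 <= q i * (k i)%:R by rewrite eq_q; lra.
  by rewrite pmulr_lge0 // ltr0n; apply: leq_trans (k2 i).
have qh i : q i <= 1 / 2.
  have := ler_wpM2l (q0 i) (k2R _ i); rewrite eq_q; have := q0 (j i); lra.
(* As q_(j i) <= 1 / 2, also q_i k_i >= 1 / 2. This uniform lower bound is what later excludes small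
   divisors. *)
have qd i : 1 <= q i * (2 * d)%:R.
  have kd : (k i)%:R <= d%:R :> rat by rewrite ler_nat; case/andP: (hk i).
  have := ler_wpM2l (q0 i) kd; rewrite eq_q natrM mulrCA; have := qh (j i); lra.
have qp i : 0 < q i.
  by rewrite lt_def q0 andbT; apply/eqP => E; have := qd i; rewrite E mul0r; lra.
exists q; split => [i|i]; last first.
  split => //; rewrite qp /=; have := ler_wpM2l (q0 i) (k2R _ i); rewrite eq_q; have := qp (j i); lra.
apply/eqP; rewrite -subr_eq0; apply/eqP/nrm_eq0.
apply: (@contraction_zero _ _ (fun i => nrm (lam i - ratr (q i))) j) => l.
rewrite !ger0_norm ?nrm_ge0 //.
have E : (k l)%:R * (lam l - ratr (q l)) = - (lam (j l) - ratr (q (j l))).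
  have h1 := hlam l; have h2 : (k l)%:R * ratr (q l) + ratr (q (j l)) = 1 :> CC R.
    by rewrite -(ratr_nat (CC R)) -rmorphM -rmorphD hq rmorph1.
  apply/eqP; rewrite -addr_eq0; apply/eqP.
  transitivity ((lam l * (k l)%:R + lam (j l)) - ((k l)%:R * ratr (q l) + ratr (q (j l)))); first by ring.
  by rewrite h1 h2 subrr.
have := congr1 (@nrm R) E; rewrite nrmM nrmN nrm_nat => <-.
have := ler_wpM2r (nrm_ge0 (lam l - ratr (q l))) (k2R R l); lra.
Qed.
End RationalWeights.

(** * Eigencoordinates modulo a power of m and the weights of monomials *)

Section EigenCoordinates.
Variables (R : realType) (n : nat).
Local Notation C := (CC R).
Local Notation germ := (germ R n).
Local Notation gX := (gX R).
Local Notation gC := (gC n).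
Local Notation mon := {ffun 'I_n -> nat}.
Local Notation gm := (gm R).
Implicit Types (a b : germ) (mu nu : C) (s : mon).

Variable T : germ -> germ.
Hypotheses (dT : gderivation T) (T0 : forall i, ev (T (gX i)) = 0).

(** Each T x_i lies in m, so in the Leibniz rule the variable that is differentiated away is
    replaced by an element of m. *)
Lemma T_ordM k a : ordM k a -> ordM k (T a).
Proof.
elim: k a => [|k IH] a ha; first exact: ordM0.
have [b -> hb] := hadamard ha; rewrite (gder_sum dT); apply: ordM_sum => i _.
rewrite (gderM dT); apply: ordMD; last by apply: ordM_gX; exact: IH.
by rewrite -add1n; apply: ordM_mul => //; apply/ordM1P.
Qed.

(** Cayley-Hamilton for the matrix of T on jets modulo m^K, written as rows indexed by [mons n K];
    the list consists of the roots of its characteristic polynomial. *)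
Lemma annihilating_list K : (0 < K)%N -> exists r : seq C, forall a, ordM K (foldr (Tm T) a r).
Proof.
move=> K0; have [N' HN] : exists N', size (mons n K) = N'.+1.
  exists (size (mons n K)).-1; rewrite prednK // lt0n size_eq0.
  by apply/eqP => E; have := mem_mons K (mon0 n); rewrite E mdeg0 K0.
pose m (k : 'I_N'.+1) := nth (mon0 n) (mons n K) k.
have sumE (F : mon -> C) : \sum_(s <- mons n K) F s = \sum_k F (m k).
  by rewrite (big_nth (mon0 n)) HN big_mkord.
have mP k : (mdeg (m k) < K)%N by rewrite -mem_mons mem_nth // HN.
have mE s : (mdeg s < K)%N -> exists k, s = m k.
  rewrite -mem_mons => hs; have hi : (index s (mons n K) < N'.+1)%N by rewrite -HN index_mem.
  by exists (Ordinal hi); rewrite /m nth_index.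
pose phi a : 'rV[C]_N'.+1 := \row_k cf a (m k).
pose A : 'M[C]_N'.+1 := \matrix_(k, l) cf (T (gm (m k))) (m l).
have phiT a : phi (T a) = phi a *m A.
  apply/rowP => l; rewrite !mxE.
  have -> : T a = T (trunc K a) + T (a - trunc K a) by rewrite -(gderD dT) addrC subrK.
  rewrite cf_add (T_ordM (@truncP _ _ K a)) // addr0 /trunc (gder_sum dT) cf_sum sumE.
  by apply: eq_bigr => k _; rewrite (gderZ dT) cf_gCM !mxE.
have phiTm mu a : phi (Tm T mu a) = phi a *m (A - mu%:M).
  rewrite mulmxBr -phiT; apply/rowP => l; rewrite TmE mul_mx_scalar !mxE cf_sub cf_gCM //.
have [r hr] := closed_field_poly_normal (char_poly A).
exists r => a.
have key (r' : seq C) b : phi (foldr (Tm T) b r') = phi b *m horner_mx A (\prod_(z <- r') ('X - z%:P)).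
  elim: r' => [|z r' IH] /=; first by rewrite big_nil rmorph1 mulmx1.
  rewrite phiTm IH big_cons mulrC rmorphM /= mulmxA rmorphB /= horner_mx_X horner_mx_C.
  by [].
have E : phi (foldr (Tm T) a r) = 0.
  rewrite key; have := Cayley_Hamilton A; rewrite hr (monicP (char_poly_monic A)) scale1r => ->.
  by rewrite mulmx0.
move=> s /mE [k ->]; have := congr1 (fun v : 'rV[C]_N'.+1 => v 0 k) E; by rewrite !mxE.
Qed.

(** The eigencomponents of the x_j have linear parts spanning the cotangent space, so n of them can
    be selected as coordinates. *)
Lemma eigen_coords K : (0 < K)%N -> exists (ys : 'I_n -> germ) (lam : 'I_n -> C),
  [/\ forall j, ev (ys j) = 0, jac ys \in unitmx & forall j, gev T (@ordM R n K) (lam j) (ys j)].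
Proof.
move=> K0; have [r hr] := annihilating_list K0.
have sS := gideal_subspace (@gideal_ordM R n K).
have sQ := gideal_subspace (@gideal_ordM R n 1).
(* Adding 0 makes the list nonempty, as [decomposed_all] requires. *)
pose rs := undup (0 :: r); have urs : uniq rs := undup_uniq _.
have rs0 : (0 < size rs)%N by have : 0 \in rs; [rewrite mem_undup mem_head | case: (rs)].
have rsub : {subset r <= rs} by move=> z zr; rewrite mem_undup inE zr orbT.

have /choice [b hb] : forall j, exists b : C -> germ, gX j = \sum_(mu <- rs) b mu /\
    forall mu, gev T (@ordM R n K) mu (b mu) /\ ordM 1 (b mu).
  move=> j; have [b [h1 h2]] := decomposed_all dT sS (@T_ordM K) sQ (@T_ordM 1) urs rs0 rsub (ordM1_gX R j) (hr _).
  by exists b.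
pose P := ('I_n * 'I_(size rs))%type.
pose y (p : P) := b p.1 rs`_p.2.
pose B : 'M[C]_(#|{: P}|, n) := \matrix_(p, i) cf (y (enum_val p)) (munit i 1).
have fB : row_full B.
  rewrite -sub1mx; apply/row_subP => j.
  have -> : row j 1%:M = \sum_(k < size rs) row (enum_rank (j, k)) B.
    apply/rowP => i; rewrite summxE !mxE.
    transitivity (cf (gX j) (munit i 1)).
      by rewrite cf_gX; congr (nat_of_bool _)%:R; apply/eqP/eqP => [->|/munit_inj ->].
    rewrite (hb j).1 cf_sum (big_nth 0) big_mkord; apply: eq_bigr => k _.
    by rewrite !mxE enum_rankK.
  by apply: summx_sub => k _; exact: row_sub.
pose f := fullrankfun fB.
exists (fun j => y (enum_val (f j))), (fun j => rs`_(enum_val (f j)).2); split.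
- by move=> j; apply/ordM1P; case: ((hb (enum_val (f j)).1).2 rs`_(enum_val (f j)).2).
- rewrite -unitmx_tr (_ : (jac _)^T = rowsub f B) ?fullrowsub_unit //.
  by apply/matrixP => j i; rewrite !mxE.
- by move=> j; case: ((hb (enum_val (f j)).1).2 rs`_(enum_val (f j)).2).
Qed.

Section Components.
Variables (K : nat) (lam : 'I_n -> C).
Hypothesis hX : forall j, gev T (@ordM R n K) (lam j) (gX j).
Let S := @ordM R n K.

Definition wpart nu a : germ := \sum_(s <- mons n K | wt lam s == nu) gC (cf a s) * gm s.

Lemma gev_wpart nu a : gev T S nu (wpart nu a).
Proof.
have sS := gideal_subspace (@gideal_ordM R n K).
apply: (gev_sum dT sS (@T_ordM K)) => s /eqP <-; apply: (gevZ dT sS).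
exact: (gev_gm dT (@gideal_ordM R n K) (@T_ordM K)).
Qed.

Lemma cf_wpart nu a s : (mdeg s < K)%N -> cf (wpart nu a) s = if wt lam s == nu then cf a s else 0.
Proof.
move=> hs; rewrite /wpart -big_filter cf_lin; last by apply/filter_uniq/mons_uniq.
by rewrite mem_filter mem_mons hs andbT.
Qed.

(** The weighted parts add up to a modulo m^K, hence to an element of J; being generalized
    eigenvectors of distinct eigenvalues, they are independent modulo J. *)
Lemma wpart_mem (J : germ -> Prop) nu a : gsubspace J -> (forall a, J a -> J (T a)) ->
  (forall a, S a -> J a) -> J a -> J (wpart nu a).
Proof.
move=> sJ TJ SJ Ja.
pose rs := undup [seq wt lam s | s <- mons n K].
have [nurs|nurs] := boolP (nu \in rs); last first.
  rewrite /wpart big_seq_cond big1; first by case: sJ.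
  move=> s /andP[sm /eqP E]; case/negP: nurs; rewrite mem_undup -E; exact: map_f.
apply: (@gev_indep _ _ T dT J sJ TJ rs (fun nu => wpart nu a)) nurs; first exact: undup_uniq.
  by move=> mu _; have [N hN] := gev_wpart mu a; exists N; exact: SJ.
have -> : \sum_(mu <- rs) wpart mu a = a - (a - trunc K a).
  rewrite subKr /trunc /wpart (exchange_big_dep xpredT) //= big_seq [RHS]big_seq.
  apply: eq_bigr => s sm; rewrite big_mkcond /= (bigD1_seq (wt lam s)) ?undup_uniq //=; last first.
    by rewrite mem_undup; exact: map_f.
  by rewrite eqxx big1 ?addr0 // => mu /negPf; rewrite eq_sym => ->.
by apply: subspaceB => //; apply: SJ; exact: truncP.
Qed.

(** In the T-stable space C F + m^K, the part of F with the weight of s is a multiple of F modulo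
    m^K, so T - 1 kills it there. By coprimality a weight other than 1 would put it into m^K. *)
Lemma weight_one F s : T F = F -> (mdeg s < K)%N -> cf F s != 0 -> wt lam s = 1.
Proof.
move=> TF hs Fs; apply/eqP; apply: contraT => w1.
have sS := gideal_subspace (@gideal_ordM R n K); have [S0 SD SZ] := sS.
pose J a := exists c, S (a - gC c * F).
have sJ : gsubspace J.
  split.
  - by exists 0; rewrite rmorph0 mul0r subr0.
  - move=> a b [c hc] [d hd]; exists (c + d); rewrite rmorphD /= mulrDl opprD addrACA; exact: SD.
  - move=> k a [c hc]; exists (k * c); rewrite rmorphM /= -mulrA -mulrBr; exact: SZ.
have TJ a : J a -> J (T a).
  move=> [c hc]; exists c; rewrite -{1}TF -(gderZ dT) -(gderB dT); exact: T_ordM.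
have SJ a : S a -> J a by move=> h; exists 0; rewrite rmorph0 mul0r subr0.
have JF : J F by exists 1; rewrite rmorph1 mul1r subrr.
have [c hc] := wpart_mem (wt lam s) sJ TJ SJ JF.
have h1 : S (itT T 1 1 (wpart (wt lam s) F)).
  rewrite itTS /itT /= -[wpart _ _](subrK (gC c * F)) (TmD dT) (TmZ dT) [Tm T 1 F]TmE TF rmorph1 mul1r subrr.
  by rewrite mulr0 addr0; apply: (S_Tm sS (@T_ordM K)).
have [N hN] := gev_wpart (wt lam s) F.
have := gev_coprime dT sS (@T_ordM K) w1 hN h1.
by move=> /(_ s hs); rewrite cf_wpart // eqxx => E; rewrite E eqxx in Fs.
Qed.
End Components.

(** Only the pure powers x_i^k with k <= d in the derivatives of F can contribute to the coefficient
    of x_i^d. *)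
Lemma axis_monomial (F : germ) d i (a : 'I_n -> germ) :
  gX i ^+ d = \sum_j a j * gd j F ->
  exists j k, (k <= d)%N /\ cf F (madd (munit i k) (munit j 1)) != 0.
Proof.
move=> E; apply: contrapT => H.
have z j k : (k <= d)%N -> cf (gd j F) (munit i k) = 0.
  move=> kd; rewrite cf_gd; have [->|h] := eqVneq (cf F (madd (munit i k) (munit j 1))) 0.
    by rewrite mulr0.
  by case: H; exists j, k.
have gXd : gX i ^+ d = gm (munit i d).
  elim: (d) => [|e IH]; first by rewrite munit0 gm0.
  by rewrite exprS IH -addn1 munitD gm_add gm_unit mulrC.
have : cf (gX i ^+ d) (munit i d) = 1 by rewrite gXd cf_gm eqxx.
rewrite E cf_sum big1; first by move/eqP; rewrite eq_sym oner_eq0.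
move=> j _; rewrite -[a j](subrK (trunc d.+1 (a j))) mulrDl cf_add.
rewrite (ordM_mull (gd j F) (@truncP _ _ d.+1 (a j))) ?mdeg_unit // add0r /trunc mulr_suml cf_sum big1 // => t _.
rewrite -mulrA cf_gCM; have [[l hl]|h] := pselect (exists l, (munit i d l < t l)%N).
  by rewrite (cf_gmM0 _ hl) mulr0.
have tE : t = munit i (t i).
  apply/ffunP => l; rewrite ffunE; case: eqP => [->//|/eqP li]; apply/eqP; rewrite -leqn0 leqNgt.
  by apply/negP => hl; apply: h; exists l; rewrite ffunE (negPf li).
have td : (t i <= d)%N.
  by rewrite leqNgt; apply/negP => hl; apply: h; exists i; rewrite ffunE eqxx.
have -> : munit i d = madd (munit i (d - t i)) t by rewrite {2}tE -munitD subnK.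
by rewrite cf_gmM z ?mulr0 // leq_subr.
Qed.
End EigenCoordinates.

(** * Weighted l1 norms and a Neumann series *)

Section WeightedEstimates.
Variables (R : realType) (n : nat).
Local Notation C := (CC R).
Local Notation germ := (germ R n).
Local Notation mon := {ffun 'I_n -> nat}.
Local Notation gm := (gm R).
Implicit Types (s t : mon) (c g : mon -> C) (A : seq mon) (tau : R).

Lemma sum_subseq_le (A B : seq mon) (F : mon -> R) : uniq A -> uniq B -> {subset A <= B} ->
  (forall s, 0 <= F s) -> \sum_(s <- A) F s <= \sum_(s <- B) F s.
Proof.
move=> uA uB AB F0.
have -> : \sum_(s <- A) F s = \sum_(s <- B | s \in A) F s.
  rewrite -[RHS]big_filter; apply: perm_big; apply: uniq_perm => //; first exact: filter_uniq.
  by move=> s; rewrite mem_filter; case: (boolP (s \in A)) => // /AB ->.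
by rewrite big_mkcond; apply: ler_sum => s _; case: ifP.
Qed.

(** Comparison with the sum over a cube of exponents, a product of n geometric sums. *)
Lemma sum_half_mon A : uniq A -> \sum_(s <- A) 2 ^- mdeg s <= 2 ^+ n :> R.
Proof.
move=> uA; pose N := (\max_(s <- A) mdeg s).+1.
have p0 (s : mon) : 0 <= 2 ^- mdeg s :> R by rewrite invr_ge0 exprn_ge0.
apply: (@le_trans _ _ (\sum_(s <- mons n N) 2 ^- mdeg s)).
  apply: sum_subseq_le => //; first exact: mons_uniq.
  by move=> s sA; rewrite mem_mons ltnS (big_rem s) //= leq_maxl.
pose H (k : nat) : R := 2 ^- k.
apply: (@le_trans _ _ (\sum_(e : {ffun 'I_n -> 'I_N}) \prod_i H (e i))).
  rewrite /mons big_filter big_map big_enum_cond /=.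
  apply: (@le_trans _ _ (\sum_(e : {ffun 'I_n -> 'I_N}) 2 ^- mdeg [ffun i => val (e i)])).
    by rewrite big_mkcond /=; apply: ler_sum => e _; case: ifP.
  apply: ler_sum => e _; rewrite le_eqVlt; apply/orP; left; apply/eqP.
  rewrite /H /mdeg -exprVn -prodrXr; apply: eq_bigr => i _; by rewrite ffunE exprVn.
rewrite -(bigA_distr_bigA (fun (_ : 'I_n) (k : 'I_N) => H k)) /=.
rewrite -[X in _ <= 2 ^+ X]card_ord -prodr_const; apply: ler_prod => i _.
by rewrite sumr_ge0 => [|k _]; [exact: sum_half | rewrite invr_ge0 exprn_ge0].
Qed.

Variable b : 'I_n -> nat.
Hypothesis b0 : forall i, (0 < b i)%N.
Definition rk s := (\sum_i b i * s i)%N.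

Lemma rkD s t : rk (madd s t) = (rk s + rk t)%N.
Proof. by rewrite /rk -big_split; apply: eq_bigr => i _; rewrite ffunE mulnDr. Qed.
Lemma rk_unit i k : rk (munit i k) = (b i * k)%N.
Proof.
rewrite /rk (bigD1 i) //= ffunE eqxx big1 ?addn0 // => j ji.
by rewrite ffunE (negPf ji) muln0.
Qed.
Lemma rk0 : rk (mon0 n) = 0%N. Proof. by rewrite /rk big1 // => i _; rewrite ffunE muln0. Qed.
Lemma mdeg_le_rk s : (mdeg s <= rk s)%N.
Proof. by apply: leq_sum => i _; rewrite leq_pmull. Qed.

Definition rklist m : seq mon := [seq s <- mons n m | (rk s < m)%N].
Lemma rklist_uniq m : uniq (rklist m). Proof. exact/filter_uniq/mons_uniq. Qed.
Lemma mem_rklist m s : (s \in rklist m) = (rk s < m)%N.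
Proof.
rewrite mem_filter mem_mons; case: ltnP => //= h.
by rewrite (leq_ltn_trans (mdeg_le_rk s) h).
Qed.

(** A weighted l1 norm bounded by B, tested on finite sets of exponents; tau^(b i) acts as the
    radius in the variable x_i. *)
Definition wb tau c (B : R) := forall A, uniq A -> \sum_(s <- A) tau ^+ rk s * nrm (c s) <= B.

Lemma wb_ge0 tau c B : wb tau c B -> 0 <= B.
Proof. by move=> /(_ [::] isT); rewrite big_nil. Qed.
Lemma wb_add tau c g B D : 0 <= tau -> wb tau c B -> wb tau g D -> wb tau (fun s => c s + g s) (B + D).
Proof.
move=> t0 hc hg A uA; apply: le_trans (lerD (hc A uA) (hg A uA)); rewrite -big_split.
by apply: ler_sum => s _; rewrite /= -mulrDr; apply: ler_wpM2l; rewrite ?exprn_ge0 ?nrmD.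
Qed.
Lemma wb_scale tau c (k : C) B : wb tau c B -> wb tau (fun s => k * c s) (nrm k * B).
Proof.
move=> hc A uA; apply: le_trans (ler_wpM2l (nrm_ge0 k) (hc A uA)); rewrite mulr_sumr.
by apply: ler_sum => s _; rewrite nrmM mulrCA.
Qed.
Lemma wb_weak tau c B D : B <= D -> wb tau c B -> wb tau c D.
Proof. by move=> BD h A uA; apply: le_trans (h A uA) BD. Qed.
Lemma wb_zero tau : wb tau (fun=> 0) 0.
Proof. by move=> A _; rewrite big1 // => s _; rewrite nrm0 mulr0. Qed.

Lemma wb_gm tau (a : germ) t B : 0 <= tau -> wb tau (cf a) B -> wb tau (cf (gm t * a)) (tau ^+ rk t * B).
Proof.
move=> t0 h A uA.
pose ge s := [forall i, (t i <= s i)%N].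
pose sub s : mon := [ffun i => (s i - t i)%N].
have subE s : ge s -> s = madd (sub s) t.
  by move=> /forallP hs; apply/ffunP => i; rewrite !ffunE subnK.
pose A' := [seq sub s | s <- A & ge s].
have uA' : uniq A'.
  rewrite map_inj_in_uniq ?filter_uniq // => s s'; rewrite !mem_filter => /andP[h1 _] /andP[h2 _] E.
  by rewrite (subE _ h1) (subE _ h2) E.
rewrite (bigID ge) /= [X in _ + X]big1 ?addr0; last first.
  move=> s /forallPn [k]; rewrite -ltnNge => hk.
  by rewrite (cf_gmM0 _ hk) nrm0 mulr0.
rewrite -big_filter.
have -> : \sum_(s <- [seq s <- A | ge s]) tau ^+ rk s * nrm (cf (gm t * a) s) =
   tau ^+ rk t * \sum_(s <- A') tau ^+ rk s * nrm (cf a s).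
  rewrite /A' big_map mulr_sumr big_seq [RHS]big_seq; apply: eq_bigr => s.
  rewrite mem_filter => /andP[hs _]; rewrite {1 2}(subE _ hs) cf_gmM rkD exprD; ring.
by apply: ler_wpM2l; [exact: exprn_ge0 | exact: h].
Qed.

Lemma wb_convergent tau c B : 0 < tau -> tau <= 1 -> wb tau c B -> convergent c.
Proof.
move=> t0 t1 h; pose M := (\max_i b i)%N.
have B0 := wb_ge0 h.
exists B, (tau ^- M); split; first by rewrite invr_gt0 exprn_gt0.
move=> s; have := h [:: s] isT; rewrite big_seq1 => hs.
have rM : (rk s <= M * mdeg s)%N.
  by rewrite /rk /mdeg big_distrr /=; apply: leq_sum => i _; rewrite leq_mul2r leq_bigmax orbT.
have h1 : tau ^+ (M * mdeg s) * nrm (c s) <= B.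
  apply: le_trans hs; apply: ler_wpM2r; first exact: nrm_ge0.
  by apply: ler_wiXn2l => //; exact: ltW.
by rewrite exprVn -exprM ler_pdivlMr ?exprn_gt0 // mulrC.
Qed.

Lemma convergent_wb c : convergent c -> exists tau0 B : R, [/\ 0 < tau0, tau0 <= 1 &
  forall tau, 0 < tau -> tau <= tau0 -> wb tau c B].
Proof.
move=> [K [r [r0 gc]]]; have K0 := geo_ge0 gc.
exists (Num.min 1 (1 / (2 * r))), (K * 2 ^+ n); split; first by rewrite lt_min ltr01 divr_gt0 ?ltr01 ?mulr_gt0 ?ltr0n.
  by rewrite ge_min lexx.
move=> tau t0; rewrite le_min => /andP[t1 t2] A uA.
apply: le_trans (ler_wpM2l K0 (sum_half_mon uA)); rewrite mulr_sumr; apply: ler_sum => s _.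
have tr : tau * r <= 2^-1.
  by move: t2; rewrite ler_pdivlMr ?mulr_gt0 //; lra.
apply: (@le_trans _ _ (tau ^+ mdeg s * (K * r ^+ mdeg s))).
  apply: ler_pM; rewrite ?exprn_ge0 ?nrm_ge0 ?(ltW t0) //.
  by apply: ler_wiXn2l => //; [exact: ltW | exact: mdeg_le_rk].
rewrite mulrCA -exprMn; apply: ler_wpM2l => //; rewrite -exprVn.
by rewrite lerXn2r ?nnegrE ?mulr_ge0 ?invr_ge0 // ltW.
Qed.

(** The norm is o(tau^r0) as tau tends to 0, because every exponent that occurs has rank beyond r0;
    this gain makes the later operators contracting. *)
Lemma small_tail c (r0 : nat) (e : R) : convergent c -> (forall s, c s != 0 -> (r0 < rk s)%N) -> 0 < e ->
  exists tau0 : R, [/\ 0 < tau0, tau0 <= 1 & forall tau, 0 < tau -> tau <= tau0 -> wb tau c (e * tau ^+ r0)].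
Proof.
move=> [K [r [r_0 gc]]] hr e0; have K0 := geo_ge0 gc.
pose z := Num.min 1 (Num.min (1 / (2 * r)) (e / (1 + K * 2 ^+ n))).
have Kn : 0 <= K * 2 ^+ n by rewrite mulr_ge0 ?exprn_ge0.
have z0 : 0 < z by rewrite !lt_min !divr_gt0 ?mulr_gt0 //; lra.
have [z1 z2 z3] : [/\ z <= 1, z <= 1 / (2 * r) & z <= e / (1 + K * 2 ^+ n)].
  by rewrite /z !ge_min !lexx !orbT.
(* The exponent fits |s| + 1 <= 2 (r0 + 1) (rk s - r0), so that tau^(rk s - r0) <= z^(|s| + 1): one
   factor z absorbs the constant, the others the geometric growth. *)
exists (z ^+ (2 * r0.+1)); split; first exact: exprn_gt0.
  by apply: exprn_ile1 => //; exact: ltW.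
move=> tau t0 ht A uA.
have zr : z * r <= 2^-1 by move: z2; rewrite ler_pdivlMr ?mulr_gt0 //; lra.
have Kz : z * (K * 2 ^+ n) <= e.
  apply: (@le_trans _ _ (e / (1 + K * 2 ^+ n) * (K * 2 ^+ n))); first exact: ler_wpM2r.
  by rewrite mulrAC ler_pdivrMr; [apply: ler_wpM2l; lra | lra].
apply: (@le_trans _ _ (\sum_(s <- A) tau ^+ r0 * (z * K) * 2 ^- mdeg s)); last first.
  rewrite -mulr_sumr; apply: le_trans (ler_wpM2l _ (sum_half_mon uA)) _.
    by rewrite !mulr_ge0 ?exprn_ge0 // ltW.
  by rewrite -!mulrA mulrC; apply: ler_wpM2r => //; rewrite exprn_ge0 // ltW.
apply: ler_sum => s _.
have [->|cs] := eqVneq (c s) 0.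
  by rewrite nrm0 mulr0 !mulr_ge0 ?invr_ge0 ?exprn_ge0 ?(ltW t0) ?(ltW z0).
have rs := hr s cs; pose d := (rk s - r0)%N.
have dE : rk s = (r0 + d)%N by rewrite /d subnKC // ltnW.
have d0 : (0 < d)%N by rewrite subn_gt0.
have hd : ((mdeg s).+1 <= 2 * r0.+1 * d)%N.
  have h1 : (mdeg s <= r0.+1 * d)%N.
    apply: leq_trans (mdeg_le_rk s) _; rewrite dE mulSn addnC leq_add2l leq_pmulr //.
  have h2 : (1 <= r0.+1 * d)%N by rewrite muln_gt0.
  by rewrite -mulnA mul2n -addnn -addn1; apply: leq_add.
have h1 : tau ^+ d <= z ^+ (mdeg s).+1.
  apply: (@le_trans _ _ ((z ^+ (2 * r0.+1)) ^+ d)).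
    by rewrite lerXn2r ?nnegrE ?exprn_ge0 // ltW.
  by rewrite -exprM; apply: ler_wiXn2l => //; exact: ltW.
rewrite dE exprD -!mulrA; apply: ler_wpM2l; first by rewrite exprn_ge0 // ltW.
apply: (@le_trans _ _ (z ^+ (mdeg s).+1 * (K * r ^+ mdeg s))).
  by apply: ler_pM; rewrite ?exprn_ge0 ?nrm_ge0 // ltW.
rewrite exprS -mulrA; apply: ler_wpM2l; first exact: ltW.
rewrite mulrCA; apply: ler_wpM2l => //; rewrite -exprMn -exprVn.
by rewrite lerXn2r ?nnegrE ?mulr_ge0 ?invr_ge0 // ltW.
Qed.

Lemma small_tails m (w : 'I_m -> germ) (r : 'I_m -> nat) (e : R) :
  (forall j s, cf (w j) s != 0 -> (r j < rk s)%N) -> 0 < e -> exists tau0 : R, [/\ 0 < tau0, tau0 <= 1 &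
  forall tau, 0 < tau -> tau <= tau0 -> forall j, wb tau (cf (w j)) (e * tau ^+ r j)].
Proof.
move=> hw e0; have h j := small_tail (svalP (w j)) (hw j) e0.
have [t0 ht] := choice h.
have p0 j : 0 <= t0 j by case: (ht j) => /ltW.
exists (\prod_j t0 j); split; first by apply: prodr_gt0 => j _; case: (ht j).
  by apply: prodr_ile1 => j _; rewrite p0; case: (ht j).
move=> tau t_0 tle j; have [_ _] := ht j; apply => //; apply: le_trans tle _.
rewrite (bigD1 j) //= -[leRHS]mulr1; apply: ler_wpM2l => //.
by apply: prodr_ile1 => k _; rewrite p0; case: (ht k).
Qed.

(* [v] is defined by recursion on [rk], so no limit is taken; the column bound gives
   |v| <= |g| + |v| / 2 in the weighted l1 norm of finite truncations. *)
Lemma neumann tau (phi : mon -> mon -> C) g (G : R) : 0 < tau ->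
  (forall t, wb tau (phi t) (tau ^+ rk t / 2)) -> wb tau g G ->
  exists v : mon -> C, (forall s, v s = g s + \sum_(t <- rklist (rk s)) v t * phi t s) /\ wb tau v (2 * G).
Proof.
move=> t0 hcol hg.
pose fix u (m : nat) (s : mon) {struct m} : C := if m is m'.+1 then g s + \sum_(t <- rklist (rk s)) u m' t * phi t s else 0.
have uS m s : u m.+1 s = g s + \sum_(t <- rklist (rk s)) u m t * phi t s by [].
have stab m m' s : (rk s < m)%N -> (rk s < m')%N -> u m s = u m' s.
  elim: m m' s => [|m IH] [|m'] s //; rewrite !ltnS => h1 h2; rewrite !uS; congr (_ + _).
  rewrite big_seq [RHS]big_seq; apply: eq_bigr => t; rewrite mem_rklist => ht.
  by congr (_ * _); apply: IH; exact: leq_trans ht _.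
pose v s := u (rk s).+1 s.
have vE s : v s = g s + \sum_(t <- rklist (rk s)) v t * phi t s.
  rewrite {1}/v uS; congr (_ + _); rewrite big_seq [RHS]big_seq; apply: eq_bigr => t.
  by rewrite mem_rklist => ht; congr (_ * _); apply: stab.
exists v; split => // A uA.
pose m := (\max_(s <- A) rk s).+1.
have nn (s : mon) (z : C) : 0 <= tau ^+ rk s * nrm z by rewrite mulr_ge0 ?nrm_ge0 ?exprn_ge0 // ltW.
apply: (@le_trans _ _ (\sum_(s <- rklist m) tau ^+ rk s * nrm (v s))).
  apply: sum_subseq_le => //; first exact: rklist_uniq.
  by move=> s sA; rewrite mem_rklist ltnS (big_rem s) //= leq_maxl.
set X := \sum_(s <- _) _.
suff : X <= G + X / 2 by lra.
have h1 : X <= \sum_(s <- rklist m) (tau ^+ rk s * nrm (g s) +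
     \sum_(t <- rklist m) nrm (v t) * (tau ^+ rk s * nrm (phi t s))).
  rewrite /X big_seq [leRHS]big_seq; apply: ler_sum => s; rewrite mem_rklist => sm.
  rewrite {1}vE; apply: le_trans (ler_wpM2l _ (nrmD _ _)) _; first by rewrite exprn_ge0 // ltW.
  rewrite mulrDr lerD2l; apply: le_trans (ler_wpM2l _ (nrm_sum _ _ _)) _; first by rewrite exprn_ge0 // ltW.
  rewrite mulr_sumr; apply: (@le_trans _ _ (\sum_(t <- rklist (rk s)) nrm (v t) * (tau ^+ rk s * nrm (phi t s)))).
    by apply: ler_sum => t _; rewrite nrmM mulrCA.
  apply: sum_subseq_le; try exact: rklist_uniq.
    by move=> t; rewrite !mem_rklist => h; exact: ltn_trans h sm.
  by move=> t; rewrite mulr_ge0 ?nrm_ge0.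
apply: (le_trans h1); rewrite big_split /=; apply: lerD; first exact/hg/rklist_uniq.
rewrite exchange_big /= /X mulr_suml; apply: ler_sum => t _.
rewrite -mulr_sumr; apply: le_trans (ler_wpM2l (nrm_ge0 _) (hcol t _ (rklist_uniq m))) _.
by rewrite mulrA mulrC mulrA [_ * nrm _]mulrC mulrC; lra.
Qed.
End WeightedEstimates.

(** * Solving (T - lam) u = g in triangular coordinates *)

Section PDE.
Variables (R : realType) (n : nat).
Local Notation C := (CC R).
Local Notation germ := (germ R n).
Local Notation gX := (gX R).
Local Notation gC := (gC n).
Local Notation mon := {ffun 'I_n -> nat}.
Local Notation gm := (gm R).
Implicit Types (s t : mon) (a u g : germ).

Lemma supp_gmM t a s : cf (gm t * a) s != 0 -> exists2 s', s = madd s' t & cf a s' != 0.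
Proof.
case: (boolP [forall k, (t k <= s k)%N]) => [/forallP h|/forallPn [k]]; last first.
  by rewrite -ltnNge => hk; rewrite (cf_gmM0 _ hk) eqxx.
have sE : s = madd [ffun k => (s k - t k)%N] t by apply/ffunP => k; rewrite !ffunE subnK.
by rewrite {1}sE cf_gmM => hs; exists [ffun k => (s k - t k)%N].
Qed.

Lemma dv_gX (w : 'I_n -> germ) i : dv w (gX i) = w i.
Proof.
rewrite /dv (bigD1 i) //= gd_gX eqxx mulr1 big1 ?addr0 // => j ji.
by rewrite gd_gX (negPf ji) mulr0.
Qed.

Lemma cf_euler (mu : 'I_n -> C) a s : cf (dv (fun j => gC (mu j) * gX j) a) s = wt mu s * cf a s.
Proof.
rewrite /dv cf_sum /wt mulr_suml; apply: eq_bigr => j _; rewrite -mulrA cf_gCM -mulrA; congr (_ * _).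
have [s0|s0] := eqVneq (s j) 0%N; first by rewrite cf_gXM0 // s0 mul0r.
have := mon_pred s0; set t := finfun _ => ->.
by rewrite cf_gXM cf_gd !ffunE eqxx addn1.
Qed.

Section Triangular.
Variable T : germ -> germ.
Hypothesis dT : gderivation T.
Variables (b : 'I_n -> nat) (mu : 'I_n -> C) (ell : 'I_n -> germ).
Hypothesis b0 : forall i, (0 < b i)%N.
Hypothesis TX : forall j, T (gX j) = gC (mu j) * gX j + ell j.
Hypothesis ellP : forall j s, cf (ell j) s != 0 -> (b j < rk b s)%N.
Local Notation E := (dv ell).
Local Notation rk := (rk b).

Lemma ell_ordM j : ordM 1 (ell j).
Proof.
move=> s; rewrite ltnS leqn0 => /eqP /mdeg_eq0 ->; apply/eqP/negPn/negP => /ellP.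
by rewrite rk0.
Qed.

(** The first summand is an Euler field, diagonal on monomials; the second strictly raises [rk], by
    [ellP]. *)
Lemma T_split a : T a = dv (fun j => gC (mu j) * gX j) a + E a.
Proof. by rewrite (gderE dT) /dv -big_split; apply: eq_bigr => j _; rewrite TX mulrDl. Qed.

Lemma E_gmS t i : E (gm (madd t (munit i 1))) = gX i * E (gm t) + gm t * ell i.
Proof. by rewrite gm_add gm_unit (gderM (gder_dv ell)) dv_gX mulrC. Qed.

Lemma E_ordM k a : ordM k a -> ordM k (E a).
Proof.
apply: T_ordM; first exact: gder_dv.
by move=> i; rewrite dv_gX; apply/ordM1P; exact: ell_ordM.
Qed.

Lemma supp_E t s : cf (E (gm t)) s != 0 -> (rk t < rk s)%N.
Proof.
move: t s; apply: mon_ind => [s|i t IH s]; first by rewrite gm0 (gder1 (gder_dv ell)) cf0 eqxx.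
rewrite E_gmS cf_add rkD; have [->|h1 _] := eqVneq (cf (gX i * E (gm t)) s) 0.
  by rewrite add0r => /supp_gmM [s' -> /ellP h]; rewrite rkD rk_unit muln1 addnC ltn_add2r.
move: h1; rewrite -gm_unit => /supp_gmM [s' -> /IH]; by rewrite rkD ltn_add2r.
Qed.

(** The Leibniz rule produces the unbounded factor |t|, which the lower bound c |t| on the divisors
    compensates in [pde_triangular]. *)
Lemma wb_E tau (e : R) t : 0 <= tau -> (forall j, wb b tau (cf (ell j)) (e * tau ^+ b j)) ->
  wb b tau (cf (E (gm t))) ((mdeg t)%:R * (e * tau ^+ rk t)).
Proof.
move=> t0 he; move: t; apply: mon_ind => [|i t IH].
  rewrite gm0 (gder1 (gder_dv ell)) mdeg0 mul0r => A uA.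
  by rewrite big1 // => s _; rewrite cf0 nrm0 mulr0.
rewrite E_gmS; have h1 := wb_gm (munit i 1) t0 IH; have h2 := wb_gm t t0 (he i).
rewrite gm_unit in h1; have := wb_add t0 h1 h2.
rewrite (_ : (fun s => _) = cf (gX i * E (gm t) + gm t * ell i)); last by apply/funext => s; rewrite cf_add.
apply: wb_weak; rewrite le_eqVlt; apply/orP; left; apply/eqP.
rewrite mdegD mdeg_unit rkD rk_unit muln1 natrD exprD; ring.
Qed.

Lemma cf_E a s : cf (E a) s = \sum_(t <- rklist b (rk s)) cf a t * cf (E (gm t)) s.
Proof.
pose K := (rk s).+1; have dE := gder_dv ell.
have -> : cf (E a) s = \sum_(t <- mons n K) cf a t * cf (E (gm t)) s.
  have := E_ordM (@truncP _ _ K a) (leq_ltn_trans (mdeg_le_rk b0 s) (ltnSn _) : (mdeg s < K)%N).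
  rewrite (gderB dE) cf_sub => /subr0_eq ->.
  by rewrite /trunc (gder_sum dE) cf_sum; apply: eq_bigr => t _; rewrite (gderZ dE) cf_gCM.
rewrite (bigID (fun t => rk t < rk s)%N) /= [X in _ + X]big1 ?addr0; last first.
  move=> t ht; apply/eqP; rewrite mulf_eq0; apply/orP; right; apply: contraNT ht; exact: supp_E.
rewrite -big_filter; apply: perm_big; apply: uniq_perm; [exact/filter_uniq/mons_uniq|exact: rklist_uniq|].
move=> t; rewrite mem_filter mem_mons mem_rklist //; case: ltnP => //= h.
by rewrite /K ltnS (leq_trans (mdeg_le_rk b0 t) (ltnW h)).
Qed.

(** With the divisors D s = wt mu s - lam and v = D u, the equation reads v = g + phi v where phi =
    - E D^-1 is triangular in [rk]; [neumann] solves it once the columns of phi are small. *)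
Lemma pde_triangular (c : R) L lam : 0 < c -> (0 < L)%N ->
  (forall s, (L <= mdeg s)%N -> c * (mdeg s)%:R <= nrm (wt mu s - lam)) ->
  forall g, ordM L g -> exists u, ordM L u /\ Tm T lam u = g.
Proof.
move=> c0 L0 hD g hg; pose D s := wt mu s - lam.
pose phi t s : C := if (L <= mdeg t)%N then - (cf (E (gm t)) s / D t) else 0.
have D1 s : (L <= mdeg s)%N -> c <= nrm (D s).
  move=> hs; apply: le_trans (hD s hs); rewrite -[leLHS]mulr1; apply: ler_wpM2l; first exact: ltW.
  by rewrite ler1n (leq_trans L0).
have Dn0 s : (L <= mdeg s)%N -> D s != 0.
  by move=> /D1 h; apply: contraTneq h => ->; rewrite nrm0 -ltNge.
(* The constant is c / 2: then |t| (c / 2) tau^(rk t), divided by |D t| >= c |t|, is at most tau^(rk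
   t) / 2. *)
have [tE [tE0 tE1 hE]] := small_tails b0 ellP (divr_gt0 c0 (ltr0Sn R 1)).
have [tG [G [tG0 tG1 hG]]] := convergent_wb b0 (svalP g).
pose tau := tE * tG.
have t0 : 0 < tau by exact: mulr_gt0.
have tlE : tau <= tE by rewrite -[leRHS]mulr1; apply: ler_wpM2l => //; exact: ltW.
have tlG : tau <= tG by rewrite -[leRHS]mul1r; apply: ler_wpM2r => //; exact: ltW.
have t1 : tau <= 1 := le_trans tlG tG1.
have hcol t : wb b tau (phi t) (tau ^+ rk t / 2).
  rewrite /phi; case: leqP => ht; last first.
    by apply: wb_weak (wb_zero _ _); rewrite divr_ge0 ?exprn_ge0 // ltW.
  rewrite (_ : (fun s => _) = fun s => - (D t)^-1 * cf (E (gm t)) s); last by apply/funext => s; ring.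
  have := wb_scale (- (D t)^-1) (wb_E t (ltW t0) (hE tau t0 tlE)); apply: wb_weak.
  rewrite nrmN nrmV ler_pdivrMl ?(lt_le_trans c0 (D1 t ht)) //.
  rewrite [leRHS](_ : _ = nrm (D t) * (tau ^+ rk t / 2)) //.
  apply: (@le_trans _ _ ((c * (mdeg t)%:R) * (tau ^+ rk t / 2))).
    by rewrite le_eqVlt; apply/orP; left; apply/eqP; field.
  by apply: ler_wpM2r; [rewrite divr_ge0 ?exprn_ge0 // ltW | exact: hD].
have [v [vE wv]] := neumann b0 t0 hcol (hG tau t0 tlG).
pose u s : C := if (L <= mdeg s)%N then v s / D s else 0.
have wu : wb b tau u (c^-1 * (2 * G)).
  move=> A uA; apply: le_trans (ler_wpM2l _ (wv A uA)); last by rewrite invr_ge0 ltW.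
  rewrite mulr_sumr; apply: ler_sum => s _; rewrite mulrCA; apply: ler_wpM2l; first by rewrite exprn_ge0 // ltW.
  rewrite /u; case: leqP => hs; last by rewrite nrm0 mulr_ge0 ?nrm_ge0 // invr_ge0 ltW.
  rewrite nrmM nrmV mulrC; apply: ler_wpM2r; first exact: nrm_ge0.
  by rewrite lef_pV2 ?posrE ?(lt_le_trans c0 (D1 s hs)) // D1.
pose U : germ := exist _ u (wb_convergent t0 t1 wu).
have UE s : cf U s = u s by [].
have oU : ordM L U by move=> s hs; rewrite UE /u leqNgt hs.
have oE s : (mdeg s < L)%N -> cf (Tm T lam U) s = 0.
  move=> hs; rewrite TmE T_split cf_sub cf_add cf_euler cf_gCM (E_ordM oU hs) (oU s hs).
  by rewrite !mulr0 addr0 subr0.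
exists U; split => //; apply: cf_inj; apply/funext => s.
have [hs|hs] := ltnP (mdeg s) L; first by rewrite oE // hg.
rewrite TmE T_split cf_sub cf_add cf_euler cf_gCM cf_E.
rewrite (eq_bigr (fun t => - (v t * phi t s))); last first.
  move=> t _; rewrite UE /u /phi; case: ifP => _; last by rewrite mul0r mulr0 oppr0.
  by rewrite mulrN opprK mulrAC mulrA.
rewrite sumrN UE /u hs; set S := \sum_(t <- _) _.
have -> : cf g s = v s - S by rewrite (vE s : v s = cf g s + S) addrK.
set q := v s / D s; have -> : v s = D s * q by rewrite /q mulrC divfK // Dn0.
rewrite /D; ring.
Qed.
End Triangular.
End PDE.

(** * Transport of derivations by a change of coordinates *)

Section Transport.
Variables (R : realType) (n : nat).
Local Notation C := (CC R).
Local Notation V := 'rV[C]_n.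
Local Notation germ := (germ R n).
Local Notation gC := (gC n).
Variables (x y : V -> V).
Hypotheses (cx : cmap x) (cy : cmap y) (xy : \forall p \near (0 : V), y (x p) = p)
  (yx : \forall q \near (0 : V), x (y q) = q).

(** The derivation T expressed in the coordinates [x], with inverse [y]. *)
Definition gconj (T : germ -> germ) a := sub y (T (sub x a)).

Lemma sub_yx a : sub y (sub x a) = a. Proof. exact: subK. Qed.
Lemma sub_xy a : sub x (sub y a) = a. Proof. exact: subK. Qed.
Lemma gder_conj T : gderivation T -> gderivation (gconj T).
Proof.
move=> dT; split => [a b|a b|k]; rewrite /gconj.
- by rewrite subD // (gderD dT) subD.
- by rewrite subM // (gderM dT) subD // !subM // !sub_yx.
- by rewrite sub_gC // (gderC dT) sub0.
Qed.
Lemma gconj_sub T a : gconj T (sub y a) = sub y (T a). Proof. by rewrite /gconj sub_xy. Qed.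
Lemma Tm_conj T mu a : Tm (gconj T) mu (sub y a) = sub y (Tm T mu a).
Proof. by rewrite !TmE gconj_sub subB // subM // sub_gC. Qed.
Lemma itT_conj T mu N a : itT (gconj T) mu N (sub y a) = sub y (itT T mu N a).
Proof. by elim: N => [|N IH] //; rewrite !itTS IH Tm_conj. Qed.
Lemma gev_conj T (S S' : germ -> Prop) mu a : (forall a, S a -> S' (sub y a)) ->
  gev T S mu a -> gev (gconj T) S' mu (sub y a).
Proof. by move=> SS [N h]; exists N; rewrite itT_conj; exact: SS. Qed.
End Transport.

(** * Exact generalized eigencoordinates *)

Section CoordinateFreePDE.
Variables (R : realType) (n : nat).
Local Notation C := (CC R).
Local Notation V := 'rV[C]_n.
Local Notation germ := (germ R n).
Local Notation gX := (gX R).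
Local Notation gC := (gC n).
Local Notation mon := {ffun 'I_n -> nat}.
Variable T : germ -> germ.
Hypotheses (dT : gderivation T) (T0 : forall i, ev (T (gX i)) = 0).

Lemma ordM2P (a : germ) : ordM 1 a -> (forall k, cf a (munit k 1) = 0) -> ordM 2 a.
Proof.
move=> h1 h2 s; rewrite ltnS leq_eqVlt ltnS leqn0 => /orP[/eqP /mdeg1 [k ->]|s0]; first exact: h2.
by apply: h1; rewrite (eqP s0).
Qed.

Definition lform (w : 'rV[C]_n) : germ := \sum_j gC (w 0 j) * gX j.
Definition linear_part : 'M[C]_n := \matrix_(j, k) cf (T (gX j)) (munit k 1).

Lemma ordM_lform w : ordM 1 (lform w).
Proof. by apply: ordM_sum => j _; apply: ordM_mulr; exact: ordM1_gX. Qed.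
Lemma cf_lform w k : cf (lform w) (munit k 1) = w 0 k.
Proof.
rewrite cf_sum (bigD1 k) //= cf_gCM cf_gX eqxx mulr1 big1 ?addr0 // => j jk.
rewrite cf_gCM cf_gX; case: eqP => [/munit_inj kj|]; last by rewrite mulr0.
by rewrite kj eqxx in jk.
Qed.
Lemma cf_T_lform w k : cf (T (lform w)) (munit k 1) = (w *m linear_part) 0 k.
Proof.
rewrite /lform (gder_sum dT) cf_sum mxE; apply: eq_bigr => j _.
by rewrite (gderZ dT) cf_gCM mxE.
Qed.

(** Schur triangularisation, which is available in positive size; hence the separate case n = 0. *)
Lemma triangular_form : exists P B : 'M[C]_n,
  [/\ P \in unitmx, is_trig_mx B & P *m linear_part = B *m P].
Proof.
case: (posnP n) => [n0|n0].
  exists 1%:M, linear_part; split; rewrite ?unitmx1 ?mul1mx ?mulmx1 //.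
  apply/is_trig_mxP => i; suff : False by [].
  by have := ltn_ord i; rewrite [X in (_ < X)%N]n0.
have [P Pu tr] := Schur linear_part n0.
have uP := unitarymx_unit Pu.
exists P, (P *m linear_part *m invmx P); split => //; last by rewrite mulmxKV.
by move: tr; rewrite /similar_to /= conjumx.
Qed.

Lemma trig_eigen (B : 'M[C]_n) i : is_trig_mx B -> exists2 v : 'rV[C]_n, v *m B = B i i *: v & v != 0.
Proof.
move=> tB; apply/eigenvalueP; rewrite eigenvalue_root_char char_poly_trig // /root horner_prod.
by rewrite (bigD1 i) //= hornerXsubC subrr mul0r.
Qed.

(** In suitable linear coordinates the linear part of T is triangular, with diagonal entries at
    least c0 by hypothesis. For |s| >= L the divisor is then at least c0 |s| - l0 >= c0 |s| / 2. *)
Lemma pde (c0 : R) : 0 < c0 ->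
  (forall mu l, ordM 1 l -> ~ ordM 2 l -> ordM 2 (Tm T mu l) -> exists2 q : R, mu = rc q & c0 <= q) ->
  forall (L : nat) (l0 : R), (0 < L)%N -> 2 * l0 <= c0 * L%:R ->
  forall g, ordM L g -> exists u, ordM L u /\ Tm T (rc l0) u = g.
Proof.
move=> c00 hev L l0 L0 hl g hg.
have [P [B [uP tB PB]]] := triangular_form.
pose ys i := lform (row i P).
have ev_ys j : ev (ys j) = 0 by apply/ordM1P; exact: ordM_lform.
have uj : jac ys \in unitmx.
  by rewrite (_ : jac ys = P^T) ?unitmx_tr //; apply/matrixP => i j; rewrite !mxE cf_lform mxE.
have [x [y [cx cy xy yx xE]]] := germ_coords ev_ys uj.
have sx j : sub x (gX j) = ys j by rewrite sub_gX.
have sy j : sub y (ys j) = gX j by rewrite -sx sub_yx.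
have dT' := gder_conj cx cy yx dT.
have /choice [q hq] : forall i, exists q : R, B i i = rc q /\ c0 <= q.
  move=> i; have [v vB v0] := trig_eigen i tB.
  have [|||r r1 r2] := hev (B i i) (lform (v *m P)); last by exists r.
  - exact: ordM_lform.
  - move=> h; case/negP: v0; have : v *m P = 0.
      apply/rowP => k; rewrite -[LHS]cf_lform mxE; apply: h; by rewrite mdeg_unit.
    by move/(congr1 (fun M => M *m invmx P)); rewrite mulmxK // mul0mx => ->.
  - apply: ordM2P => [|k]; rewrite TmE.
      by apply: ordMB; [apply: T_ordM => //; exact: ordM_lform | apply: ordM_mulr; exact: ordM_lform].
    rewrite cf_sub cf_T_lform cf_gCM cf_lform.
    have -> : v *m P *m linear_part = B i i *: (v *m P) by rewrite -mulmxA PB mulmxA vB scalemxAl.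
    by rewrite mxE subrr.
pose ell j := gconj x y T (gX j) - gC (B j j) * gX j.
(* Decreasing weights between n+1 and 2n: both the strictly triangular linear terms
   and all the terms of order at least 2 raise [rk]. *)
pose b (i : 'I_n) := (2 * n - i)%N.
have b0 i : (0 < b i)%N by rewrite subn_gt0 (leq_trans (ltn_ord i)) // leq_pmull.
have bn i : (n.+1 <= b i)%N by rewrite /b ltn_subRL mul2n -addnn ltn_add2r.
have TX j : gconj x y T (gX j) = gC (B j j) * gX j + ell j by rewrite /ell addrC subrK.
(* The relation [P *m linear_part = B *m P] read row by row: modulo m^2, T acts on the forms [ys]
   through B. *)
have O2 j : ordM 2 (T (ys j) - \sum_k gC (B j k) * ys k).
  apply: ordM2P => [|k].
    apply: ordMB; first by apply: T_ordM => //; exact: ordM_lform.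
    by apply: ordM_sum => k _; apply: ordM_mulr; exact: ordM_lform.
  rewrite cf_sub cf_T_lform -row_mul PB row_mul cf_sum mxE; apply/eqP; rewrite subr_eq0; apply/eqP.
  by apply: eq_bigr => i _; rewrite cf_gCM cf_lform !mxE.
have ellP j s : cf (ell j) s != 0 -> (b j < rk b s)%N.
  apply: contraNltn => hs.
  (* In degree at least 2 the rank is at least 2 (n + 1), which exceeds b j <= 2 n. *)
  have s2 : (mdeg s < 2)%N.
    rewrite ltnNge; apply/negP => s2; have : (n.+1 * mdeg s <= b j)%N.
      apply: leq_trans hs; rewrite /mdeg big_distrr /=; apply: leq_sum => i _.
      by rewrite leq_mul2r bn orbT.
    rewrite leqNgt => /negP; apply; apply: leq_ltn_trans (leq_subr _ _) _.
    apply: (@leq_trans (n.+1 * 2)); last by rewrite leq_mul2l s2 orbT.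
    by rewrite [(2 * n)%N]mulnC ltn_mul2r /= ltnSn.
  have -> : ell j = sub y (T (ys j) - \sum_k gC (B j k) * ys k) + \sum_(k | k != j) gC (B j k) * gX k.
    rewrite subB // sub_sum // (bigD1 j) //= subM // sub_gC // sy.
    rewrite (eq_bigr (fun k => gC (B j k) * gX k)) => [|k _]; last by rewrite subM // sub_gC // sy.
    rewrite opprD addrA subrK /ell; congr (_ - _).
    by rewrite -sy gconj_sub.
  rewrite cf_add (ordM_sub cy (O2 j)) // add0r cf_sum big1 // => k kj.
  rewrite cf_gCM cf_gX; case: eqP => [sE|_]; last by rewrite mulr0.
  move: hs; rewrite sE rk_unit muln1 /b => hs.
  have jk : (j < k)%N.
    rewrite ltn_neqAle eq_sym kj /=; rewrite leqNgt; apply/negP => kj'.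
    move: hs; rewrite leqNgt => /negP; apply; apply: ltn_sub2l => //.
    by apply: (leq_trans (ltn_ord k)); rewrite leq_pmull.
  by have /is_trig_mxP h := tB; rewrite h // mul0r.
have hw s : (L <= mdeg s)%N -> c0 / 2 * (mdeg s)%:R <= nrm (wt (fun j => B j j) s - rc l0).
  move=> hs.
  have -> : wt (fun j => B j j) s - rc l0 = rc (\sum_i q i * (s i)%:R - l0).
    rewrite /wt /rc rmorphB rmorph_sum /=; congr (_ - _); apply: eq_bigr => i _.
    by rewrite (hq i).1 rmorphM rmorph_nat.
  rewrite nrm_rc; apply: le_trans (ler_norm _).
  have h1 : c0 * (mdeg s)%:R <= \sum_i q i * (s i)%:R.
    rewrite /mdeg natr_sum mulr_sumr; apply: ler_sum => i _; apply: ler_wpM2r; [exact: ler0n|exact: (hq i).2].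
  have h2 : c0 * L%:R <= c0 * (mdeg s)%:R by rewrite ler_pM2l // ler_nat.
  by move: h1 h2 hl; lra.
have [u [ou hu]] := pde_triangular dT' b0 TX ellP (divr_gt0 c00 (ltr0Sn R 1)) L0 hw (ordM_sub cy hg).
exists (sub x u); split; first exact: ordM_sub.
have := Tm_conj cx cy xy T (rc l0) (sub x u); rewrite sub_yx // hu => /(congr1 (sub x)).
by rewrite !sub_xy.
Qed.

Lemma pde_iter (c0 : R) : 0 < c0 ->
  (forall mu l, ordM 1 l -> ~ ordM 2 l -> ordM 2 (Tm T mu l) -> exists2 q : R, mu = rc q & c0 <= q) ->
  forall (L : nat) (l0 : R), (0 < L)%N -> 2 * l0 <= c0 * L%:R ->
  forall N g, ordM L g -> exists u, ordM L u /\ itT T (rc l0) N u = g.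
Proof.
move=> c00 hev L l0 L0 hl; elim=> [|N IH] g hg; first by exists g.
have [w [ow <-]] := IH g hg; have [u [ou <-]] := pde c00 hev L0 hl ow.
by exists u; rewrite itTSr.
Qed.

(** A power of T - l j maps [ys j] into m^K. By [pde_iter] the result has a preimage in m^K, which
    is subtracted from [ys j]; as K >= 2, the linear parts do not change. *)
Lemma exact_eigen_coords (c0 : R) (K : nat) (ys : 'I_n -> germ) (l : 'I_n -> R) : 0 < c0 ->
  (forall j, ev (ys j) = 0) -> jac ys \in unitmx ->
  (forall j, gev T (@ordM R n K) (rc (l j)) (ys j)) -> (2 <= K)%N ->
  (forall j, c0 <= l j) -> (forall j, 2 * l j <= c0 * K%:R) ->
  exists zs : 'I_n -> germ, [/\ forall j, ev (zs j) = 0, jac zs \in unitmx &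
    forall j, gev T (fun a => a = 0) (rc (l j)) (zs j)].
Proof.
move=> c00 evy uj hy K2 lc lK.
have K0 : (0 < K)%N by apply: leq_trans K2.
(* The [ys] span m/m^2, so an eigenvalue mu of T there is one of the l j: otherwise a, of eigenvalue
   mu, would be independent of its own expansion in the [ys]. *)
have hev mu a : ordM 1 a -> ~ ordM 2 a -> ordM 2 (Tm T mu a) -> exists2 q : R, mu = rc q & c0 <= q.
  move=> a1 a2 aT; have [/existsP [j /eqP <-]|hmu] := boolP [exists j, rc (l j) == mu].
    by exists (l j).
  case: a2; pose J := @ordM R n 2.
  have sJ := gideal_subspace (@gideal_ordM R n 2).
  have TJ : forall a, J a -> J (T a) := @T_ordM R n T dT T0 2.
  pose v := (\row_k cf a (munit k 1)) *m invmx (jac ys)^T.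
  pose rs := undup [seq rc (l j) | j <- enum 'I_n].
  pose h nu := if nu == mu then - a else \sum_(j | rc (l j) == nu) gC (v 0 j) * ys j.
  have murs : mu \notin rs.
    rewrite mem_undup; apply/negP => /mapP [j _ E]; case/existsP: hmu; exists j; exact/eqP.
  have urs : uniq (mu :: rs) by rewrite /= murs undup_uniq.
  have := @gev_indep R n T dT J sJ TJ (mu :: rs) h urs _ _ mu (mem_head _ _).
  have hm : h mu = - a by rewrite /h eqxx.
  rewrite hm => ha; rewrite -[a]opprK; apply: ordMN; apply: ha.
    move=> nu _; rewrite /h; case: eqP => [->|_].
      rewrite -sub0r; apply: gevB => //; last by exists 1%N.
      by apply: gev_S; exact: ordM_zero.
    apply: gev_sum => // j /eqP <-; apply: gevZ => //; case: (hy j) => N hN.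
    by exists N; exact: ordM_weak hN.
  rewrite big_cons hm addrC (_ : \sum_(nu <- rs) h nu = \sum_j gC (v 0 j) * ys j).
    apply: ordM2P => [|k].
      by apply: ordMB => //; apply: ordM_sum => j _; apply: ordM_mulr; apply/ordM1P.
    rewrite cf_sub cf_sum; apply/eqP; rewrite subr_eq0; apply/eqP.
    transitivity ((v *m (jac ys)^T) 0 k); last by rewrite /v mulmxKV ?unitmx_tr // mxE.
    by rewrite mxE; apply: eq_bigr => j _; rewrite cf_gCM !mxE.
  rewrite (eq_big_seq (fun nu => \sum_(j | rc (l j) == nu) gC (v 0 j) * ys j)); last first.
    by move=> nu nurs; rewrite /h; case: eqP => // E; rewrite -E nurs in murs.
  rewrite (exchange_big_dep xpredT) //=; apply: eq_bigr => j _.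
  rewrite (eq_bigl (fun nu => nu == rc (l j))) => [|nu]; last by rewrite eq_sym.
  rewrite -big_filter filter_pred1_uniq ?undup_uniq ?big_seq1 //.
  by rewrite mem_undup; apply/mapP; exists j; rewrite ?mem_enum.
have /choice [u hu] : forall j, exists u, ordM K u /\ exists N, itT T (rc (l j)) N (ys j - u) = 0.
  move=> j; have [N hN] := hy j.
  have [u [ou hu]] := pde_iter c00 hev K0 (lK j) N hN.
  by exists u; split => //; exists N; rewrite itTB // hu subrr.
exists (fun j => ys j - u j); split.
- move=> j; rewrite rmorphB /= evy; apply/eqP; rewrite sub0r oppr_eq0; apply/eqP/ordM1P.
  by apply: ordM_weak (hu j).1.
- rewrite (_ : jac _ = jac ys) //; apply/matrixP => i j; rewrite !mxE cf_sub [X in _ - X](hu j).1 ?subr0 //.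
  by rewrite mdeg_unit.
- by move=> j; exact: (hu j).2.
Qed.
End CoordinateFreePDE.

Lemma nat_min (P : nat -> Prop) : (exists k, P k) -> exists2 k, P k & forall j, P j -> (k <= j)%N.
Proof.
move=> [k0 hk0]; have ex : exists k, `[< P k >] by exists k0; exact/asboolP.
have [k /asboolP hk hmin] := ex_minnP ex.
by exists k => // j /asboolP; exact: hmin.
Qed.

(** * A local monomial order and Dickson's lemma *)

Section MonomialOrder.
Variable n : nat.
Local Notation mon := {ffun 'I_n -> nat}.
Implicit Types (s t u : mon) (E : mon -> Prop).

(** Degree first, then the last coordinate where the exponents differ. Low degree counts as small,
    so the least exponent of a series is its initial one. *)
Definition mlt s t := (mdeg s < mdeg t)%N \/
  (mdeg s = mdeg t /\ exists j, (s j < t j)%N /\ forall k : 'I_n, (j < k)%N -> s k = t k).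

Lemma mlt_total s t : s <> t -> mlt s t \/ mlt t s.
Proof.
move=> st; case: (ltngtP (mdeg s) (mdeg t)) => [h|h|h]; [by left; left|by right; left|].
have [j0 hj0] : exists j, s j != t j.
  apply/existsP; rewrite -negb_forall; apply: contra_notN st => /forallP h'.
  by apply/ffunP => j; apply/eqP.
pose Q (j : 'I_n) := s j != t j.
have [j hj hmax] := @arg_maxnP _ j0 Q (fun j => val j) hj0.
have hk (k : 'I_n) : (j < k)%N -> s k = t k.
  by move=> jk; apply/eqP/negPn/negP => /hmax; rewrite /= leqNgt jk.
case: (ltngtP (s j) (t j)) => [h1|h1|h1]; last by rewrite /Q h1 eqxx in hj.
  by left; right; split => //; exists j.
by right; right; split => //; exists j; split => // k jk; rewrite hk.
Qed.

(* A linear weight refining the graded lexicographic order [mlt] below degree [B]. *)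
Definition bw B (j : 'I_n) := (B ^ n + B ^ j)%N.

Lemma rk_bw B s : rk (bw B) s = (B ^ n * mdeg s + \sum_(j < n) B ^ j * s j)%N.
Proof. by rewrite /rk /mdeg big_distrr -big_split; apply: eq_bigr => j _; rewrite mulnDl. Qed.

(** Each term is at most B^(m-1) s_k, and the s_k add up to less than B. *)
Lemma small_digits B s (Q : pred 'I_n) m : (mdeg s < B)%N -> (forall k, Q k -> (k < m)%N) ->
  (\sum_(k < n | Q k) B ^ k * s k < B ^ m)%N.
Proof.
move=> sB Qm; have B0 : (0 < B)%N by apply: leq_ltn_trans sB.
rewrite -(ltn_pmul2r B0); apply: (@leq_ltn_trans (B ^ m * mdeg s)); last first.
  by rewrite ltn_pmul2l ?expn_gt0 ?B0.
rewrite /mdeg [in leqRHS](bigID Q) mulnDr /=; apply: (leq_trans _ (leq_addr _ _)).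
rewrite big_distrl big_distrr /=; apply: leq_sum => k /Qm km.
by rewrite mulnAC -expnSr leq_mul2r leq_pexp2l ?orbT.
Qed.

Lemma mlt_rk B s t : (mdeg s < B)%N -> mlt s t -> (rk (bw B) s < rk (bw B) t)%N.
Proof.
move=> sB; rewrite !rk_bw => -[h|[st [j [h1 h2]]]].
  apply: (@leq_trans (B ^ n * (mdeg s).+1)).
    by rewrite mulnSr ltn_add2l; apply: small_digits.
  by apply: (leq_trans _ (leq_addr _ _)); rewrite leq_mul2l h orbT.
rewrite -st ltn_add2l (bigD1 j) //= [ltnRHS](bigD1 j) //=.
rewrite (bigID (fun k : 'I_n => (k < j)%N)) /= [X in (_ < _ + X)%N](bigID (fun k : 'I_n => (k < j)%N)) /=.
set S1 := (\sum_(i | (i != j) && (i < j)) _)%N; set S2 := (\sum_(i | (i != j) && ~~ (i < j)) _)%N.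
have -> : (\sum_(i < n | (i != j) && ~~ (i < j)) B ^ i * t i = S2)%N.
  apply: eq_bigr => k /andP[kj]; rewrite -leqNgt leq_eqVlt => /orP[/eqP/val_inj E|jk]; last by rewrite h2.
  by rewrite E eqxx in kj.
rewrite !addnA ltn_add2r; apply: (leq_trans _ (leq_addr _ _)).
apply: (@leq_trans (B ^ j * (s j).+1)); last by rewrite leq_mul2l h1 orbT.
by rewrite mulnSr ltn_add2l; apply: small_digits => // k /andP[].
Qed.

(** Minimise the degree m, then the rank for [bw m.+1], which is strictly increasing for [mlt] on
    exponents of degree m. *)
Lemma mlt_min E : (exists s, E s) -> exists2 s, E s & forall t, E t -> t <> s -> mlt s t.
Proof.
move=> [s0 Es0].
have [|m [s1 [Es1 m1]] hm] := @nat_min (fun m => exists s, E s /\ mdeg s = m); first by exists (mdeg s0), s0.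
have [|r [s [Es [sm sr]]] hr] := @nat_min (fun r => exists s, E s /\ (mdeg s = m /\ rk (bw m.+1) s = r)).
  by exists (rk (bw m.+1) s1), s1.
exists s => // t Et ts.
have [//|[h|[h h']]] : mlt s t \/ mlt t s by apply: mlt_total => /esym.
- by have := hm _ (ex_intro _ t (conj Et erefl)); rewrite -sm leqNgt h.
- have tm : mdeg t = m by rewrite h.
  have := hr _ (ex_intro _ t (conj Et (conj tm erefl))).
  by rewrite -sr leqNgt mlt_rk //; [rewrite tm | right].
Qed.

(** Each index is followed by one, further on, at which u is minimal among all remaining values. *)
Lemma mono_subseq (u : nat -> nat) : exists2 phi : nat -> nat,
  {homo phi : k l / (k < l)%N} & forall k l, (k <= l)%N -> (u (phi k) <= u (phi l))%N.
Proof.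
have /choice [g hg] : forall N, exists k, (N <= k)%N /\ forall j, (N <= j)%N -> (u k <= u j)%N.
  move=> N; have [|m [k [Nk <-]] hm] := @nat_min (fun m => exists k, (N <= k)%N /\ u k = m).
    by exists (u N), N.
  by exists k; split => // j Nj; apply: hm; exists j.
pose phi k := iter k (fun m => g m.+1) (g 0%N).
have phiS k : (phi k < phi k.+1)%N by have [] := hg (phi k).+1.
have phiN k : exists2 N, phi k = g N & (N <= phi k)%N.
  by case: k => [|k]; [exists 0%N | exists (phi k).+1].
have hphi := homo_ltn ltn_trans phiS.
exists phi => // k l; rewrite leq_eqVlt => /orP[/eqP -> //|kl].
have [N E N1] := phiN k; rewrite {1}E; apply: (hg N).2.
by apply: (leq_trans N1); exact/ltnW/hphi.
Qed.

(** Monotone subsequences are extracted one coordinate at a time. *)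
Lemma dickson_seq (v : nat -> mon) : exists i j, (i < j)%N /\ forall k, (v i k <= v j k)%N.
Proof.
suff h r : exists2 phi : nat -> nat, {homo phi : k l / (k < l)%N} &
    forall k l, (k <= l)%N -> forall i : 'I_n, (i < r)%N -> (v (phi k) i <= v (phi l) i)%N.
  by have [phi h1 h2] := h n; exists (phi 0%N), (phi 1%N); split => [|k]; [exact: h1 | exact: h2].
elim: r => [|r [phi h1 h2]]; first by exists id.
case: (ltnP r n) => rn; last first.
  by exists phi => // k l kl i _; apply: h2 => //; apply: leq_trans rn.
have [psi g1 g2] := mono_subseq (fun k => v (phi k) (Ordinal rn)).
exists (phi \o psi) => [k l kl|k l kl i]; first exact/h1/g1.
rewrite ltnS leq_eqVlt => /orP[/eqP ir|ir].
  by rewrite (_ : i = Ordinal rn) /=; [exact: g2 | exact: val_inj].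
apply: h2 => //; move: kl; rewrite leq_eqVlt => /orP[/eqP -> //|kl].
exact/ltnW/g1.
Qed.

(** Otherwise exponents of E lying above none of the previous ones could be chosen forever, against
    [dickson_seq]. *)
Lemma dickson E : exists l : seq mon, (forall s, s \in l -> E s) /\
  forall s, E s -> exists2 t, t \in l & forall k, (t k <= s k)%N.
Proof.
apply: contrapT => H.
have /choice [f hf] : forall l : seq mon, exists s, (forall t, t \in l -> E t) ->
    E s /\ forall t, t \in l -> ~ forall k, (t k <= s k)%N.
  move=> l; have [hl|hl] := pselect (forall t, t \in l -> E t); last by exists (mon0 n).
  apply: contrapT => H2; apply: H; exists l; split => // s Es.
  apply: contrapT => H3; apply: H2; exists s => _; split => // t tl ts; apply: H3.
  by exists t.
pose L k := iter k (fun l => f l :: l) [::].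
have EL k t : t \in L k -> E t.
  elim: k t => [|k IH] t //=; rewrite inE => /orP[/eqP ->|]; last exact: IH.
  by case: (hf (L k) IH).
have uL i j : (i < j)%N -> f (L i) \in L j.
  elim: j => // j IH; rewrite ltnS leq_eqVlt => /orP[/eqP -> /=|/IH h /=]; first exact: mem_head.
  by rewrite inE h orbT.
have [i [j [ij h]]] := dickson_seq (fun k => f (L k)).
by have [_ h2] := hf (L j) (@EL j); exact: h2 _ (uL _ _ ij) h.
Qed.
End MonomialOrder.

(** * Division, standard bases and Krull's intersection theorem *)

Section Division.
Variables (R : realType) (n : nat).
Local Notation C := (CC R).
Local Notation germ := (germ R n).
Local Notation gC := (gC n).
Local Notation mon := {ffun 'I_n -> nat}.
Local Notation gm := (gm R).
Implicit Types (s t u : mon) (a g r : germ).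

Definition msub t u : mon := [ffun k => (t k - u k)%N].
Lemma msubK t u : (forall k, (u k <= t k)%N) -> madd (msub t u) u = t.
Proof. by move=> h; apply/ffunP => k; rewrite !ffunE subnK. Qed.
Lemma maddK t u : msub (madd t u) u = t.
Proof. by apply/ffunP => k; rewrite !ffunE addnK. Qed.

Lemma convergent_dom (c d : mon -> C) t : convergent d ->
  (forall s, nrm (c s) <= nrm (d (madd s t))) -> convergent c.
Proof.
move=> [K [r [r0 hd]]] h; exists (K * r ^+ mdeg t), r; split => // s.
by apply: (le_trans (h s)); rewrite -mulrA -exprD addnC -mdegD.
Qed.

Section DivisionBy.
Variables (m : nat) (e : 'I_m -> mon) (p : 'I_m -> germ) (b : 'I_n -> nat).
Hypotheses (b0 : forall i, (0 < b i)%N) (p1 : forall i, cf (p i) (e i) = 1)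
  (pe : forall i t, cf (p i) t != 0 -> t <> e i -> (rk b (e i) < rk b t)%N).

(** Fixes one divisor of each exponent, so that every monomial is reduced in a single way. *)
Definition above t : option 'I_m := [pick i | [forall k, (e i k <= t k)%N]].
Lemma aboveP t i : above t = Some i -> forall k, (e i k <= t k)%N.
Proof. by rewrite /above; case: pickP => // j /forallP h [<-]. Qed.

Let tl i := p i - gm (e i).
Let tlP i t : cf (tl i) t != 0 -> (rk b (e i) < rk b t)%N.
Proof.
rewrite cf_sub cf_gm; have [->|/eqP te] := eqVneq t (e i); first by rewrite p1 subrr eqxx.
by rewrite subr0 => h; exact: pe h te.
Qed.

(** Reduction of a monomial: when e_i is chosen below t, x^t = x^(t - e_i) p_i + phi t, and the
    exponents of phi t have larger rank. *)
Let phi t s : C := if above t is Some i then - cf (gm (msub t (e i)) * tl i) s else 0.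
Let phiP t s : phi t s != 0 -> (rk b t < rk b s)%N.
Proof.
rewrite /phi; case E: (above t) => [i|]; last by rewrite eqxx.
rewrite oppr_eq0 => /supp_gmM [s' -> /tlP h]; rewrite -{1}(msubK (aboveP E)) !rkD addnC.
by rewrite ltn_add2r.
Qed.

Lemma sum_pick (N : nat) (P : pred mon) (w : mon -> C) u : (mdeg u < N)%N ->
  \sum_(t <- mons n N | P t) w t * (t == u)%:R = if P u then w u else 0.
Proof.
rewrite -mem_mons => uN; rewrite big_mkcond (bigD1_seq u) ?mons_uniq //= eqxx mulr1.
by rewrite big1 ?addr0 // => t tu; rewrite (negPf tu) mulr0; case: ifP.
Qed.

(** The solution v of v = g + sum_t v_t phi_t gives the total coefficient with which each monomial
    is met during the reduction. The part of v assigned to e_i, divided by x^(e_i), is the i-th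
    quotient; the unassigned part is the remainder. *)
Lemma division g : exists (a : 'I_m -> germ) r, g = \sum_i a i * p i + r /\
  forall s i, (forall k, (e i k <= s k)%N) -> cf r s = 0.
Proof.
have h20 : 0 < 2^-1 :> R by rewrite invr_gt0.
have [tE [tE0 tE1 hE]] := small_tails b0 tlP h20.
have [tG [G [tG0 tG1 hG]]] := convergent_wb b0 (svalP g).
pose tau := tE * tG.
have t0 : 0 < tau by exact: mulr_gt0.
have tlE : tau <= tE by rewrite -[leRHS]mulr1; apply: ler_wpM2l => //; exact: ltW.
have tlG : tau <= tG by rewrite -[leRHS]mul1r; apply: ler_wpM2r => //; exact: ltW.
have t1 : tau <= 1 := le_trans tlG tG1.
have hcol t : wb b tau (phi t) (tau ^+ rk b t / 2).
  rewrite /phi; case E: (above t) => [i|]; last first.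
    by apply: wb_weak (wb_zero _ _); rewrite divr_ge0 ?exprn_ge0 // ltW.
  have := wb_scale (-1) (wb_gm (msub t (e i)) (ltW t0) (hE tau t0 tlE i)).
  have -> : nrm (-1 : C) * (tau ^+ rk b (msub t (e i)) * (2^-1 * tau ^+ rk b (e i))) = tau ^+ rk b t / 2.
    by rewrite nrmN nrm1 mul1r mulrCA -exprD -rkD (msubK (aboveP E)) mulrC.
  have -> // : (fun s => -1 * cf (gm (msub t (e i)) * tl i) s) = (fun s => - cf (gm (msub t (e i)) * tl i) s).
  by apply/funext => s; rewrite mulN1r.
have [v [vE wv]] := neumann b0 t0 hcol (hG tau t0 tlG).
have cv : convergent v := wb_convergent t0 t1 wv.
have cr : convergent (fun s => if above s is None then v s else 0).
  apply: (@convergent_dom _ _ (mon0 n) cv) => s; rewrite madd0.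
  by case: (above s) => [i|] //; rewrite nrm0 nrm_ge0.
have ca i : convergent (fun u => if above (madd u (e i)) == Some i then v (madd u (e i)) else 0).
  apply: (@convergent_dom _ _ (e i) cv) => s.
  by case: ifP => _ //; rewrite nrm0 nrm_ge0.
pose r : germ := exist _ _ cr; pose a i : germ := exist _ _ (ca i).
exists a, r; split; last first.
  move=> s i his; rewrite /r /cf /= /above; case: pickP => // /(_ i) /negP [].
  exact/forallP.
apply: cf_inj; apply/funext => s.
(* N exceeds rk s by the degrees of the e_i, so that truncation at degree N leaves the quotients
   unchanged up to degree rk s. *)
pose M0 := (\sum_i mdeg (e i))%N; pose N := ((rk b s).+1 + M0)%N.
have M0i i : (mdeg (e i) <= M0)%N by rewrite /M0 (bigD1 i) //= leq_addr.
have sN : (mdeg s < N)%N by rewrite /N addSn ltnS (leq_trans (mdeg_le_rk b0 s)) // leq_addr.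
pose aN i : germ := \sum_(t <- mons n N | above t == Some i) gC (v t) * gm (msub t (e i)).
have haN i : ordM (rk b s).+1 (a i - aN i).
  move=> u hu; rewrite cf_sub /aN cf_sum.
  rewrite (eq_bigr (fun t => v t * (t == madd u (e i))%:R)); last first.
    move=> t /eqP ht; rewrite cf_gCM cf_gm; congr (_ * (nat_of_bool _)%:R).
    apply/eqP/eqP => [->|->]; last by rewrite maddK.
    by rewrite msubK //; exact: aboveP.
  rewrite sum_pick ?subrr // mdegD /N; apply: (@leq_trans ((rk b s).+1 + mdeg (e i))).
    by rewrite ltn_add2r.
  by rewrite leq_add2l.
have -> : cf (\sum_i a i * p i + r) s = cf (\sum_i aN i * p i) s + cf r s.
  rewrite cf_add; congr (_ + _); apply/eqP; rewrite -subr_eq0 -cf_sub -sumrB; apply/eqP.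
  have : ordM (rk b s).+1 (\sum_i (a i * p i - aN i * p i)).
    by apply: ordM_sum => i _; rewrite -mulrBl; exact: ordM_mull.
  by apply; rewrite ltnS mdeg_le_rk.
have -> : cf (\sum_i aN i * p i) s = \sum_i \sum_(t <- mons n N | above t == Some i) (v t * (t == s)%:R - v t * phi t s).
  rewrite cf_sum; apply: eq_bigr => i _; rewrite /aN mulr_suml cf_sum; apply: eq_bigr => t /eqP ht.
  rewrite -mulrA cf_gCM /phi ht -mulrBr opprK; congr (_ * _).
  have -> : p i = gm (e i) + tl i by rewrite /tl addrC subrK.
  by rewrite mulrDr -gm_add (msubK (aboveP ht)) cf_add cf_gm eq_sym.
rewrite (exchange_big_dep (fun t => above t : bool)) /=; last by move=> i t _ /eqP ->.
rewrite (eq_bigr (fun t => v t * (t == s)%:R - v t * phi t s)); last first.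
  move=> t; case E: (above t) => [i|] // _; rewrite (bigD1 i) //= big1 ?addr0 // => j /andP[/eqP [->]].
  by rewrite eqxx.
rewrite sumrB sum_pick //.
have -> : \sum_(t <- mons n N | above t) v t * phi t s = \sum_(t <- rklist b (rk b s)) v t * phi t s.
  rewrite (bigID (fun t => rk b t < rk b s)%N) /= [X in _ + X]big1 ?addr0; last first.
    by move=> t /andP[_ ht]; apply/eqP; rewrite mulf_eq0; apply/orP; right; apply: contraNT ht; exact: phiP.
  rewrite [RHS](bigID (fun t => above t : bool)) /= [X in _ = _ + X]big1 ?addr0; last first.
    by move=> t ht; rewrite /phi; case: (above t) ht => // _; rewrite mulr0.
  rewrite -big_filter -[RHS]big_filter; apply: perm_big; apply: uniq_perm.
  - exact/filter_uniq/mons_uniq.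
  - exact/filter_uniq/rklist_uniq.
  move=> t; rewrite mem_filter mem_mons [RHS]mem_filter mem_rklist //; case: (above t) => //= _.
  case: ltnP => //= h; rewrite /N addSn ltnS (leq_trans (mdeg_le_rk b0 t)) //.
  by rewrite (leq_trans (ltnW h)) ?leq_addr.
rewrite (_ : cf g s = v s - \sum_(t <- rklist b (rk b s)) v t * phi t s); last by rewrite {1}(vE s) addrK.
rewrite addrAC; congr (_ - _); rewrite /r /=.
by case: (above s) => [i|]; rewrite ?addr0 ?add0r.
Qed.
End DivisionBy.

Definition lead a s := cf a s != 0 /\ forall t, cf a t != 0 -> t <> s -> mlt s t.
(** Closure for the m-adic topology, the intersection of all J + m^K. *)
Definition gclosure (J : germ -> Prop) a := forall K, exists2 c, J c & ordM K (a - c).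

Lemma lead_exists a : a <> 0 -> exists s, lead a s.
Proof.
move=> a0; have [|s h1 h2] := @mlt_min n (fun s => cf a s != 0); last by exists s.
apply: contra_notP a0 => h; apply: cf_inj; apply/funext => s; rewrite cf0.
by apply/eqP/negPn/negP => hs; apply: h; exists s.
Qed.

Section Generation.
Variable J : germ -> Prop.
Hypothesis iJ : gideal J.

Lemma gclosure_incl a : J a -> gclosure J a.
Proof. by move=> h K; exists a => //; rewrite subrr; exact: ordM_zero. Qed.

Lemma gclosure_ideal : gideal (gclosure J).
Proof.
have [J0 JD JM] := iJ; split => [|a c ha hc K|a c hc K]; first exact: gclosure_incl.
  have [a' h1 h2] := ha K; have [c' h3 h4] := hc K; exists (a' + c'); first exact: JD.
  by rewrite opprD addrACA; exact: ordMD.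
have [c' h3 h4] := hc K; exists (a * c'); first exact: JM.
by rewrite -mulrBr; exact: ordM_mulr.
Qed.

(* Dividing by a standard basis leaves a remainder whose initial exponent cannot
   be an initial exponent of [J]; this gives Krull's intersection theorem and the
   generation statement at the same time. *)
Lemma standard_basis_generates m (e : 'I_m -> mon) (q : 'I_m -> germ) :
  (forall i, gclosure J (q i)) -> (forall i, cf (q i) (e i) = 1) -> (forall i, lead (q i) (e i)) ->
  (forall a s, J a -> lead a s -> exists i, forall k, (e i k <= s k)%N) ->
  forall a, gclosure J a -> exists c : 'I_m -> germ, a = \sum_i c i * q i.
Proof.
move=> hq q1 ql cover a ha.
pose B := (\sum_i mdeg (e i)).+1.
have eB i : (mdeg (e i) < B)%N by rewrite /B ltnS (bigD1 i) //= leq_addr.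
have b0 (i : 'I_n) : (0 < bw B i)%N by rewrite /bw addn_gt0 expn_gt0.
have pe i t : cf (q i) t != 0 -> t <> e i -> (rk (bw B) (e i) < rk (bw B) t)%N.
  by move=> h1 h2; apply: mlt_rk => //; exact: (ql i).2.
have [c [r [E hr]]] := division b0 q1 pe a.
exists c; rewrite {1}E; suff -> : r = 0 by rewrite addr0.
have sI := gideal_subspace gclosure_ideal; have [_ _ IM] := gclosure_ideal.
have Ir : gclosure J r.
  have -> : r = a - \sum_i c i * q i by rewrite E addrC addKr.
  apply: (subspaceB sI ha); apply: (@subspace_sum _ _ (gclosure J) _ _ _ (fun i => c i * q i) sI).
  by move=> i _; exact: IM.
apply: contrapT => /lead_exists [s [s0 hs]].
(* An element of J that agrees with r up to degree |s| has the same initial exponent s. *)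
have [d Jd od] := Ir (mdeg s).+1.
have dE t : (mdeg t <= mdeg s)%N -> cf d t = cf r t.
  by move=> ts; have := od t ts; rewrite cf_sub => /subr0_eq.
have [i hi] : exists i, forall k, (e i k <= s k)%N.
  apply: (cover d s Jd); split => [|t t0 ts]; first by rewrite dE.
  case: (leqP (mdeg t) (mdeg s)) => h; last by left.
  by apply: hs => //; rewrite -dE.
by move: s0; rewrite (hr s i hi) eqxx.
Qed.

(** Dickson's lemma for the set of initial exponents of J, with representatives scaled to initial
    coefficient 1. *)
Lemma standard_basis : exists m (e : 'I_m -> mon) (p : 'I_m -> germ),
  [/\ forall i, J (p i), forall i, cf (p i) (e i) = 1, forall i, lead (p i) (e i) &
   forall a s, J a -> lead a s -> exists i, forall k, (e i k <= s k)%N].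
Proof.
have [l [hl cover]] := dickson (fun s => exists2 a, J a & lead a s).
have sJ := gideal_subspace iJ; have [_ _ JZ] := sJ.
have /choice [p hp] : forall i : 'I_(size l), exists a, [/\ J a, cf a (nth (mon0 n) l i) = 1 & lead a (nth (mon0 n) l i)].
  move=> i; set s := nth _ l i; have [a Ja [s0 hs]] := hl s (mem_nth _ (ltn_ord i)).
  exists (gC (cf a s)^-1 * a); split; rewrite ?cf_gCM ?mulVf //; first exact: JZ.
  split; first by rewrite cf_gCM mulVf // oner_neq0.
  by move=> t; rewrite cf_gCM mulf_eq0 negb_or => /andP[_]; exact: hs.
exists (size l), (fun i => nth (mon0 n) l i), p; split=> [i|i|i|a s Ja ls]; try by case: (hp i).
have [t tl ts] := cover s (ex_intro2 _ _ a Ja ls).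
move: (tl); rewrite -index_mem => il; by exists (Ordinal il) => k /=; rewrite nth_index.
Qed.

(** Krull's theorem: a standard basis generates the closure, and its elements belong to J. *)
Lemma gclosure_closed a : gclosure J a -> J a.
Proof.
have [m [e [p [Jp p1 pl cover]]]] := standard_basis.
move=> ha; have [c ->] := standard_basis_generates (fun i => gclosure_incl (Jp i)) p1 pl cover ha.
have [_ _ JM] := iJ; apply: subspace_sum; first exact: gideal_subspace.
by move=> i _; exact: JM.
Qed.
End Generation.
End Division.

(** * Quasihomogeneous form of f and of generators of an ideal *)

Section QuasihomogeneousCoordinates.
Variables (R : realType) (n : nat).
Local Notation C := (CC R).
Local Notation V := 'rV[C]_n.
Local Notation germ := (germ R n).
Local Notation gX := (gX R).
Local Notation gC := (gC n).
Local Notation mon := {ffun 'I_n -> nat}.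
Implicit Types (s t : mon) (a b : germ).

Lemma rc_ratr (q : rat) : rc (ratr q : R) = ratr q.
Proof. exact: (fmorph_rat (real_complex R)). Qed.

Lemma gconj_ev (T : germ -> germ) x y : gderivation T -> (forall i, ev (T (gX i)) = 0) -> cmap x -> cmap y ->
  forall i, ev (gconj x y T (gX i)) = 0.
Proof.
move=> dT T0 cx cy i; rewrite /gconj ev_sub //; apply/ordM1P/(T_ordM dT T0)/(ordM_sub cx).
exact: ordM1_gX.
Qed.

Section Coordinates.
Variables (T : germ -> germ) (F : germ) (d : nat).
Hypotheses (dT : gderivation T) (T0 : forall i, ev (T (gX i)) = 0) (TF : T F = F) (F3 : ordM 3 F).
Hypothesis FC : forall l, ev l = 0 -> exists2 D, gderivation D & l ^+ d = D F.

Lemma exact_rational_coords : exists (zs : 'I_n -> germ) (q : 'I_n -> rat),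
  [/\ forall i, 0 < q i < 1 / 2, forall j, ev (zs j) = 0, jac zs \in unitmx &
      forall j, gev T (fun a => a = 0) (ratr (q j)) (zs j)].
Proof.
(* K exceeds d + 1, so the monomials x_i^k x_j with k <= d are visible modulo m^K, and it exceeds 2
   d + 1, so that c0 K >= 1 >= 2 q_i. *)
pose K := (2 * d).+2.
have [ys [lam [evy uj hy]]] := eigen_coords dT T0 (ltn0Sn (2 * d).+1 : (0 < K)%N).
have [x [y [cx cy xy yx xE]]] := germ_coords evy uj.
have sy j : sub y (ys j) = gX j by rewrite -xE -sub_gX // sub_yx.
pose T1 := gconj x y T; pose F1 := sub y F.
have dT1 : gderivation T1 by exact: gder_conj.
have T10 := gconj_ev dT T0 cx cy.
have hX j : gev T1 (@ordM R n K) (lam j) (gX j).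
  by rewrite -sy; apply: (gev_conj cx cy xy _ (hy j)) => a; exact: ordM_sub.
have TF1 : T1 F1 = F1 by rewrite /T1 /F1 gconj_sub // TF.
have /choice [k hk] : forall i, exists k, exists j, (2 <= k <= d)%N /\ lam i * k%:R + lam j = 1.
  move=> i; have [|D dD hD] := FC (l := sub x (gX i)); first by rewrite ev_sub // ev_gX.
  have E : gX i ^+ d = \sum_j gconj x y D (gX j) * gd j F1.
    transitivity (gconj x y D F1); first by rewrite /F1 gconj_sub // -hD subX // sub_yx.
    exact: (congr1 (fun G => G F1) (gderE (gder_conj cx cy yx dD))).
  have [j [k [kd nz]]] := axis_monomial E; exists k, j.
  have ms : mdeg (madd (munit i k) (munit j 1)) = k.+1 by rewrite mdegD !mdeg_unit addn1.
  split.
    (* For k <= 1 the monomial would have degree at most 2, impossible in an element of m^3. *)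
    rewrite kd andbT ltnNge; apply: contra nz => k1; apply/eqP; apply: (ordM_sub cy F3).
    by rewrite ms ltnS.
  have sK : (mdeg (madd (munit i k) (munit j 1)) < K)%N.
    by rewrite ms /K !ltnS (leq_trans kd) // leq_pmull.
  by have := weight_one dT1 T10 hX TF1 sK nz; rewrite wt_add !wt_unit mulr1.
have [j hj] := choice hk.
have [q [lamE hq]] := rational_weights (fun i => (hj i).1) (fun i => (hj i).2).
(* The denominator 2 d + 1 instead of 2 d covers d = 0; the value lies below every weight since 1 <=
   q i * 2 d. *)
pose c0 : R := (2 * d).+1%:R^-1.
have c00 : 0 < c0 by rewrite invr_gt0.
have qK (i : 'I_n) : (0 < ratr (q i) :> R) /\ (2 * (ratr (q i) : R) <= 1) /\ (1 <= (ratr (q i) : R) * (2 * d)%:R).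
  have [/andP[q0 q2] q1] := hq i; split; first by rewrite ltr0q.
  split; last by rewrite -(ratr_nat _ (2 * d)) -rmorphM -(rmorph1 ratr) ler_rat.
  have : ratr (2 * q i) <= ratr 1 :> R by rewrite ler_rat; move: q2; lra.
  by rewrite rmorphM rmorph1 rmorph_nat.
have hy' i : gev T (@ordM R n K) (rc (ratr (q i))) (ys i) by rewrite rc_ratr -lamE; exact: hy.
have c0q i : c0 <= ratr (q i).
  have [h1 [h2 h3]] := qK i; rewrite /c0 -[leLHS]mul1r ler_pdivrMr //; apply: (le_trans h3).
  by rewrite ler_pM2l // ler_nat.
have qc0 i : 2 * ratr (q i) <= c0 * K%:R.
  have [h1 [h2 h3]] := qK i; apply: (le_trans h2); rewrite /c0 mulrC ler_pdivlMr // mul1r ler_nat.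
  by rewrite /K leqnSn.
have [zs [evz uz hz]] := exact_eigen_coords dT T0 c00 evy uj hy' (isT : (1 < K)%N) c0q qc0.
by exists zs, q; split => // [i|i]; [case: (hq i) | rewrite -rc_ratr; exact: hz].
Qed.

Lemma convergent_cpart (lam : 'I_n -> C) nu a : convergent (fun s => if wt lam s == nu then cf a s else 0).
Proof.
apply: (@convergent_dom _ _ _ (cf a) (mon0 n) (svalP a)) => s; rewrite madd0.
by case: ifP => _ //; rewrite nrm0 nrm_ge0.
Qed.
(** The full component of weight nu, whereas [wpart] stops at degree K; suppressing coefficients
    keeps the series convergent. *)
Definition cpart lam nu a : germ := exist _ _ (convergent_cpart lam nu a).
Lemma cf_cpart lam nu a s : cf (cpart lam nu a) s = if wt lam s == nu then cf a s else 0.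
Proof. by []. Qed.

Lemma wt_ratr (q : 'I_n -> rat) s : wt (fun i => ratr (q i)) s = ratr (weight q s) :> C.
Proof. by rewrite /wt /weight rmorph_sum; apply: eq_bigr => i _; rewrite rmorphM rmorph_nat. Qed.

Variable J : germ -> Prop.
Hypotheses (iJ : gideal J) (TJ : forall a, J a -> J (T a)) (J0 : forall a, J a -> ev a = 0).

Theorem quasihomogeneous_coordinates : exists (x y : V -> V) (q : 'I_n -> rat),
  [/\ [/\ cmap x, cmap y, \forall p \near (0 : V), y (x p) = p & \forall q \near (0 : V), x (y q) = q],
    forall i, 0 < q i < 1 / 2,
    forall s, cf (sub y F) s != 0 -> weight q s = 1 &
    exists m (h : 'I_m -> germ) (w : 'I_m -> rat),
      [/\ forall i, 0 < w i, forall i, J (h i),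
          forall i s, cf (sub y (h i)) s != 0 -> weight q s = w i &
          forall a, J a -> exists c : 'I_m -> germ, a = \sum_i c i * h i]].
Proof.
have [zs [q [hq evz uz hz]]] := exact_rational_coords.
have [x [y [cx cy xy yx xE]]] := germ_coords evz uz.
pose lam i : C := ratr (q i).
have sy j : sub y (zs j) = gX j by rewrite -xE -sub_gX // sub_yx.
pose T2 := gconj x y T; pose F2 := sub y F; pose J2 a := J (sub x a).
have dT2 : gderivation T2 by exact: gder_conj.
have T20 := gconj_ev dT T0 cx cy.
have hX K j : gev T2 (@ordM R n K) (lam j) (gX j).
  rewrite -sy; apply: (gev_conj cx cy xy _ (hz j)) => a ->; rewrite sub0 //; exact: ordM_zero.
have TF2 : T2 F2 = F2 by rewrite /T2 /F2 gconj_sub // TF.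
have [JJ0 JD JM] := iJ.
have iJ2 : gideal J2.
  split=> [|a b ha hb|a b hb]; rewrite /J2; first by rewrite sub0.
    by rewrite subD //; exact: JD.
  by rewrite subM //; exact: JM.
have sJ2 := gideal_subspace iJ2; have [J20 J2D J2Z] := sJ2.
have TJ2 a : J2 a -> J2 (T2 a) by move=> ha; rewrite /J2 /T2 /gconj sub_xy //; exact: TJ.
(* For every K the space J2 + m^K is stable under T2, so it contains the truncated component, which
   agrees with [cpart] below degree K. *)
have J2c nu a : J2 a -> gclosure J2 (cpart lam nu a).
  move=> Ja K; pose JK a := exists2 b, J2 b & ordM K (a - b).
  have sJK : gsubspace JK.
    split; first by exists 0 => //; rewrite subrr; exact: ordM_zero.
      move=> a1 a2 [b1 h1 h2] [b2 h3 h4]; exists (b1 + b2); first exact: J2D.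
      by rewrite opprD addrACA; exact: ordMD.
    move=> k a1 [b1 h1 h2]; exists (gC k * b1); first exact: J2Z.
    by rewrite -mulrBr; exact: ordM_mulr.
  have TJK a1 : JK a1 -> JK (T2 a1).
    move=> [b1 h1 h2]; exists (T2 b1); first exact: TJ2.
    by rewrite -(gderB dT2); exact: (T_ordM dT2 T20).
  have SJK a1 : ordM K a1 -> JK a1 by move=> h; exists 0; rewrite ?subr0.
  have JKa : JK a by exists a => //; rewrite subrr; exact: ordM_zero.
  have [b Jb ob] := wpart_mem dT2 T20 (hX K) nu sJK TJK SJK JKa.
  by exists b => // s sK; have := ob s sK; rewrite !cf_sub cf_wpart // cf_cpart.
have [m [e [p [Jp p1 pl cover]]]] := standard_basis iJ2.
(* Keeping the weight of the initial exponent e i preserves this exponent and its coefficient, so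
   [standard_basis_generates] applies to the components. *)
pose qq i := cpart lam (wt lam (e i)) (p i).
have q1 i : cf (qq i) (e i) = 1 by rewrite cf_cpart eqxx.
have hqq i : gclosure J2 (qq i) by exact: J2c.
have ql i : lead (qq i) (e i).
  split; first by rewrite q1 oner_neq0.
  by move=> t; rewrite cf_cpart; case: ifP => _; [exact: (pl i).2 | rewrite eqxx].
have gen := standard_basis_generates iJ2 hqq q1 ql cover.
exists x, y, q; split => //.
  move=> s hs; have := weight_one dT2 T20 (hX (mdeg s).+1) TF2 (ltnSn _) hs.
  by rewrite /lam wt_ratr -(rmorph1 ratr) => /fmorph_inj.
exists m, (fun i => sub x (qq i)), (fun i => weight q (e i)); split=> [i|i|i s|a Ja].
- have Jq : J (sub x (qq i)) by exact: (gclosure_closed iJ2).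
  (* Elements of J vanish at 0, so the initial exponent is nonzero and its weight is positive. *)
  have ei0 : e i <> mon0 n.
    move=> E; have := J0 Jq; rewrite ev_sub // ev_cf -E q1 => /eqP; by rewrite oner_eq0.
  have [k hk] : exists k, e i k != 0%N.
    apply/existsP; rewrite -negb_forall; apply: contra_notN ei0 => /forallP h.
    by apply/ffunP => k; rewrite ffunE; apply/eqP.
  have q0 k' : 0 < q k' by case/andP: (hq k').
  rewrite /weight (bigD1 k) //=; apply: ltr_wpDr; last by rewrite mulr_gt0 // ltr0n lt0n.
  by apply: sumr_ge0 => k' _; rewrite mulr_ge0 // ltW.
- exact: (gclosure_closed iJ2).
- rewrite sub_yx // cf_cpart; case: ifP => [/eqP|]; last by rewrite eqxx.
  by rewrite /lam !wt_ratr => /fmorph_inj.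
- have Ja2 : J2 (sub y a) by rewrite /J2 sub_xy.
  have [c E] := gen _ (gclosure_incl Ja2); exists (fun i => sub x (c i)).
  rewrite -[LHS](sub_xy cx cy xy) E sub_sum //; apply: eq_bigr => i _; by rewrite subM.
Qed.
End Coordinates.
End QuasihomogeneousCoordinates.

(** * Logarithmic derivations and the ideal df(Theta_X) *)

Section LogarithmicDerivations.
Variables (R : realType) (n : nat).
Local Notation C := (CC R).
Local Notation germ := (germ R n).
Local Notation gX := (gX R).
Local Notation gC := (gC n).
Implicit Types (a b l : germ) (S : germ -> Prop).

Definition lincomb_germs k (E : 'I_k -> germ) (c : 'rV[C]_k) : germ := \sum_i gC (c 0 i) * E i.
Local Notation lc := lincomb_germs.
Definition gbasis S k (E : 'I_k -> germ) := forall a, exists! c : 'rV[C]_k, S (a - lc E c).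

Lemma lc0 k (E : 'I_k -> germ) : lc E 0 = 0.
Proof. by rewrite /lc big1 // => i _; rewrite mxE rmorph0 mul0r. Qed.

Lemma lc_mulmx S k k' (E : 'I_k -> germ) (E' : 'I_k' -> germ) (M : 'M[C]_(k', k)) c : gsubspace S ->
  (forall i, S (E' i - lc E (row i M))) -> S (lc E' c - lc E (c *m M)).
Proof.
move=> sS h; have [_ _ SZ] := sS.
have -> : lc E' c - lc E (c *m M) = \sum_i gC (c 0 i) * (E' i - lc E (row i M)).
  rewrite (eq_bigr (fun i => gC (c 0 i) * E' i - gC (c 0 i) * lc E (row i M))) => [|i _]; last by rewrite mulrBr.
  rewrite sumrB; congr (_ - _).
  rewrite (eq_bigr (fun i => \sum_j gC (c 0 i * M i j) * E j)) => [|i _]; last first.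
    by rewrite /lc mulr_sumr; apply: eq_bigr => j _; rewrite mxE rmorphM mulrA.
  rewrite exchange_big /lc; apply: eq_bigr => j _.
  by rewrite mxE rmorph_sum mulr_suml; apply: eq_bigr => i _.
by apply: subspace_sum => // i _; exact: SZ.
Qed.

(** Both change of basis matrices are square of size k. Uniqueness of coordinates modulo S' makes
    their product 1 in one order, hence in the other, and an element of S' then has zero coordinates
    modulo S. *)
Lemma gbasis_sub S S' k (E E' : 'I_k -> germ) : gsubspace S -> gsubspace S' -> (forall a, S a -> S' a) ->
  gbasis S E -> gbasis S' E' -> forall a, S' a -> S a.
Proof.
move=> sS sS' SS hE hE' a Sa; have [S0 SD SZ] := sS; have [S0' SD' SZ'] := sS'.
have /choice [M hM] : forall i, exists c, S (E' i - lc E c) by move=> i; have [c [h _]] := hE (E' i); exists c.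
have /choice [N hN] : forall i, exists c, S' (E i - lc E' c) by move=> i; have [c [h _]] := hE' (E i); exists c.
pose mM : 'M[C]_k := \matrix_i M i; pose mN : 'M[C]_k := \matrix_i N i.
have hM' c : S (lc E' c - lc E (c *m mM)) by apply: lc_mulmx => // i; rewrite rowK.
have hN' c : S' (lc E c - lc E' (c *m mN)) by apply: lc_mulmx => // i; rewrite rowK.
have MN (c : 'rV[C]_k) : c *m mM *m mN = c.
  have [c0 [_ u]] := hE' (lc E' c).
  have u1 : c0 = c by apply: u; rewrite subrr.
  have u2 : c0 = c *m mM *m mN.
    by apply: u; have := SD' _ _ (SS _ (hM' c)) (hN' (c *m mM)); rewrite addrA subrK.
  by rewrite -u2 u1.
have MN1 : mM *m mN = 1%:M.
  by apply/row_matrixP => i; rewrite !rowE mulmxA MN mulmx1.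
have [c [hc _]] := hE a.
have cN : c *m mN = 0.
  have [c0 [_ u]] := hE' 0.
  have u1 : c0 = 0 by apply: u; rewrite lc0 subrr.
  rewrite -u1; apply/esym/u.
  have -> : 0 - lc E' (c *m mN) = (lc E c - lc E' (c *m mN)) + ((a - lc E c) - a) by ring.
  by apply: SD' => //; apply: subspaceB => //; exact: SS.
have c0 : c = 0 by rewrite -[c]mulmx1 -(mulmx1C MN1) mulmxA cN mul0mx.
by move: hc; rewrite c0 lc0 subr0.
Qed.

(** The k + 1 powers 1, l, ..., l^k are dependent modulo S. Factoring out the lowest power that
    occurs leaves a unit, as l vanishes at 0, so that power lies in S. *)
Lemma gbasis_power S k (E : 'I_k -> germ) : gideal S -> gbasis S E -> forall l, ev l = 0 -> S (l ^+ k).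
Proof.
move=> iS hE l l0; have sS := gideal_subspace iS; have [_ _ SM] := iS.
have /choice [M hM] : forall i : 'I_k.+1, exists c, S (l ^+ i - lc E c).
  by move=> i; have [c [h _]] := hE (l ^+ i); exists c.
pose mM : 'M[C]_(k.+1, k) := \matrix_i M i.
have : kermx mM != 0 by rewrite -mxrank_eq0 mxrank_ker subn_eq0 -ltnNge ltnS rank_leq_col.
move=> /rowV0Pn [v /sub_kermxP vM v0].
have Sv : S (lc (fun i : 'I_k.+1 => l ^+ i) v).
  have := @lc_mulmx S k k.+1 E (fun i => l ^+ i) mM v sS; rewrite vM lc0 subr0; apply.
  by move=> i; rewrite rowK.
have [i0 hi0] : exists i, v 0 i != 0.
  apply/existsP; rewrite -negb_forall; apply: contraNN v0 => /forallP h.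
  by apply/eqP/rowP => i; rewrite mxE; apply/eqP.
pose Q (i : 'I_k.+1) := v 0 i != 0.
have [i hi hmin] := @arg_minnP _ i0 Q (fun i => val i) hi0.
pose w : germ := \sum_(j : 'I_k.+1 | (i < j)%N) gC (v 0 j) * l ^+ (j - i.+1).
have E1 : lc (fun i : 'I_k.+1 => l ^+ i) v = l ^+ i * (gC (v 0 i) + l * w).
  rewrite /lc (bigD1 i) //= mulrDr mulrC; congr (_ + _).
  rewrite (bigID (fun j : 'I_k.+1 => (i < j)%N)) /= [X in _ + X]big1 ?addr0; last first.
    move=> j /andP[ji]; rewrite -leqNgt => jle; have [->|vj] := eqVneq (v 0 j) 0; first by rewrite rmorph0 mul0r.
    by have := hmin j vj; rewrite /= leqNgt ltn_neqAle jle andbT (_ : val j != val i).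
  rewrite mulr_sumr mulr_sumr.
  rewrite (eq_bigl (fun j : 'I_k.+1 => (i < j)%N)) => [|j]; last first.
    by case: (ltnP i j) => ij; rewrite ?andbF // andbT; apply: contraTneq ij => ->; rewrite ltnn.
  by apply: eq_bigr => j ij; rewrite -{1}(subnKC ij) exprD exprS; ring.
have uw : ev (gC (v 0 i) + l * w) != 0 by rewrite rmorphD rmorphM /= ev_gC l0 mul0r addr0.
have Si : S (l ^+ i).
  have := SM (ginv (gC (v 0 i) + l * w)) _ Sv.
  by rewrite E1 mulrCA [ginv _ * _]mulrC ginvP // mulr1.
by rewrite -(subnK (ltn_ord i : (i <= k)%N)) exprD; exact: SM.
Qed.

Variables (F : germ) (I : germ -> Prop).
Hypothesis iI : gideal I.

Definition logder (D : germ -> germ) := gderivation D /\ forall a, I a -> I (D a).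
Definition Jlog a := exists2 D, logder D & a = D F.

Lemma logder_bracket D D' : logder D -> logder D' -> logder (fun a => D (D' a) - D' (D a)).
Proof.
move=> [dD ID] [dD' ID']; split; last first.
  by move=> a Ia; apply: (subspaceB (gideal_subspace iI)); [apply/ID/ID' | apply/ID'/ID].
split=> [a b|a b|k].
- by rewrite (gderD dD') (gderD dD) (gderD dD) (gderD dD') opprD addrACA.
- rewrite (gderM dD') (gderM dD) (gderD dD) (gderD dD') !(gderM dD) !(gderM dD'); ring.
- by rewrite (gderC dD') (gderC dD) (gder0 dD) (gder0 dD') subrr.
Qed.

Lemma gideal_Jlog : gideal Jlog.
Proof.
have [I0 ID IM] := iI; split.
- exists (fun=> 0) => //; split; last by [].
  by split=> *; rewrite ?addr0 ?mul0r ?mulr0 ?addr0.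
- move=> _ _ [D [dD hD] ->] [D' [dD' hD'] ->]; exists (fun a => D a + D' a) => //; split.
    split=> [a b|a b|k].
    + by rewrite (gderD dD) (gderD dD') addrACA.
    + rewrite (gderM dD) (gderM dD'); ring.
    + by rewrite (gderC dD) (gderC dD') addr0.
  by move=> a Ia; apply: ID; [exact: hD | exact: hD'].
- move=> b _ [D [dD hD] ->]; exists (fun a => b * D a) => //; split.
    split=> [a c|a c|k].
    + by rewrite (gderD dD) mulrDr.
    + rewrite (gderM dD); ring.
    + by rewrite (gderC dD) mulr0.
  by move=> a Ia; apply: IM; exact: hD.
Qed.

(* [Jlog] is stable under [T] because [[T, D] F + D F = T (D F)]; differentiating
   the least power of [l] in [Jlog] would then give a smaller one if [T l] were a unit. *)
Lemma euler_vanishes T d l : logder T -> T F = F -> ordM 3 F ->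
  (forall l, ev l = 0 -> Jlog (l ^+ d)) -> ev l = 0 -> ev (T l) = 0.
Proof.
move=> lT TF F3 hd l0; apply/eqP/negPn/negP => Tl0; have [_ _ JM] := gideal_Jlog.
have [dT IT] := lT.
have TJ a : Jlog a -> Jlog (T a).
  move=> [D lD ->]; have -> : T (D F) = (T (D F) - D (T F)) + D F by rewrite TF subrK.
  have [_ JD _] := gideal_Jlog; apply: JD; last by exists D.
  by exists (fun a => T (D a) - D (T a)) => //; exact: logder_bracket.
have [|[|p] hp hmin] := @nat_min (fun p => Jlog (l ^+ p)); first by exists d; exact: hd.
  (* The exponent 0 is excluded: F has order at least 3, so D F vanishes at 0 and is not 1. *)
  have [D [dD _] E] := hp; have : ev (D F) = 0.
    by apply/ordM1P; apply: ordM_weak (gder_ordM dD F3).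
  by rewrite -E expr0 rmorph1 => /eqP; rewrite oner_eq0.
have := hmin p; rewrite ltnn => /(_ _) H; suff : false by []; apply: H.
pose z : C := p.+1%:R; have z0 : z != 0 by rewrite pnatr_eq0.
have := JM (gC z^-1 * ginv (T l)) _ (TJ _ hp).
rewrite (gderX dT) /= (_ : gC _ * _ * _ = l ^+ p) //.
have h1 : T l * ginv (T l) = 1 := ginvP Tl0.
have h2 : gC z^-1 * gC z = 1 by rewrite -rmorphM mulVf // rmorph1.
have h3 : (p.+1)%:R = gC z by rewrite /z rmorph_nat.
rewrite h3; transitivity ((gC z^-1 * gC z) * (T l * ginv (T l)) * l ^+ p); first by ring.
by rewrite h1 h2 !mul1r.
Qed.
End LogarithmicDerivations.

(** * Dictionary between functions and germs *)

Section Assembly.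
Variables (R : realType) (n : nat).
Local Notation C := (CC R).
Local Notation V := 'rV[C]_n.
Local Notation germ := (germ R n).
Local Notation gX := (gX R).
Local Notation gC := (gC n).
Local Notation gm := (gm R).
Local Notation mon := {ffun 'I_n -> nat}.
Implicit Types (f g h : V -> C) (a b c : germ) (X : set V) (s : mon).

Lemma mk_sum k (g : 'I_k -> V -> C) : (forall i, On (g i)) -> mk (fun x => \sum_i g i x) = \sum_i mk (g i).
Proof. by move=> hg; apply/mkE/germ_eq_sym/fn_sum => i; exact/germ_eq_sym/fn_mk. Qed.
Lemma ev_mk f : On f -> ev (mk f) = f 0.
Proof. by move=> hf; rewrite /ev (germ_eq0 (fn_mk hf)). Qed.

Lemma ordM_ideal_exp k f : ideal_exp (@maxideal R n) k f -> ordM k (mk f).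
Proof.
elim: k f => [|k IH] f; first by move=> _; exact: ordM0.
move=> [hf [m [g [h [gh E]]]]].
have hg i : On (g i) by case: (gh i) => [[]].
have hh i : On (h i) by case: (gh i) => _; case: (k) => [|k'] //= [].
rewrite (mk_eq hf E) mk_sum => [|i]; last exact: On_mul.
apply: ordM_sum => i _; rewrite mkM //; apply: (@ordM_mul _ _ 1 k); last by apply: IH; case: (gh i).
by apply/ordM1P; rewrite ev_mk //; case: (gh i) => [[]].
Qed.

Definition vanishing_germs X a := vanishing_ideal X (fn a).
Local Notation IX := vanishing_germs.

Lemma vanishing_germ_eq X f g : germ_eq f g -> vanishing_ideal X f -> vanishing_ideal X g.
Proof.
move=> E [hf h]; split; first exact: germ_eq_On E hf.
by move: E h; apply: filterS2 => p -> h /h.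
Qed.
Lemma vanishing_mk X f : On f -> vanishing_ideal X f <-> IX X (mk f).
Proof.
move=> hf; split; apply: vanishing_germ_eq; [exact: fn_mk | exact/germ_eq_sym/fn_mk].
Qed.

Lemma gideal_vanishing X : gideal (IX X).
Proof.
split=> [|a b [_ ha] [_ hb]|a b [_ hb]]; (split; first exact: fn_On).
- by have := fn_gC n (0 : C); rewrite rmorph0; apply: filterS => p ->.
- by move: (fnD a b) ha hb; apply: filterS3 => p -> h1 h2 Xp; rewrite h1 // h2 // addr0.
- by move: (fnM a b) hb; apply: filterS2 => p -> h Xp; rewrite h // mulr0.
Qed.

(** By [fn_derivation] a logarithmic field yields the derivation [dv] of its components; conversely
    D yields the field with components D x_i, and [gderE] recovers D from it. *)
Lemma df_logE X f g : On f -> On g -> df_log X f g <-> Jlog (mk f) (IX X) (mk g).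
Proof.
move=> hf hg; split.
  move=> [_ [v [vv hv] E]]; pose D := dv (fun i => mk (fun p => v p 0 i)); exists D.
    split; first exact: gder_dv.
    move=> a Ia; apply: vanishing_germ_eq (hv _ Ia); rewrite /D -{2}(mkK a).
    by apply: fn_derivation => //; exact: fn_On.
  by rewrite (mk_eq hg E); apply: mkE; exact: fn_derivation.
move=> [D [dD ID] E]; split => //.
pose v (p : V) : V := \row_i fn (D (gX i)) p.
have vi i : mk (fun p => v p 0 i) = D (gX i).
  by rewrite (_ : (fun p => v p 0 i) = fn (D (gX i))) ?mkK //; apply/funext => p; rewrite mxE.
have vv : vector_fields v.
  have : \forall x \near (0 : V), forall i, differentiable (fn (D (gX i))) x.
    by apply: (@filter_forall _ 'I_n (fun i x => differentiable (fn (D (gX i))) x) (nbhs (0 : V)) _) => i; exact: fn_On.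
  apply: filterS => x hx; apply: differentiable_row => j.
  by rewrite (_ : (fun p => v p 0 j) = fn (D (gX j))) //; apply/funext => p; rewrite mxE.
have DE : dv (fun i => mk (fun p => v p 0 i)) = D.
  by rewrite [RHS](gderE dD); congr dv; apply/funext => i.
have hD h : On h -> germ_eq (derivation v h) (fn (D (mk h))) by move=> hh; rewrite -DE; exact: fn_derivation.
exists v; first split => // h hh.
  have [oh _] := hh; apply: vanishing_germ_eq (germ_eq_sym (hD h oh)) _.
  by apply: ID; exact: (vanishing_mk X oh).1.
apply: germ_eq_trans (fn_mk hg) _; rewrite E; exact/germ_eq_sym/hD.
Qed.

Definition Jtjurina X (F : germ) a := exists2 b, Jlog F (IX X) b & exists c, a = b + c * F.

Lemma tjurinaE X f g : On f -> On g ->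
  ideal_add (df_log X f) (ideal_gen (fun _ : 'I_1 => f)) g <-> Jtjurina X (mk f) (mk g).
Proof.
move=> hf hg; split.
  move=> [_ [g1 [h1 [dg [oh [a [ha Ea]]] E]]]].
  have og1 : On g1 by case: dg.
  exists (mk g1); first exact/df_logE.
  exists (mk (a 0)); rewrite -mkM // -mkD //; last exact: On_mul.
  apply: mk_eq => //; move: E Ea; apply: filterS2 => p -> ->.
  by rewrite big_ord1.
move=> [b Jb [c E]]; split => //; exists (fn b), (fun x => fn c x * f x); split.
- by apply/df_logE => //; [exact: fn_On | rewrite mkK].
- split; first by apply: On_mul => //; exact: fn_On.
  exists (fun=> fn c); split; first by move=> _; exact: fn_On.
  by apply: filterS (filterT : \forall p \near (0 : V), True) => p _; rewrite big_ord1.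
- apply: germ_eq_trans (fn_mk hg) _; rewrite E.
  by move: (fnD b (c * mk f)) (fnM c (mk f)) (fn_mk hf); apply: filterS3 => p -> -> ->.
Qed.

Lemma gideal_Jtjurina X F : gideal (Jtjurina X F).
Proof.
have [J0 JD JM] := gideal_Jlog F (gideal_vanishing X); split.
- by exists 0 => //; exists 0; rewrite mul0r addr0.
- move=> _ _ [b1 h1 [c1 ->]] [b2 h2 [c2 ->]]; exists (b1 + b2); first exact: JD.
  by exists (c1 + c2); rewrite mulrDl addrACA.
- move=> a _ [b hb [c ->]]; exists (a * b); first exact: JM.
  by exists (a * c); rewrite mulrDr mulrA.
Qed.

Lemma quotient_basis_germ (J : set (V -> C)) (S : germ -> Prop) k (e : 'I_k -> V -> C) :
  (forall g, On g -> J g <-> S (mk g)) -> quotient_basis J e -> gbasis S (fun i => mk (e i)).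
Proof.
move=> JS [he hb] a.
have hc (c : 'rV[C]_k) : On (fun x => fn a x - \sum_i c 0 i * e i x) /\
    mk (fun x => fn a x - \sum_i c 0 i * e i x) = a - lincomb_germs (fun i => mk (e i)) c.
  have E : germ_eq (fn (a - lincomb_germs (fun i => mk (e i)) c)) (fun x => fn a x - \sum_i c 0 i * e i x).
    have h1 : germ_eq (fn (lincomb_germs (fun i => mk (e i)) c)) (fun p => \sum_i c 0 i * e i p).
      apply: fn_sum => i; move: (fn_gCM (c 0 i) (mk (e i))) (fn_mk (he i)).
      by apply: filterS2 => p -> ->.
    move: (fnD a (- lincomb_germs (fun i => mk (e i)) c)) (fnN (lincomb_germs (fun i => mk (e i)) c)) h1.
    by apply: filterS3 => p -> -> ->.
  by split; [apply: germ_eq_On E _; exact: fn_On | exact/mkE/germ_eq_sym].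
have [c [h1 h2]] := hb (fn a) (fn_On a); exists c; split.
  by have [oc <-] := hc c; exact: (JS _ oc).1.
move=> c' h; apply: h2; have [oc E] := hc c'; apply: (JS _ oc).2.
by rewrite E.
Qed.

(** The default of [xget] is +oo, so a finite value comes from an actual basis. *)
Lemma quotient_dim_basis (J : set (V -> C)) : (quotient_dim J < +oo)%E ->
  exists k (e : 'I_k -> V -> C), quotient_basis J e /\ quotient_dim J = (k%:R)%:E.
Proof.
rewrite /quotient_dim; set P := image _ _ => h.
have [[z Pz]|NP] := pselect (exists z, P z); last first.
  by move: h; rewrite xgetPN ?ltxx // => z Pz; apply: NP; exists z.
have [k [e he] <-] := xgetI +oo%E Pz.
by exists k, e.
Qed.

Lemma fn_gm s : germ_eq (fn (gm s)) (fun p => \prod_i p 0 i ^+ s i).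
Proof.
move: s; apply: mon_ind => [|i s IH].
  rewrite gm0; have := fn_gC n (1 : C); rewrite rmorph1; apply: filterS => p ->.
  by rewrite big1 // => i _; rewrite ffunE expr0.
rewrite gm_add gm_unit; move: (fnM (gm s) (gX i)) IH (fn_gX R i).
apply: filterS3 => p -> -> ->.
rewrite [RHS](eq_bigr (fun j => p 0 j ^+ s j * p 0 j ^+ munit i 1 j)) => [|j _]; last by rewrite ffunE exprD.
rewrite big_split /=; congr (_ * _).
by rewrite (bigD1 i) //= ffunE eqxx expr1 big1 ?mulr1 // => j ji; rewrite ffunE (negPf ji) expr0.
Qed.

(** With S = 1 + sum of the 1 / q_i each S q_i is at least 1, so |s| is at most S times the
    weight. *)
Lemma weight_bound (q : 'I_n -> rat) w : (forall i, 0 < q i) -> exists N, forall s, weight q s = w -> (mdeg s < N)%N.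
Proof.
move=> q0; pose S : rat := 1 + \sum_i (q i)^-1.
have qi0 i : 0 <= (q i)^-1 by rewrite invr_ge0 ltW.
have S0 : 0 < S by rewrite ltr_wpDr // sumr_ge0.
have hS i : 1 <= S * q i.
  rewrite -ler_pdivrMr // div1r /S (bigD1 i) //= addrCA lerDl addr_ge0 // sumr_ge0 //.
exists (Num.bound `|S * w|) => s ws.
rewrite -(ltr_nat rat); apply: (@le_lt_trans _ _ (S * w)).
  rewrite -ws /weight /mdeg natr_sum mulr_sumr; apply: ler_sum => i _.
  by rewrite mulrA -[leLHS]mul1r; apply: ler_wpM2r.
by apply: (le_lt_trans (ler_norm _)); apply: archi_boundP.
Qed.

(** Positive weights leave finitely many exponents of weight w, so in the coordinates the series is
    a polynomial and the finitely supported sum is an ordinary one. *)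
Lemma quasihomogeneous_of_germ (x y : V -> V) (q : 'I_n -> rat) w f : cmap x -> cmap y ->
  (\forall p \near (0 : V), y (x p) = p) -> (forall i, 0 < q i) -> On f ->
  (forall s, cf (sub y (mk f)) s != 0 -> weight q s = w) -> quasihomogeneous x q w f.
Proof.
move=> cx cy xy q0 hf hw; have [N hN] := weight_bound w q0.
pose r := [seq s <- mons n N | weight q s == w].
have ur : uniq r by apply/filter_uniq/mons_uniq.
have mr s : (s \in r) = (weight q s == w).
  by rewrite mem_filter mem_mons; case: eqP => //= /hN ->.
pose a := cf (sub y (mk f)); exists a.
have GE : sub y (mk f) = \sum_(s <- r) gC (a s) * gm s.
  apply: cf_inj; apply/funext => s; rewrite cf_lin // mr; case: eqP => // h.
  by apply/eqP/negPn/negP => /hw.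
have E1 : germ_eq (fn (sub y (mk f))) (fun p => \sum_(s <- r) a s * \prod_i p 0 i ^+ s i).
  rewrite GE; apply: fn_sum => s; move: (fn_gCM (a s) (gm s)) (fn_gm s).
  by apply: filterS2 => p -> ->.
have E2 : germ_eq f (fn (sub y (mk f)) \o x).
  by apply: germ_eq_trans (fn_mk hf) _; rewrite -{1}(sub_xy cx cy xy (mk f)); exact: fn_sub.
move: E2 (comp_germ_eq cx E1); apply: filterS2 => p -> -> /=.
have -> : [set s | weight q s = w] = [set` r].
  by apply/seteqP; split => s /=; rewrite mr => /eqP.
by rewrite -fsbig_seq.
Qed.
End Assembly.

Theorem theorem4p1 (R : realType) (n : nat) (X : set 'rV[CC R]_n)
    (f : 'rV[CC R]_n -> CC R)
    (hX : analytic_germ X)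
    (hf : On f)
    (hmu : (BR_milnor X f < +oo)%E)
    (hf3 : ideal_exp (@maxideal R n) 3 f)
    (hmutau : BR_milnor X f = BR_tjurina X f) :
  exists w : 'I_n -> rat,
    (forall i, 0 < w i < 1 / 2) /\ relatively_quasihomogeneous f X w.
Proof.
pose F := mk f; pose I := vanishing_germs X.
have iI : gideal I := gideal_vanishing X.
have I0 a : I a -> ev a = 0 by move=> [_ /nbhs_singleton h]; exact: h hX.1.
have F3 : ordM 3 F := ordM_ideal_exp hf3.
have [k [e [be muk]]] := quotient_dim_basis hmu.
have htau : (BR_tjurina X f < +oo)%E by rewrite -hmutau.
have [k' [e' [be' tauk]]] := quotient_dim_basis htau.
have kk : k' = k.
  move: hmutau; rewrite /BR_milnor /BR_tjurina muk tauk => -[] /eqP.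
  by rewrite eqr_nat => /eqP.
subst k'.
have iJ := gideal_Jlog F iI.
have bJ := quotient_basis_germ (fun g hg => df_logE X hf hg) be.
have bJ' := quotient_basis_germ (fun g hg => tjurinaE X hf hg) be'.
(* Equal finite codimension makes the inclusion of df(Theta_X) in df(Theta_X) + (f) an equality. *)
have JF : Jlog F I F.
  apply: (gbasis_sub (gideal_subspace iJ) (gideal_subspace (gideal_Jtjurina X F)) _ bJ bJ').
    by move=> a Ja; exists a => //; exists 0; rewrite mul0r addr0.
  by have [J0 _ _] := iJ; exists 0 => //; exists 1; rewrite mul1r add0r.
have [T lT /esym TF] := JF; have [dT TI] := lT.
(* Here k = mu_X(f) serves as the exponent d. *)
have FC l : ev l = 0 -> Jlog F I (l ^+ k) by exact: gbasis_power.
have T0 i : ev (T (gX R i)) = 0 by apply: (euler_vanishes iI lT TF F3 FC); exact: ev_gX.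
have FC' l : ev l = 0 -> exists2 D, gderivation D & l ^+ k = D F.
  by move=> /FC [D [dD _] ->]; exists D.
have [x [y [q [[cx cy xy yx] hq qF [m [h [w [w0 Ih hw gen]]]]]]]] :=
  quasihomogeneous_coordinates dT T0 TF F3 FC' iI TI I0.
have q0 i : 0 < q i by case/andP: (hq i).
exists q; split => //; split => //.
exists x, m, (fun i => fn (h i)), w; split.
- have [[vx x0] [vy y0]] := (cx, cy); split => //; by exists y.
- split; first exact: Ih.
  apply/seteqP; split => [g vg|g [og [a [oa E]]]].
    have [og _] := vg; split => //.
    have [c E] := gen (mk g) ((vanishing_mk X og).1 vg).
    exists (fun i => fn (c i)); split; first by move=> i; exact: fn_On.
    apply: germ_eq_trans (fn_mk og) _; rewrite E; apply: fn_sum => i; exact: fnM.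
  apply/(vanishing_mk X og); rewrite (mk_eq og E) mk_sum => [|i]; last by apply: On_mul => //; exact: fn_On.
  apply: subspace_sum; first exact: gideal_subspace.
  move=> i _; rewrite mkM ?mkK //; last exact: fn_On.
  by have [_ _ IM] := iI; apply: IM; exact: Ih.
- exact: (quasihomogeneous_of_germ cx cy xy q0 hf).
- move=> i; split => //; apply: (quasihomogeneous_of_germ cx cy xy q0 (fn_On (h i))) => s.
  by rewrite mkK; exact: hw.
Qed.
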